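(* $Q_5$ is a finitely generated $R$-module, and $Q_5 = Q_5^{(3)}$, i.e. $Q_5 = Q_4 u_4 Q_4 u_4 Q_4 u_4 Q_4$.
   Context: $R=\mathbb{Z}[a^{\pm1},b^{\pm1},c^{\pm1}]$. $B_n$ is the braid group with Artin generators $s_1,\dots,s_{n-1}$. For $n\ge 3$, $Q_n$ is the quotient of $RB_n$ by the relations $(s_1-a)(s_1-b)(s_1-c)=0$ and $$s_1^{-1}s_2s_1 = s_1 s_2 s_1^{-1} - a^{-1} s_1 s_2 + a s_1 s_2^{-1} + a s_1^{-1}s_2 - a^3 s_1^{-1} s_2^{-1}+ a^{-1} s_2 s_1 - a s_2 s_1^{-1} - a s_2^{-1} s_1 + a^3 s_2^{-1}s_1^{-1} + a^2 s_1^{-1} s_2^{-1} s_1- a^2 s_1 s_2^{-1} s_1^{-1}.$$ Inside $Q_5$, we write $Q_4$ for the image of the natural morphism $Q_4\to Q_5$ (the subalgebra generated by $s_1,s_2,s_3$), and $u_4=R+Rs_4+Rs_4^{-1}$ for the subalgebra generated by $s_4$. For $k\ge 1$, $Q_5^{(k)} = Q_4u_4Q_4u_4\cdots u_4Q_4$ with $k+1$ factors $Q_4$ ($R$-span of products). *)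

(* Defs.v *)
From HB Require Import structures.
From mathcomp Require Import all_boot all_order all_algebra.
From mathcomp Require Import ring.
From mathcomp Require Import finmap boolp classical_sets monalg.

Set Implicit Arguments.
Unset Strict Implicit.
Unset Printing Implicit Defensive.

Import GRing.Theory.

Local Open Scope quotient_scope.
Local Open Scope ring_scope.
Local Open Scope classical_set_scope.

(* Group algebras: finitely supported functions G -> R with the convolution   *)
(* product.  The ring structure that monalg puts on {malg R[K]} requires K to *)
(* be a monoid without nontrivial units, hence the separate type galg R G.    *)

Section Convolution.
Variables (R : nzRingType) (G : groupType).
Implicit Types (x y z : {malg R[G]}) (d : {fset G}).

Definition conv x y : {malg R[G]} :=
  \sum_(g <- msupp x) \sum_(h <- msupp y) mkmalgU (g * h)%g (x@_g * y@_h).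

Let convw d1 d2 x y : fsubset (msupp x) d1 -> fsubset (msupp y) d2 ->
  conv x y = \sum_(g <- d1) \sum_(h <- d2) mkmalgU (g * h)%g (x@_g * y@_h).
Proof.
move=> le1 le2; rewrite /conv (big_fset_incl _ le1) /=.
  apply: eq_bigr => g _; apply: big_fset_incl => // h _ /mcoeff_outdom ->.
  by rewrite mulr0 monalgU0.
move=> g _ /mcoeff_outdom xg0.
by rewrite big1 // => h _; rewrite xg0 mul0r monalgU0.
Qed.

Lemma convUU (g h : G) (p q : R) :
  conv (mkmalgU g p) (mkmalgU h q) = mkmalgU (g * h)%g (p * q).
Proof. by rewrite (convw msuppU_le msuppU_le) !big_seq_fset1 !mcoeffUU. Qed.

Lemma convDl : left_distributive conv +%R.
Proof.
move=> x y z; pose d := fsetU (msupp x) (msupp y).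
rewrite (convw (d1 := d) (msuppD_le _ _) (fsubset_refl _)).
rewrite (convw (d1 := d) (fsubsetUl _ _) (fsubset_refl (msupp z))).
rewrite (convw (d1 := d) (fsubsetUr _ _) (fsubset_refl (msupp z))).
rewrite -big_split /=; apply: eq_bigr => g _.
rewrite -big_split /=; apply: eq_bigr => h _.
by rewrite mcoeffD mulrDl monalgUD.
Qed.

Lemma convDr : right_distributive conv +%R.
Proof.
move=> z x y; pose d := fsetU (msupp x) (msupp y).
rewrite (convw (d2 := d) (fsubset_refl _) (msuppD_le _ _)).
rewrite (convw (d2 := d) (fsubset_refl (msupp z)) (fsubsetUl _ _)).
rewrite (convw (d2 := d) (fsubset_refl (msupp z)) (fsubsetUr _ _)).
rewrite -big_split /=; apply: eq_bigr => g _.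
rewrite -big_split /=; apply: eq_bigr => h _.
by rewrite mcoeffD mulrDr monalgUD.
Qed.

Let conv0x : left_zero 0 conv.
Proof. by move=> x; rewrite /conv msupp0 big_seq_fset0. Qed.

Let convx0 : right_zero 0 conv.
Proof.
by move=> x; rewrite /conv big1 // => g _; rewrite msupp0 big_seq_fset0.
Qed.

Lemma malg_ind (P : {malg R[G]} -> Prop) :
  P 0 -> (forall x y, P x -> P y -> P (x + y)) ->
  (forall g p, P (mkmalgU g p)) -> forall x, P x.
Proof. by move=> P0 PD PU x; rewrite [x]monalgE; apply: big_ind. Qed.

Lemma convA : associative conv.
Proof.
move=> x y z; elim/malg_ind: x => [|x1 x2 IH1 IH2|g p].
- by rewrite !conv0x.
- by rewrite !convDl IH1 IH2.
elim/malg_ind: y => [|y1 y2 IH1 IH2|h q].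
- by rewrite !(conv0x, convx0).
- by rewrite !(convDl, convDr) IH1 IH2.
elim/malg_ind: z => [|z1 z2 IH1 IH2|k r].
- by rewrite !convx0.
- by rewrite !convDr IH1 IH2.
by rewrite !convUU mulrA mulgA.
Qed.

Lemma conv1x : left_id (mkmalgU (1%g : G) 1) conv.
Proof.
elim/malg_ind=> [|x y IHx IHy|g p]; first exact: convx0.
- by rewrite convDr IHx IHy.
- by rewrite convUU mul1r mul1g.
Qed.

Lemma convx1 : right_id (mkmalgU (1%g : G) 1) conv.
Proof.
elim/malg_ind=> [|x y IHx IHy|g p]; first exact: conv0x.
- by rewrite convDl IHx IHy.
- by rewrite convUU mulr1 mulg1.
Qed.

Lemma malg_scaleU (p q : R) (g : G) :
  p *: mkmalgU g q = mkmalgU g (p * q) :> {malg R[G]}.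
Proof. by apply/malgP => h; rewrite mcoeffZ !mcoeffU mulrnAr. Qed.

Lemma convZl p x y : p *: conv x y = conv (p *: x) y.
Proof.
elim/malg_ind: x => [|x1 x2 IH1 IH2|g q].
- by rewrite scaler0 !conv0x scaler0.
- by rewrite scalerDr !convDl scalerDr IH1 IH2.
elim/malg_ind: y => [|y1 y2 IH1 IH2|h r].
- by rewrite !convx0 scaler0.
- by rewrite !convDr scalerDr IH1 IH2.
by rewrite !(malg_scaleU, convUU) mulrA.
Qed.

End Convolution.

Definition galg (R : nzRingType) (G : groupType) : Type := {malg R[G]}.

HB.lock Definition gelt (R : nzRingType) (G : groupType) (g : G) : galg R G :=
  mkmalgU g 1.

HB.lock Definition galg_zero (R : nzRingType) (G : groupType) : galg R G :=
  (0 : {malg R[G]}).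

HB.lock Definition galg_opp (R : nzRingType) (G : groupType) (x : galg R G) :
    galg R G :=
  - (x : {malg R[G]}).

HB.lock Definition galg_add (R : nzRingType) (G : groupType) (x y : galg R G) :
    galg R G :=
  (x : {malg R[G]}) + (y : {malg R[G]}).

HB.lock Definition galg_scale (R : nzRingType) (G : groupType) (p : R)
    (x : galg R G) : galg R G :=
  p *: (x : {malg R[G]}).

HB.lock Definition galg_mul (R : nzRingType) (G : groupType) (x y : galg R G) :
    galg R G :=
  conv x y.

Section GroupAlgebra.
Variables (R : nzRingType) (G : groupType).
Implicit Types (p q : R) (g h : G) (x y z : galg R G).

HB.instance Definition _ := Choice.copy (galg R G) {malg R[G]}.

Fact galg_addA : associative (@galg_add R G).
Proof. by rewrite galg_add.unlock => x y z; exact: (@addrA {malg R[G]}). Qed.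

Fact galg_addC : commutative (@galg_add R G).
Proof. by rewrite galg_add.unlock => x y; exact: (@addrC {malg R[G]}). Qed.

Fact galg_add0 : left_id (galg_zero R G) (@galg_add R G).
Proof.
by rewrite galg_add.unlock galg_zero.unlock => x; exact: (@add0r {malg R[G]}).
Qed.

Fact galg_addN : left_inverse (galg_zero R G) (@galg_opp R G) (@galg_add R G).
Proof.
rewrite galg_add.unlock galg_zero.unlock galg_opp.unlock => x.
exact: (@addNr {malg R[G]}).
Qed.

HB.instance Definition _ :=
  GRing.isZmodule.Build (galg R G) galg_addA galg_addC galg_add0 galg_addN.

Lemma galg_0E : 0 = galg_zero R G. Proof. by []. Qed.
Lemma galg_DE x y : x + y = galg_add x y. Proof. by []. Qed.

Fact galg_mulA : associative (@galg_mul R G).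
Proof. by rewrite galg_mul.unlock; exact: convA. Qed.

Fact galg_mul1x : left_id (gelt R (1%g : G)) (@galg_mul R G).
Proof. by rewrite galg_mul.unlock gelt.unlock; exact: conv1x. Qed.

Fact galg_mulx1 : right_id (gelt R (1%g : G)) (@galg_mul R G).
Proof. by rewrite galg_mul.unlock gelt.unlock; exact: convx1. Qed.

Fact galg_mulDl : left_distributive (@galg_mul R G) +%R.
Proof.
by move=> x y z; rewrite !galg_DE galg_mul.unlock galg_add.unlock;
  exact: convDl.
Qed.

Fact galg_mulDr : right_distributive (@galg_mul R G) +%R.
Proof.
by move=> x y z; rewrite !galg_DE galg_mul.unlock galg_add.unlock;
  exact: convDr.
Qed.

Fact galg_1neq0 : gelt R (1%g : G) != 0.
Proof.
by rewrite galg_0E gelt.unlock galg_zero.unlock monalgU_eq0 oner_neq0.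
Qed.

HB.instance Definition _ := GRing.Zmodule_isNzRing.Build (galg R G)
  galg_mulA galg_mul1x galg_mulx1 galg_mulDl galg_mulDr galg_1neq0.

Fact galg_scaleA p q x :
  galg_scale p (galg_scale q x) = galg_scale (p * q) x.
Proof. by rewrite galg_scale.unlock; exact: (@scalerA _ {malg R[G]}). Qed.

Fact galg_scale1 : left_id 1 (@galg_scale R G).
Proof. by rewrite galg_scale.unlock; exact: (@scale1r _ {malg R[G]}). Qed.

Fact galg_scaleDr : right_distributive (@galg_scale R G) +%R.
Proof.
move=> p x y; rewrite !galg_DE galg_scale.unlock galg_add.unlock.
exact: (@scalerDr _ {malg R[G]}).
Qed.

Fact galg_scaleDl x : {morph (@galg_scale R G)^~ x : p q / p + q}.
Proof.
move=> p q; rewrite galg_DE galg_scale.unlock galg_add.unlock.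
exact: (@scalerDl _ {malg R[G]}).
Qed.

HB.instance Definition _ := GRing.Zmodule_isLmodule.Build R (galg R G)
  galg_scaleA galg_scale1 galg_scaleDr galg_scaleDl.

Lemma galg_ME x y : x * y = galg_mul x y. Proof. by []. Qed.
Lemma galg_ZE p x : p *: x = galg_scale p x. Proof. by []. Qed.

Fact galg_scaleAl p x y : p *: (x * y) = (p *: x) * y.
Proof.
by rewrite !galg_ME !galg_ZE galg_mul.unlock galg_scale.unlock; exact: convZl.
Qed.

HB.instance Definition _ :=
  GRing.Lmodule_isLalgebra.Build R (galg R G) galg_scaleAl.

Lemma gelt1 : gelt R (1%g : G) = 1.
Proof. by []. Qed.

Lemma geltM g h : gelt R (g * h)%g = gelt R g * gelt R h.
Proof. by rewrite galg_ME galg_mul.unlock gelt.unlock convUU mulr1. Qed.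

Lemma galg_ind (P : galg R G -> Prop) :
  P 0 -> (forall x y, P x -> P y -> P (x + y)) ->
  (forall p g, P (p *: gelt R g)) -> forall x, P x.
Proof.
move=> P0 PD PU; apply: malg_ind => [|x y Px Py|g p].
- by move: P0; rewrite galg_0E galg_zero.unlock.
- by move: (PD x y Px Py); rewrite galg_DE galg_add.unlock.
- by move: (PU p g); rewrite galg_ZE galg_scale.unlock gelt.unlock malg_scaleU
    mulr1.
Qed.

End GroupAlgebra.

Section GroupAlgebraCom.
Variables (R : comNzRingType) (G : groupType).

Fact galg_scaleAr (p : R) (x y : galg R G) : p *: (x * y) = x * (p *: y).
Proof.
have geltZ g q z : gelt R g * (q *: z) = q *: (gelt R g * z) :> galg R G.
  elim/galg_ind: z => [|z1 z2 IH1 IH2|r h].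
  - by rewrite !(scaler0, mulr0).
  - by rewrite !(scalerDr, mulrDr) IH1 IH2.
  rewrite scalerA; have E t : gelt R g * (t *: gelt R h) = t *: gelt R (g * h)%g.
    rewrite !galg_ZE galg_ME galg_mul.unlock galg_scale.unlock gelt.unlock.
    by rewrite !malg_scaleU convUU mul1r mulr1.
  by rewrite !E scalerA.
elim/galg_ind: x => [|x1 x2 IH1 IH2|q g].
- by rewrite !(mul0r, scaler0).
- by rewrite !(mulrDl, scalerDr) IH1 IH2.
by rewrite -!scalerAl geltZ !scalerA mulrC.
Qed.

HB.instance Definition _ :=
  GRing.Lalgebra_isAlgebra.Build R (galg R G) galg_scaleAr.

Lemma galg_UM (p q : R) (g h : G) :
  (p *: gelt R g) * (q *: gelt R h) = (p * q) *: gelt R (g * h)%g.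
Proof. by rewrite -scalerAl -scalerAr scalerA geltM. Qed.

End GroupAlgebraCom.

(* A Z-module regarded as a multiplicative group. *)
Definition mulgrp (V : zmodType) : Type := V.

HB.instance Definition _ (V : zmodType) := Choice.on (mulgrp V).
HB.instance Definition _ (V : zmodType) :=
  isGroup.Build (mulgrp V) (@addrA V) (@add0r V) (@addr0 V)
    (@addNr V) (@addrN V).

Lemma mulgrpC (V : zmodType) (u v : mulgrp V) : (u * v = v * u)%g.
Proof. exact: addrC. Qed.

(* The ring Z[a^{+-1}, b^{+-1}, c^{+-1}] is the group ring of Z^3; the        *)
(* monomial a^i b^j c^k is lmon (i, j, k).                                    *)
Definition laurent3 : Type := galg int (mulgrp (int * int * int)%type).

HB.instance Definition _ := GRing.NzRing.on laurent3.

Definition lmon (u : int * int * int) : laurent3 :=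
  gelt int (u : mulgrp (int * int * int)%type).

Fact laurent3_mulC : @commutative laurent3 laurent3 *%R.
Proof.
move=> x y; elim/galg_ind: x => [|x1 x2 IH1 IH2|q g].
- by rewrite mul0r mulr0.
- by rewrite mulrDl mulrDr IH1 IH2.
elim/galg_ind: y => [|y1 y2 IH1 IH2|r h].
- by rewrite mul0r mulr0.
- by rewrite mulrDl mulrDr IH1 IH2.
by rewrite [LHS]galg_UM [RHS]galg_UM [q * r]mulrC mulgrpC.
Qed.

HB.instance Definition _ :=
  GRing.PzRing_hasCommutativeMul.Build laurent3 laurent3_mulC.

Definition laurent3_unit : pred laurent3 := fun x => `[< exists y, y * x = 1 >].

Definition laurent3_inv (x : laurent3) : laurent3 :=
  if pselect (exists y, y * x = 1) is left e then projT1 (cid e) else x.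

Fact laurent3_mulVx : {in laurent3_unit, left_inverse 1 laurent3_inv *%R}.
Proof.
move=> x /asboolP ex; rewrite /laurent3_inv; case: pselect => // e.
exact: projT2 (cid e).
Qed.

Fact laurent3_unitPl (x y : laurent3) : y * x = 1 -> laurent3_unit x.
Proof. by move=> yx1; apply/asboolP; exists y. Qed.

Fact laurent3_invr_out : {in [predC laurent3_unit], laurent3_inv =1 id}.
Proof.
move=> x /negP ux; rewrite /laurent3_inv; case: pselect => // e.
by case: ux; apply/asboolP.
Qed.

HB.instance Definition _ := GRing.ComNzRing_hasMulInverse.Build laurent3
  laurent3_mulVx laurent3_unitPl laurent3_invr_out.

Definition La : laurent3 := lmon (1, 0, 0).
Definition Lb : laurent3 := lmon (0, 1, 0).
Definition Lc : laurent3 := lmon (0, 0, 1).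

Lemma lmonD u v : lmon (u + v) = lmon u * lmon v.
Proof. exact: geltM. Qed.

Lemma lmon_unit u : lmon u \is a GRing.unit.
Proof.
by apply/unitrPr; exists (lmon (- u)); rewrite -lmonD subrr; exact: gelt1.
Qed.

Lemma La_unit : La \is a GRing.unit. Proof. exact: lmon_unit. Qed.
Lemma Lb_unit : Lb \is a GRing.unit. Proof. exact: lmon_unit. Qed.
Lemma Lc_unit : Lc \is a GRing.unit. Proof. exact: lmon_unit. Qed.

Lemma lmonV u : (lmon u)^-1 = lmon (- u).
Proof.
by apply: (mulrI (lmon_unit u)); rewrite divrr ?lmon_unit // -lmonD subrr.
Qed.

(* The letter (i, true) stands for the Artin generator s_{i+1} (ordinals      *)
(* start at 0) and (i, false) for its inverse.                                *)
Section BraidGroup.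
Variable n : nat.

Definition braid_word : Type := seq ('I_n.-1 * bool).

HB.instance Definition _ := Choice.on braid_word.

Definition winv (w : braid_word) : braid_word :=
  rev [seq (l.1, ~~ l.2) | l <- w].

Inductive braid_eq : braid_word -> braid_word -> Prop :=
| braid_eq_refl w : braid_eq w w
| braid_eq_sym v w : braid_eq v w -> braid_eq w v
| braid_eq_trans u v w : braid_eq u v -> braid_eq v w -> braid_eq u w
| braid_eq_cat v v' w w' :
    braid_eq v v' -> braid_eq w w' -> braid_eq (v ++ w) (v' ++ w')
| braid_eq_cancel i e : braid_eq [:: (i, e); (i, ~~ e)] [::]
| braid_eq_comm (i j : 'I_n.-1) : (i.+1 < j)%N ->
    braid_eq [:: (i, true); (j, true)] [:: (j, true); (i, true)]
| braid_eq_braid (i j : 'I_n.-1) : i.+1 = j :> nat ->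
    braid_eq [:: (i, true); (j, true); (i, true)]
             [:: (j, true); (i, true); (j, true)].

Definition braid_eqb : rel braid_word := fun v w => `[< braid_eq v w >].

Fact braid_eqb_equiv : equiv_class_of braid_eqb.
Proof.
split=> [w|v w|v u w].
- by apply/asboolP; exact: braid_eq_refl.
- by apply/asboolP/asboolP; exact: braid_eq_sym.
- by move=> /asboolP uv /asboolP vw; apply/asboolP; exact: braid_eq_trans vw.
Qed.

Canonical braid_equiv := EquivRelPack braid_eqb_equiv.

Definition braid : Type := {eq_quot braid_equiv}.

HB.instance Definition _ := Choice.on braid.
HB.instance Definition _ := Quotient.on braid.

Lemma braid_eq_winvr w : braid_eq (w ++ winv w) [::].
Proof.
elim: w => [|[i e] w IH]; first exact: braid_eq_refl.
have -> : ((i, e) :: w) ++ winv ((i, e) :: w) =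
    [:: (i, e)] ++ ((w ++ winv w) ++ [:: (i, ~~ e)]).
  by rewrite /winv /= rev_cons -cats1 -catA.
apply: braid_eq_trans (braid_eq_cancel i e).
apply: (braid_eq_cat (v' := [:: (i, e)]) (w' := [:: (i, ~~ e)])).
  exact: braid_eq_refl.
apply: (braid_eq_cat (v' := [::]) (w' := [:: (i, ~~ e)])) => //.
exact: braid_eq_refl.
Qed.

Lemma winvK : involutive winv.
Proof.
move=> w; rewrite /winv map_rev revK -map_comp map_id_in //.
by case=> i e _ /=; rewrite negbK.
Qed.

Lemma braid_eq_winvl w : braid_eq (winv w ++ w) [::].
Proof. by rewrite -{2}[w]winvK; exact: braid_eq_winvr. Qed.

End BraidGroup.

Arguments winv {n} w.

HB.lock Definition bword (n : nat) (w : braid_word n) : braid n :=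
  \pi_{eq_quot (braid_equiv n)} w.

Section BraidGroupTheory.
Variable n : nat.
Local Notation braid_word := (braid_word n).
Local Notation braid := (braid n).
Implicit Types (u v w : braid_word).

Lemma bwordP v w : bword v = bword w <-> braid_eq v w.
Proof.
rewrite bword.unlock; split=> [/eqmodP/asboolP//|vw].
by apply/eqmodP/asboolP.
Qed.

Lemma bword_repr (x : braid) : bword (repr x) = x.
Proof. by rewrite bword.unlock reprK. Qed.

Lemma braid_repr_eq w : braid_eq (repr (bword w)) w.
Proof. by apply/bwordP; rewrite bword_repr. Qed.

Definition bmul (x y : braid) : braid := bword (repr x ++ repr y).
Definition binv (x : braid) : braid := bword (winv (repr x)).

Lemma bmulE v w : bmul (bword v) (bword w) = bword (v ++ w).
Proof. by apply/bwordP/braid_eq_cat; exact: braid_repr_eq. Qed.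

Lemma braid_ind (P : braid -> Prop) :
  (forall w, P (bword w)) -> forall x, P x.
Proof. by move=> Pw x; rewrite -[x]bword_repr; exact: Pw. Qed.

Fact bmulA : associative bmul.
Proof.
elim/braid_ind=> u; elim/braid_ind=> v; elim/braid_ind=> w.
by rewrite !bmulE catA.
Qed.

Fact bmul1x : left_id (bword [::]) bmul.
Proof. by elim/braid_ind=> u; rewrite bmulE. Qed.

Fact bmulx1 : right_id (bword [::]) bmul.
Proof. by elim/braid_ind=> u; rewrite bmulE cats0. Qed.

Fact bmulVx : left_inverse (bword [::]) binv bmul.
Proof.
move=> x; rewrite -{2}[x]bword_repr bmulE; apply/bwordP; exact: braid_eq_winvl.
Qed.

Fact bmulxV : right_inverse (bword [::]) binv bmul.
Proof.
move=> x; rewrite -{1}[x]bword_repr bmulE; apply/bwordP; exact: braid_eq_winvr.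
Qed.

HB.instance Definition _ := isGroup.Build braid bmulA bmul1x bmulx1 bmulVx bmulxV.

Definition artin (i : 'I_n.-1) : braid := bword [:: (i, true)].

End BraidGroupTheory.

(* Quotient of an R-algebra by the two-sided ideal generated by a set S.  It  *)
(* may be trivial, while lalgType requires 1 != 0, so in general it only gets *)
(* the structures of a ring and of an R-module.                               *)
Section QuotientAlgebra.
Variables (R : pzRingType) (A : algType R) (S : set A).

Inductive ideal_gen : set A :=
| ideal_gen_in x : S x -> ideal_gen x
| ideal_gen0 : ideal_gen 0
| ideal_genD x y : ideal_gen x -> ideal_gen y -> ideal_gen (x + y)
| ideal_genMl x y : ideal_gen y -> ideal_gen (x * y)
| ideal_genMr x y : ideal_gen x -> ideal_gen (x * y).

Lemma ideal_genN x : ideal_gen x -> ideal_gen (- x).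
Proof. by rewrite -mulN1r; exact: ideal_genMl. Qed.

Definition ideal_eqb : rel A := fun x y => `[< ideal_gen (x - y) >].

Fact ideal_eqb_equiv : equiv_class_of ideal_eqb.
Proof.
have sym x y : ideal_gen (x - y) -> ideal_gen (y - x).
  by move=> /ideal_genN; rewrite opprB.
split=> [x|x y|y x z].
- by apply/asboolP; rewrite subrr; exact: ideal_gen0.
- by apply/asboolP/asboolP; exact: sym.
- move=> /asboolP xy /asboolP yz; apply/asboolP.
  by rewrite -[x](subrK y) -addrA; exact: ideal_genD.
Qed.

Canonical ideal_equiv := EquivRelPack ideal_eqb_equiv.

Definition qalg : Type := {eq_quot ideal_equiv}.

HB.instance Definition _ := Choice.on qalg.
HB.instance Definition _ := Quotient.on qalg.

End QuotientAlgebra.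

HB.lock Definition qproj (R : pzRingType) (A : algType R) (S : set A) (x : A) :
    qalg S :=
  \pi_{eq_quot (ideal_equiv S)} x.

Section QuotientAlgebraTheory.
Variables (R : pzRingType) (A : algType R) (S : set A).
Local Notation qalg := (qalg S).
Local Notation qproj := (@qproj R A S).
Local Notation ideal_gen := (@ideal_gen R A S).

Lemma qprojP x y : qproj x = qproj y <-> ideal_gen (x - y).
Proof.
rewrite qproj.unlock; split=> [/eqmodP/asboolP//|xy].
by apply/eqmodP/asboolP.
Qed.

Lemma qproj_repr (x : qalg) : qproj (repr x) = x.
Proof. by rewrite qproj.unlock reprK. Qed.

Lemma qalg_ind (P : qalg -> Prop) : (forall x, P (qproj x)) -> forall x, P x.
Proof. by move=> Px x; rewrite -[x]qproj_repr; exact: Px. Qed.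

Let reprE x : ideal_gen (repr (qproj x) - x).
Proof. by apply/qprojP; rewrite qproj_repr. Qed.

Definition qadd (x y : qalg) := qproj (repr x + repr y).
Definition qopp (x : qalg) := qproj (- repr x).
Definition qmul (x y : qalg) := qproj (repr x * repr y).
Definition qscale (k : R) (x : qalg) := qproj (k *: repr x).

Let addE x y : qadd (qproj x) (qproj y) = qproj (x + y).
Proof. by apply/qprojP; rewrite opprD addrACA; exact: ideal_genD. Qed.

Let oppE x : qopp (qproj x) = qproj (- x).
Proof. by apply/qprojP; rewrite -opprD; exact: ideal_genN. Qed.

Let mulE x y : qmul (qproj x) (qproj y) = qproj (x * y).
Proof.
apply/qprojP; set x' := repr _; set y' := repr _.
have -> : x' * y' - x * y = (x' - x) * y' + x * (y' - y).
  by rewrite mulrBl mulrBr addrA subrK.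
by apply: ideal_genD;
  [apply: ideal_genMr | apply: ideal_genMl]; exact: reprE.
Qed.

Let scaleE k x : qscale k (qproj x) = qproj (k *: x).
Proof.
apply/qprojP; rewrite -scalerBr -mulr_algl; apply: ideal_genMl; exact: reprE.
Qed.

Fact qaddA : associative qadd.
Proof.
elim/qalg_ind=> x; elim/qalg_ind=> y; elim/qalg_ind=> z.
by rewrite !addE addrA.
Qed.

Fact qaddC : commutative qadd.
Proof. by elim/qalg_ind=> x; elim/qalg_ind=> y; rewrite !addE addrC. Qed.

Fact qadd0x : left_id (qproj 0) qadd.
Proof. by elim/qalg_ind=> x; rewrite addE add0r. Qed.

Fact qaddNx : left_inverse (qproj 0) qopp qadd.
Proof. by elim/qalg_ind=> x; rewrite oppE addE addNr. Qed.

HB.instance Definition _ :=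
  GRing.isZmodule.Build qalg qaddA qaddC qadd0x qaddNx.

Fact qmulA : associative qmul.
Proof.
elim/qalg_ind=> x; elim/qalg_ind=> y; elim/qalg_ind=> z.
by rewrite !mulE mulrA.
Qed.

Fact qmul1x : left_id (qproj 1) qmul.
Proof. by elim/qalg_ind=> x; rewrite mulE mul1r. Qed.

Fact qmulx1 : right_id (qproj 1) qmul.
Proof. by elim/qalg_ind=> x; rewrite mulE mulr1. Qed.

Fact qmulDl : left_distributive qmul +%R.
Proof.
elim/qalg_ind=> x; elim/qalg_ind=> y; elim/qalg_ind=> z.
by rewrite [_ + _]addE !mulE [RHS]addE mulrDl.
Qed.

Fact qmulDr : right_distributive qmul +%R.
Proof.
elim/qalg_ind=> x; elim/qalg_ind=> y; elim/qalg_ind=> z.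
by rewrite [qproj y + _]addE !mulE [RHS]addE mulrDr.
Qed.

HB.instance Definition _ :=
  GRing.Zmodule_isPzRing.Build qalg qmulA qmul1x qmulx1 qmulDl qmulDr.

Fact qscaleA k l x : qscale k (qscale l x) = qscale (k * l) x.
Proof. by elim/qalg_ind: x => x; rewrite !scaleE scalerA. Qed.

Fact qscale1 : left_id 1 qscale.
Proof. by elim/qalg_ind=> x; rewrite scaleE scale1r. Qed.

Fact qscaleDr : right_distributive qscale +%R.
Proof.
move=> k; elim/qalg_ind=> x; elim/qalg_ind=> y.
by rewrite [_ + _]addE !scaleE [RHS]addE scalerDr.
Qed.

Fact qscaleDl x : {morph qscale^~ x : k l / k + l}.
Proof.
by elim/qalg_ind: x => x k l; rewrite !scaleE [RHS]addE scalerDl.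
Qed.

HB.instance Definition _ :=
  GRing.Zmodule_isLmodule.Build R qalg qscaleA qscale1 qscaleDr qscaleDl.

Fact qscaleAl k (x y : qalg) : k *: (x * y) = (k *: x) * y.
Proof.
elim/qalg_ind: x => x; elim/qalg_ind: y => y.
by rewrite [k *: qproj x]scaleE [RHS]mulE -scalerAl -[RHS]scaleE
  -[qproj (x * y)]mulE.
Qed.

Fact qscaleAr k (x y : qalg) : k *: (x * y) = x * (k *: y).
Proof.
elim/qalg_ind: x => x; elim/qalg_ind: y => y.
by rewrite [k *: qproj y]scaleE [RHS]mulE -scalerAr -[RHS]scaleE
  -[qproj (x * y)]mulE.
Qed.

Lemma qprojD x y : qproj (x + y) = qproj x + qproj y.
Proof. by rewrite [RHS]addE. Qed.

Lemma qprojM x y : qproj (x * y) = qproj x * qproj y.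
Proof. by rewrite [RHS]mulE. Qed.

Lemma qprojZ k x : qproj (k *: x) = k *: qproj x.
Proof. by rewrite [RHS]scaleE. Qed.

Lemma qproj1 : qproj 1 = 1.
Proof. by []. Qed.

Lemma qproj_rel x : S x -> qproj x = 0.
Proof. by move=> Sx; apply/qprojP; rewrite subr0; exact: ideal_gen_in. Qed.

End QuotientAlgebraTheory.

Section Relations.
Variables (R : comUnitRingType) (a b c : R).

Definition cubic_rel (n : nat) (i : 'I_n.-1) : galg R (braid n) :=
  let s := gelt R (artin i) in
  (s - a%:A) * (s - b%:A) * (s - c%:A).

(* Left-hand side minus right-hand side of the second defining relation, with *)
(* i and j in the roles of 1 and 2.                                           *)
Definition mixed_rel (n : nat) (i j : 'I_n.-1) : galg R (braid n) :=
  let s1 := gelt R (artin i) in let s1' := gelt R (artin i)^-1%g in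
  let s2 := gelt R (artin j) in let s2' := gelt R (artin j)^-1%g in
  s1' * s2 * s1
  - (s1 * s2 * s1' - a^-1 *: (s1 * s2) + a *: (s1 * s2')
     + a *: (s1' * s2) - a ^+ 3 *: (s1' * s2') + a^-1 *: (s2 * s1)
     - a *: (s2 * s1') - a *: (s2' * s1) + a ^+ 3 *: (s2' * s1')
     + a ^+ 2 *: (s1' * s2' * s1) - a ^+ 2 *: (s1 * s2' * s1')).

Definition Qrel (n : nat) : set (galg R (braid n)) :=
  [set x | exists2 i : 'I_n.-1, i = 0%N :> nat & x = cubic_rel i] `|`
  [set x | exists i j : 'I_n.-1,
      [/\ i = 0%N :> nat, j = 1%N :> nat & x = mixed_rel i j]].

End Relations.

(* The quotient maps to R by s_i |-> a, hence is nontrivial. *)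
Section Nontrivial.
Variables (R : comUnitRingType) (a b c : R) (n : nat).
Hypothesis Ua : a \is a GRing.unit.

Local Notation Qrel := (@Qrel R a b c n).

Definition wval (w : braid_word n) : R := \prod_(l <- w) (if l.2 then a else a^-1).

Let wvalE v w : braid_eq v w -> wval v = wval w.
Proof.
elim=> {v w} // [u v w _ -> _ -> //|v v' w w' _ IHv _ IHw|i e|i j _|i j _].
- by rewrite /wval !big_cat /= -!/(wval _) IHv IHw.
- rewrite /wval !big_cons big_nil mulr1.
  by case: e => /=; rewrite ?mulrV ?mulVr.
- by rewrite /wval !big_cons big_nil.
- by rewrite /wval !big_cons big_nil.
Qed.

Let bchar (g : braid n) : R := wval (repr g).

Let bcharE w : bchar (bword w) = wval w.
Proof. by rewrite /bchar (wvalE (braid_repr_eq w)). Qed.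

Let bcharM g h : bchar (g * h)%g = bchar g * bchar h.
Proof.
elim/braid_ind: g => v; elim/braid_ind: h => w.
by rewrite [X in bchar X]bmulE !bcharE /wval big_cat.
Qed.

Let bchar1 : bchar 1%g = 1.
Proof. by rewrite [LHS]bcharE /wval big_nil. Qed.

Let bchar_artin i : bchar (artin i) = a.
Proof. by rewrite bcharE /wval big_seq1. Qed.

Let bchar_artinV i : bchar (artin i)^-1%g = a^-1.
Proof.
by apply: (mulrI Ua); rewrite -{1}(bchar_artin i) -bcharM mulgV bchar1 mulrV.
Qed.

Let aug (x : galg R (braid n)) : R := mmap idfun bchar x.

Let augE g : aug (gelt R g) = bchar g.
Proof. by rewrite gelt.unlock /aug mmapU mul1r. Qed.

Let aug0 : aug 0 = 0.
Proof. by rewrite galg_0E galg_zero.unlock /aug mmap0. Qed.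

Let augD x y : aug (x + y) = aug x + aug y.
Proof. by rewrite galg_DE galg_add.unlock /aug mmapD. Qed.

Let augZ p x : aug (p *: x) = p * aug x.
Proof.
rewrite galg_ZE galg_scale.unlock /aug (mmapEw (msuppZ_le p x)) mmapE mulr_sumr.
by apply: eq_bigr => g _; rewrite mcoeffZ mulrA.
Qed.

Let augN x : aug (- x) = - aug x.
Proof. by rewrite -scaleN1r augZ mulN1r. Qed.

Let augM x y : aug (x * y) = aug x * aug y.
Proof.
elim/galg_ind: x => [|x1 x2 IH1 IH2|p g].
- by rewrite !(mul0r, aug0).
- by rewrite mulrDl !augD IH1 IH2 mulrDl.
elim/galg_ind: y => [|y1 y2 IH1 IH2|q h].
- by rewrite !(mulr0, aug0).
- by rewrite mulrDr !augD IH1 IH2 mulrDr.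
by rewrite galg_UM !augZ !augE bcharM mulrACA.
Qed.

Let aug_mixed (S : comNzRingType) (x y : S) :
  y * x * x - (x * x * y - y * (x * x) + x * (x * y) + x * (y * x)
    - x ^+ 3 * (y * y) + y * (x * x) - x * (x * y) - x * (y * x)
    + x ^+ 3 * (y * y) + x ^+ 2 * (y * y * x) - x ^+ 2 * (x * y * y)) = 0.
Proof. by ring. Qed.

Let aug_ideal x : ideal_gen Qrel x -> aug x = 0.
Proof.
elim=> {x} [x [[i _ ->]|[i [j [_ _ ->]]]]||x y _ IHx _ IHy|x y _ IH|x y _ IH].
- rewrite !augM augD augN augZ augE bchar_artin.
  by rewrite -gelt1 augE bchar1 mulr1 subrr !mul0r.
- rewrite !(augM, augZ, augD, augN, augE, bchar_artin, bchar_artinV).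
  exact: aug_mixed.
- exact: aug0.
- by rewrite augD IHx IHy addr0.
- by rewrite augM IH mulr0.
- by rewrite augM IH mul0r.
Qed.

Fact qalg_Qrel_neq0 : 1 != 0 :> qalg Qrel.
Proof.
apply/eqP => /qprojP; rewrite subr0 => /aug_ideal.
by rewrite -gelt1 augE bchar1 => /eqP; rewrite oner_eq0.
Qed.

End Nontrivial.

Section CubicQuotient.

Local Notation R := laurent3.
Local Notation Qrel := (@Qrel R La Lb Lc).

Definition Q (n : nat) : Type := qalg (@Qrel n).

HB.instance Definition _ n := GRing.PzRing.on (Q n).
HB.instance Definition _ n := GRing.Lmodule.on (Q n).
HB.instance Definition _ n := GRing.PzSemiRing_isNonZero.Build (Q n)
  (qalg_Qrel_neq0 Lb Lc n La_unit).
HB.instance Definition _ n :=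
  GRing.Lmodule_isLalgebra.Build R (Q n) (@qscaleAl _ _ (@Qrel n)).
HB.instance Definition _ n :=
  GRing.Lalgebra_isAlgebra.Build R (Q n) (@qscaleAr _ _ (@Qrel n)).

Definition Qelt (n : nat) (g : braid n) : Q n := qproj (@Qrel n) (gelt R g).

Inductive subalg_gen (A : algType R) (S : set A) : set A :=
| subalg_gen_in x : S x -> subalg_gen S x
| subalg_gen1 : subalg_gen S 1
| subalg_genD x y : subalg_gen S x -> subalg_gen S y -> subalg_gen S (x + y)
| subalg_genM x y : subalg_gen S x -> subalg_gen S y -> subalg_gen S (x * y)
| subalg_genZ k x : subalg_gen S x -> subalg_gen S (k *: x).

Definition span (V : lmodType R) (S : set V) : set V :=
  [set x | exists (m : nat) (k : 'I_m -> R) (v : 'I_m -> V),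
     (forall i, S (v i)) /\ x = \sum_(i < m) k i *: v i].

Definition fin_gen (V : lmodType R) : Prop :=
  exists (m : nat) (v : 'I_m -> V), span (range v) = setT.

(* The subalgebra generated by s_1, s_2, s_3; it contains their inverses by   *)
(* the cubic relation, as a b c is invertible in R.                           *)
Definition Q4in5 : set (Q 5) :=
  subalg_gen [set Qelt (@artin 5 i) | i in [set i : 'I_4 | (i < 3)%N]].

Definition u4 : set (Q 5) :=
  let s4 := @artin 5 (ord_max : 'I_4) in
  [set x | exists p q r : R, x = p%:A + q *: Qelt s4 + r *: Qelt s4^-1%g].

(* Span of the products x_0 u_0 x_1 u_1 ... u_{k-1} x_k. *)
Definition Q5pow (k : nat) : set (Q 5) :=
  span [set z | exists (x0 : Q 5) (u x : 'I_k -> Q 5),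
    [/\ Q4in5 x0, forall i, u4 (u i), forall i, Q4in5 (x i) &
        z = x0 * \prod_(i < k) (u i * x i)]].

End CubicQuotient.

(* Main.v *)
(* All computations take place with words in [s_1^{+-1}, ..., s_4^{+-1}] up to
   linear combinations, so that coefficients can be ignored.  Put X = s_2 s_1^-1 s_2,
   Y = s_3 s_2^-1 s_3, W = s_4 s_3^-1 s_4, Z_e = s_3^e X s_3^e, V_e = s_4^e Y s_4^e.
   The mixed relation gives Q_3 = u_1 u_2 u_1 + R X, and then
   Q_4 = Q_3 u_3 Q_3 + Q_3 Y Q_3 + R Z_+ + R Z_-.  By induction on the length of
   words, Q_5 = Q_5^(3) follows from s_4^i Q_4 s_4^j Q_4 s_4^k Q_4 s_4^l being in
   Q_5^(3).  Products of three factors u_4 containing a W, and then those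
   containing a V_e, are reduced first.  Since s_4^e q s_4^f is, for q in Q_4, a
   combination of elements of Q_5^(1), Q_4 W Q_4, Q_4 V_e Q_4 and of the
   s_4^e Z_g s_4^e with e = f, only the words s_4^e Z s_4^e Z s_4^e Z s_4^e
   remain.  If some Z is Z_e, then s_4^e Z_e s_4^e can be replaced by
   s_4^e s_3^e s_2^e s_1^2e s_2^e s_3^e s_4^e, which commutes with Q_4; otherwise
   the middle s_4^e Z s_4^e is rewritten by braid moves.  Finiteness follows, as
   each step leaves a finite list of words. *)
Require Import Defs.
From mathcomp Require Import all_boot all_order all_algebra.
From mathcomp Require Import classical_sets.
From mathcomp Require Import zify.

Set Implicit Arguments.
Unset Strict Implicit.
Unset Printing Implicit Defensive.

(** * Spans of words modulo the relations *)

(** Without coefficients no equation can be solved for a word that occurs on both of its sides.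
    Rules are therefore directed, and a word is often lengthened by an inverse pair before it can be
    shortened. Two kinds of representatives are played off against each other. Modulo u_i u_j u_i,
    the words X, Y, W absorb s_1, s_2, s_3 respectively on either side, and all their signs can be
    changed at once, but they do not move through other words. The words s_2^e s_1^(2e) s_2^e and
    s_3^e s_2^e s_1^(2e) s_2^e s_3^e are Jucys-Murphy elements up to inversion and commute with the
    lower generators, but absorb nothing. The second kind is tied to a sign: Z_g is exchanged for
    the element with e = g, and s_4^e Z_g s_4^e for a Jucys-Murphy element only if g = e. This is
    why s_4^e Z_g s_4^e with g = -e is the exceptional factor at the end. All checks on the finite
    lists of normal forms are left to computation. *)

(* The letter [(i, true)] stands for [s_{i+1}] and [(i, false)] for its inverse;
   all generator indices below are thus one less than in the usual notation. *)
Definition letter : Type := nat * bool.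
Definition word : Type := seq letter.

Definition adj (i j : nat) : bool := (i.+1 == j) || (j.+1 == i).
Definition far (i j : nat) : bool := (i.+1 < j) || (j.+1 < i).

Definition pattern (i j : nat) (w : seq (bool * bool)) : word :=
  [seq (if x.1 then j else i, x.2) | x <- w].

(* Together with [pattern], lists the words spanning [u_i u_j u_i]. *)
Definition uuu_pattern : seq (seq (bool * bool)) :=
  let pw := [:: [::]; [:: (false, true)]; [:: (false, false)]] in
  pw ++ [seq x ++ yz | x <- pw,
          yz <- [seq (true, e) :: z | e <- [:: true; false], z <- pw]].

Definition uuu (i j : nat) : seq word := map (pattern i j) uuu_pattern.

Lemma uuuP i j w :
  reflect (exists2 p, p \in uuu_pattern & w = pattern i j p) (w \in uuu i j).
Proof. exact: mapP. Qed.

(* [ax n l rs]: among the first [n] generators, the word [l] is a combination of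
   the words [rs].  Coefficients are dropped: this loses nothing, because every
   relation in use has a unit coefficient at the word that it eliminates.
   [ax_mixed] is the second defining relation multiplied by [s_j] on the right,
   which equates [a s_j s_i^-1 s_j] and [a b c s_j^-1 s_i s_j^-1] modulo
   [u_i u_j u_i]. *)
Inductive ax (n : nat) : word -> seq word -> Prop :=
| ax_cancel i e : i < n -> ax n [:: (i, e); (i, ~~ e)] [:: [::]]
| ax_uncancel i e : i < n -> ax n [::] [:: [:: (i, e); (i, ~~ e)]]
| ax_sq i e : i < n ->
    ax n [:: (i, e); (i, e)] [:: [:: (i, e)]; [::]; [:: (i, ~~ e)]]
| ax_unsq i e : i < n ->
    ax n [:: (i, e)] [:: [:: (i, ~~ e); (i, ~~ e)]; [:: (i, ~~ e)]; [::]]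
| ax_comm i j e f : i < n -> j < n -> far i j ->
    ax n [:: (i, e); (j, f)] [:: [:: (j, f); (i, e)]]
| ax_braid i j e : i < n -> j < n -> adj i j ->
    ax n [:: (i, e); (j, e); (i, e)] [:: [:: (j, e); (i, e); (j, e)]]
| ax_braid_mixed i j e f : i < n -> j < n -> adj i j ->
    ax n [:: (i, e); (j, f); (i, ~~ e)] [:: [:: (j, ~~ e); (i, f); (j, e)]]
| ax_mixed i j e : i < n -> j < n -> adj i j ->
    ax n [:: (j, e); (i, ~~ e); (j, e)]
         ([:: (j, ~~ e); (i, e); (j, ~~ e)] :: uuu i j).

(* [inspan n T w]: repeated use of the relations expresses [w] as a combination
   of words satisfying [T]. *)
Inductive inspan (n : nat) (T : word -> Prop) : word -> Prop :=
| inspan_in w : T w -> inspan n T w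
| inspan_step u l v rs : ax n l rs ->
    (forall r, r \in rs -> inspan n T (u ++ r ++ v)) -> inspan n T (u ++ l ++ v).

Lemma inspan_bind n (T T' : word -> Prop) w :
  inspan n T w -> (forall t, T t -> inspan n T' t) -> inspan n T' w.
Proof.
move=> Tw TT'; elim: Tw => [t /TT' //|u l v rs lrs _ IH].
exact: inspan_step lrs IH.
Qed.

Lemma inspan_ctx n (T T' : word -> Prop) u w v :
  inspan n T w -> (forall t, T t -> inspan n T' (u ++ t ++ v)) -> inspan n T' (u ++ w ++ v).
Proof.
move=> Tw TT'; elim: Tw => [t /TT' //|u' l v' rs lrs _ IH].
have E r : u ++ (u' ++ r ++ v') ++ v = (u ++ u') ++ r ++ v' ++ v by rewrite !catA.
by rewrite E; apply: inspan_step lrs _ => r /IH; rewrite E.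
Qed.

Definition valid n (r : word * seq word) := inspan n (fun w => w \in r.2) r.1.
Definition valids n (R : seq (word * seq word)) := forall r, r \in R -> valid n r.

(** * A rewriting procedure for words *)

Fixpoint match_at (l w : word) : option word :=
  match l, w with
  | [::], _ => Some w
  | a :: l', b :: w' => if a == b then match_at l' w' else None
  | _, [::] => None
  end.

Fixpoint match_in (l u w : word) : option (word * word) :=
  if match_at l w is Some v then Some (rev u, v) else
  if w is b :: w' then match_in l (b :: u) w' else None.

Fixpoint rewrite1 (R : seq (word * seq word)) (w : word) : option (seq word) :=
  if R is (l, rs) :: R' then
    if match_in l [::] w is Some (u, v) then Some [seq u ++ r ++ v | r <- rs]
    else rewrite1 R' w
  else None.

(* [k] is the fuel; words that already satisfy [T] are discarded, so that only
   the words still to be treated are returned. *)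
Fixpoint normalize (T : pred word) R (k : nat) (w : word) : seq word :=
  if T w then [::] else
  if k is k'.+1 then
    if rewrite1 R w is Some ws then flatten (map (normalize T R k') ws)
    else [:: w]
  else [:: w].

(** Commutations and braid moves serve in both directions within one calculation and would run in
    circles if put together. A calculation is thus a list of phases, each with its own rules and
    fuel; with fuel 1 each word is rewritten at most once. *)
Fixpoint residue (T : pred word) (ps : seq (nat * seq (word * seq word))) (w : word) :
    seq word :=
  if ps is (k, R) :: ps' then flatten (map (residue T ps') (normalize T R k w))
  else if T w then [::] else [:: w].

Lemma match_atP l w v : match_at l w = Some v -> w = l ++ v.
Proof.
elim: l w => [w [->]//|a l IH [|b w] //=].
by case: eqP => // <- /IH ->.
Qed.

Lemma match_inP l u w u' v : match_in l u w = Some (u', v) -> rev u ++ w = u' ++ l ++ v.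
Proof.
elim: w u => [|b w IH] u /=; case E: match_at => [x|] //.
- by case=> <- <-; rewrite (match_atP E).
- by case=> <- <-; rewrite (match_atP E).
- by move/IH => <-; rewrite rev_cons cat_rcons.
Qed.

Lemma rewrite1P n T R w ws : valids n R -> rewrite1 R w = Some ws ->
  (forall x, x \in ws -> inspan n T x) -> inspan n T w.
Proof.
elim: R => [|[l rs] R IH] //= vR.
case E: match_in => [[u v]|].
  case=> <- H; rewrite (match_inP E : w = _).
  apply: inspan_ctx (vR _ (mem_head _ _)) _ => t /= trs.
  by apply: H; apply/mapP; exists t.
by apply: IH => r rR; apply: vR; rewrite inE rR orbT.
Qed.

Lemma normalizeP n (T : pred word) (T' : word -> Prop) R k w :
  valids n R -> (forall x, T x -> T' x) ->
  (forall x, x \in normalize T R k w -> inspan n T' x) -> inspan n T' w.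
Proof.
move=> vR TT'; elim: k w => [|k IH] w /=; case: ifP => [/TT' Tw _|_]; try exact: inspan_in.
  by apply; rewrite mem_head.
case E: rewrite1 => [ws|]; last by apply; rewrite mem_head.
move=> H; apply: (rewrite1P vR E) => x xws; apply: IH => y yx; apply: H.
by apply/flattenP; exists (normalize T R k x) => //; apply: map_f.
Qed.

Lemma residueP n (T : pred word) ps w : (forall p, p \in ps -> valids n p.2) ->
  nilp (residue T ps w) -> inspan n T w.
Proof.
elim: ps w => [|[k R] ps IH] w vp /=.
  by case: ifP => // Tw _; exact: inspan_in.
move=> /nilP E; apply: (@normalizeP n T T R k) => [|//|x xw].
  by apply: vp (k, R) _; rewrite mem_head.
apply: IH => [p pps|]; first by apply: vp; rewrite inE pps orbT.
apply/nilP; case F: (residue _ _ _) => [|y s] //.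
suff: y \in flatten (map (residue T ps) (normalize T R k w)) by rewrite E.
apply/flattenP; exists (residue T ps x); first exact: map_f.
by rewrite F mem_head.
Qed.

(** * Symmetries of the relations *)

Lemma inspan_map n m (g : letter -> letter) (T : word -> Prop) w :
  (forall l rs, ax n l rs -> exists2 rs', ax m (map g l) rs' &
     {subset rs' <= map (map g) rs}) ->
  inspan n T w -> inspan m (fun x => exists2 t, T t & x = map g t) (map g w).
Proof.
move=> gax; elim=> [t Tt|u l v rs /gax [rs' lrs' sub] _ IH].
  by apply: inspan_in; exists t.
rewrite !map_cat; apply: inspan_step lrs' _ => _ /sub /mapP [r rs_r ->].
by rewrite -!map_cat; exact: IH.
Qed.

(** The relations are stable under reversal: both three-letter words of [ax_mixed] are palindromes,
    and the list [uuu i j] is closed under reversal. Every statement about the left thus has a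
    counterpart on the right. *)
Lemma inspan_rev n (T : word -> Prop) w :
  inspan n T w -> inspan n (fun x => T (rev x)) (rev w).
Proof.
have rev_ax l rs : ax n l rs ->
    exists2 rs', ax n (rev l) rs' & {subset rs' <= map rev rs}.
  case=> [i e ?|i e ?|i e ?|i e ?|i j e f ? ? ?|i j e ? ? ?|i j e f ? ? ?|i j e ? ? ?].
  - by exists [:: [::]] => //; rewrite -{1}[e]negbK; constructor.
  - exists [:: [:: (i, ~~ e); (i, ~~ ~~ e)]]; first by constructor.
    by rewrite negbK.
  - by exists [:: [:: (i, e)]; [::]; [:: (i, ~~ e)]] => //; constructor.
  - by exists [:: [:: (i, ~~ e); (i, ~~ e)]; [:: (i, ~~ e)]; [::]] => //; constructor.
  - by exists [:: [:: (i, e); (j, f)]] => //; constructor=> //; rewrite /far orbC.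
  - by exists [:: [:: (j, e); (i, e); (j, e)]] => //; constructor.
  - exists [:: [:: (j, e); (i, f); (j, ~~ e)]] => //.
    by move: (@ax_braid_mixed n i j (~~ e) f); rewrite negbK; apply.
  - exists ([:: (j, ~~ e); (i, e); (j, ~~ e)] :: uuu i j); first by constructor.
    move=> w'; rewrite in_cons => /orP [/eqP ->|/uuuP [p pP ->]]; first exact: mem_head.
    apply/mapP; exists (pattern i j (rev p)); last by rewrite /pattern map_rev revK.
    rewrite in_cons; apply/orP; right; apply/uuuP; exists (rev p) => //.
    by move: p pP; apply/allP; vm_compute.
elim=> [t Tt|u l v rs /rev_ax [rs' lrs' sub] _ IH].
  by apply: inspan_in; rewrite revK.
rewrite !rev_cat -catA; apply: inspan_step lrs' _ => _ /sub /mapP [r rs_r ->].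
by have:= IH _ rs_r; rewrite !rev_cat -catA.
Qed.

Definition relabel (g : nat -> nat) : word -> word := map (fun x => (g x.1, x.2)).

(** Serves for three maps of indices: an adjacent pair put in place of s_1, s_2, the shift by one,
    and the flip of s_1, s_2, s_3. *)
Lemma inspan_relabel n m (g : nat -> nat) (T : word -> Prop) w :
  (forall i, i < n -> g i < m) ->
  (forall i j, i < n -> j < n -> adj i j -> adj (g i) (g j)) ->
  (forall i j, i < n -> j < n -> far i j -> far (g i) (g j)) ->
  inspan n T w -> inspan m (fun x => exists2 t, T t & x = relabel g t) (relabel g w).
Proof.
move=> gn gadj gfar; apply: inspan_map => l rs.
case=> [i e ?|i e ?|i e ?|i e ?|i j e f ? ? ?|i j e ? ? ?|i j e f ? ? ?|i j e ? ? ?];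
  [|by exists [:: [:: (g i, e); (g i, ~~ e)]] => //; constructor; auto|..];
  (eexists; first by constructor; auto) => //.
Qed.

(** * Rules and their validity *)

Definition rule : Type := word * seq word.
Definition signs := [:: true; false].

Definition r_cancel n : seq rule := [seq ([:: (i, e);
  (i, ~~ e)], [:: [::]]) | i <- iota 0 n, e <- signs].

Definition r_sq n : seq rule :=
  [seq ([:: (i, e); (i, e)], [:: [:: (i, e)]; [::]; [:: (i, ~~ e)]]) | i <- iota 0 n, e <- signs].

Definition r_unsq i e : rule := ([:: (i, e)], [:: [:: (i, ~~ e); (i, ~~ e)]; [:: (i, ~~ e)]; [::]]).
Definition r_comm i j : seq rule :=
  [seq ([:: (i, e); (j, f)], [:: [:: (j, f); (i, e)]]) | e <- signs, f <- signs].

(** The order of the arguments is the direction of use: [r_braid 2 1] lowers the number of letters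
    s_3 (index 2). *)
Definition r_braid i j : seq rule :=
  [seq ([:: (i, e); (j, e); (i, e)], [:: [:: (j, e); (i, e); (j, e)]]) | e <- signs] ++
  [seq ([:: (i, e); (j, f); (i, ~~ e)], [:: [:: (j, ~~ e); (i, f);
    (j, e)]]) | e <- signs, f <- signs].

Definition r_mixed i j e : rule :=
  ([:: (j, e); (i, ~~ e); (j, e)], [:: (j, ~~ e); (i, e); (j, ~~ e)] :: uuu i j).

Lemma ax_valid n l rs : ax n l rs -> valid n (l, rs).
Proof.
move=> lrs; rewrite /valid /= -[l]cats0 -[l ++ _]cat0s.
by apply: inspan_step lrs _ => r rP; rewrite cat0s cats0; apply: inspan_in.
Qed.

Lemma valids_nil n : valids n [::]. Proof. by []. Qed.

Lemma valids_cons n r R : valid n r -> valids n R -> valids n (r :: R).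
Proof. by move=> vr vR x; rewrite inE => /orP [/eqP ->|/vR]. Qed.

Lemma valids_cat n R R' : valids n R -> valids n R' -> valids n (R ++ R').
Proof. by move=> vR vR' x; rewrite mem_cat => /orP [/vR|/vR']. Qed.

Lemma valids_map (I : Type) n (f : I -> rule) s : (forall i, valid n (f i)) -> valids n (map f s).
Proof. by move=> vf r; elim: s => //= i s IH; rewrite inE => /orP [/eqP ->|/IH]. Qed.

Lemma valids_map2 n (f : bool -> bool -> rule) :
  (forall e e', valid n (f e e')) -> valids n [seq f e e' | e <- signs, e' <- signs].
Proof. by move=> vf _ /allpairsP [[e e'] [_ _ ->]]. Qed.

Lemma valids_mapR n (f : rule -> rule) R :
  (forall r, valid n r -> valid n (f r)) -> valids n R -> valids n (map f R).
Proof. by move=> vf vR _ /mapP [r /vR vr ->]; exact: vf. Qed.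

Lemma valid_cancel n m : m <= n -> valids n (r_cancel m).
Proof.
move=> mn _ /allpairsP [[i e] [/= im _ ->]]; apply: ax_valid; constructor.
by move: im; rewrite mem_iota => /leq_trans; apply.
Qed.

Lemma valid_sq n m : m <= n -> valids n (r_sq m).
Proof.
move=> mn _ /allpairsP [[i e] [/= im _ ->]]; apply: ax_valid; constructor.
by move: im; rewrite mem_iota => /leq_trans; apply.
Qed.

Lemma valid_unsq n i e : i < n -> valid n (r_unsq i e).
Proof. by move=> im; apply: ax_valid; constructor. Qed.

Lemma valid_mixed n i j e : i < n -> j < n -> adj i j -> valid n (r_mixed i j e).
Proof. by move=> *; apply: ax_valid; constructor. Qed.

Lemma valid_comm n i j : i < n -> j < n -> far i j -> valids n (r_comm i j).
Proof. by move=> im jn ij _ /allpairsP [[e f] [/= _ _ ->]]; apply: ax_valid; constructor. Qed.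

Lemma valid_braid n i j : i < n -> j < n -> adj i j -> valids n (r_braid i j).
Proof.
move=> im jn ij r; rewrite mem_cat => /orP [/mapP [e _ ->]|/allpairsP [[e f] [/= _ _ ->]]];
  by apply: ax_valid; constructor.
Qed.

Create HintDb rules discriminated.
#[export] Hint Constants Opaque : rules.
#[export] Hint Resolve valid_cancel valid_sq valid_unsq valid_mixed
  valid_comm valid_braid : rules.

Lemma phases_nil n : forall p : nat * seq rule, p \in [::] -> valids n p.2. Proof. by []. Qed.

Lemma phases_cons n k R ps : valids n R -> (forall p : nat * seq rule, p \in ps -> valids n p.2) ->
  forall p : nat * seq rule, p \in (k, R) :: ps -> valids n p.2.
Proof. by move=> vR vps p; rewrite inE => /orP [/eqP ->|/vps]. Qed.

Definition rmap g (r : rule) : rule := (relabel g r.1, map (relabel g) r.2).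
Definition pq p q i : nat := if i == 0 then p else q.
Definition at_ p q R := map (rmap (pq p q)) R.
Lemma inspan_pq n p q (T : word -> Prop) w : p < n -> q < n -> adj p q -> inspan 2 T w ->
  inspan n (fun x => exists2 t, T t & x = relabel (pq p q) t) (relabel (pq p q) w).
Proof.
move=> pn qn apq; apply: inspan_relabel => [[|i] //|[|[|i]] [|[|j]] //|[|[|i]] [|[|j]] //] _ _ _.
by rewrite /adj orbC.
Qed.

Lemma valid_pq n p q r : p < n -> q < n -> adj p q -> valid 2 r -> valid n (rmap (pq p q) r).
Proof.
move=> pn qn apq /(inspan_pq pn qn apq) vr; apply: inspan_bind vr _ => _ [t tr ->].
by apply: inspan_in; apply: map_f.
Qed.

Lemma valids_pq n p q R : p < n -> q < n -> adj p q -> valids 2 R -> valids n (at_ p q R).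
Proof. by move=> pn qn apq vR _ /mapP [r rR ->]; apply: valid_pq => //; exact: vR. Qed.

Ltac rules := repeat match goal with
 | |- forall p, _ -> _ => first [exact: phases_nil | apply: phases_cons]
 | |- valids _ (_ ++ _) => apply: valids_cat
 | |- valids _ (_ :: _) => apply: valids_cons
 | |- valids _ [::] => exact: valids_nil
 | |- _ => solve [auto with rules]
 | |- valids _ (map _ signs) => apply: valids_map => ?
 | |- valids _ (at_ _ _ _) => apply: valids_pq
 | |- valids _ (map ?f _) => apply: (@valids_mapR _ f)
 | |- valids _ (flatten [seq [seq _ | _ <- signs] | _ <- signs]) => apply: valids_map2 => ? ?
 end.

(** * Two generators: absorption and the normal form of Q_3 *)

Definition X (p q : nat) (e : bool) : word := [:: (q, e); (p, ~~ e); (q, e)].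

Definition uuux p q e := X p q e :: uuu p q.

Definition r_uuu : seq rule := r_cancel 2 ++ r_sq 2 ++ r_braid 1 0.
Lemma valid_uuu n : 1 < n -> valids n r_uuu.
Proof. by move=> n1; rewrite /r_uuu; rules. Qed.
#[export] Hint Resolve valid_uuu : rules.

(* [(s_0 - a) s_1 s_0^-1 s_1] lies in [u_0 u_1 u_0], by [ax_mixed] and
   [s_0 s_1 s_0^-1 s_1 = s_1^-1 s_0 s_1^2]. *)
Definition r_absl : seq rule := [seq ((0, e) :: X 0 1 f, uuux 0 1 f) | e <- signs, f <- signs].

Lemma valid_absl : valids 2 r_absl.
Proof.
move=> r; pose R := [seq ([:: (0, e); (1, e); (0, ~~ e)], [:: [:: (1, ~~ e); (0, e);
  (1, e)]]) | e <- signs].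
have vR : valids 2 R by move=> _ /mapP [e _ ->]; apply: ax_valid; constructor.
(* The first phase gives X the sign e if necessary, so that the braid move of [R] applies; the last
   one restores the sign f. *)
case/allpairsP => -[e f] [/= _ _ ->]; apply: (residueP (ps := [:: (1, [:: r_mixed 0 1 (~~e)]);
  (1, R); (9, r_uuu); (9, [:: r_mixed 0 1 (~~ f)])])); first by rules.
by case: e; case: f; vm_compute.
Qed.

Definition r_rev (r : rule) : rule := (rev r.1, map rev r.2).
Lemma valid_rev n r : valid n r -> valid n (r_rev r).
Proof.
move=> /inspan_rev vr; apply: inspan_bind vr _ => t tr; apply: inspan_in.
by rewrite /= -[t]revK; apply: map_f.
Qed.

Lemma valids_rev n R : valids n R -> valids n (map r_rev R).
Proof. by move=> vR _ /mapP [r rR ->]; apply: valid_rev; exact: vR. Qed.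

Definition r_abs := r_absl ++ map r_rev r_absl.
Lemma valid_abs : valids 2 r_abs.
Proof. by apply: valids_cat; [|apply: valids_rev]; exact: valid_absl. Qed.
#[export] Hint Resolve valids_pq valid_abs valids_rev valid_rev : rules.

(** In the usual numbering: s_1^-e is a combination of s_1^(2e), s_1^e and 1, and the term s_2^e
    s_1^(2e) s_2^e that survives commutes with s_1. *)
Definition r_X2 := [seq (X 0 1 e, [:: (1, e); (0, e); (0, e); (1, e)] :: uuu 0 1) | e <- signs].

Lemma valid_X2 : valids 2 r_X2.
Proof.
move=> _ /mapP [e _ ->].
apply: (residueP (ps := [:: (1, [:: r_unsq 0 (~~ e)]); (9, r_uuu)])); first by rules.
by case: e; vm_compute.
Qed.

Definition r_unabs := [seq (X 0 1 e, ((0, f) :: X 0 1 e) :: uuu 0 1) | e <- signs, f <- signs].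

(** Absorption read backwards: an empty pattern matches at the left end, so the inverse pair is
    inserted in front of X, which then absorbs its second letter. *)
Lemma valid_unabs : valids 2 r_unabs.
Proof.
move=> _ /allpairsP [[e f] [_ _ ->]].
apply: (residueP (ps := [:: (1, [:: ([::], [:: [:: (0, f); (0, ~~ f)]])]); (1, r_absl);
  (9, r_uuu)])).
  by rules; [apply: ax_valid; constructor | exact: valid_absl].
by case: e; case: f; vm_compute.
Qed.
#[export] Hint Resolve valid_X2 valid_unabs : rules.

Definition wlt k (w : word) := all (fun l => l.1 < k) w.

Lemma wlt2_ind n T w : wlt 2 w -> inspan n T [::] ->
  (forall i e t, i < 2 -> T t -> inspan n T ((i, e) :: t)) -> inspan n T w.
Proof.
move=> w2 T0 TS; elim: w w2 => //= -[i e] w IH /andP [/= i2 /IH Tw].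
by rewrite -[_ :: _]/([:: (i, e)] ++ w) -[w]cats0; apply: inspan_ctx Tw _ => t Tt; rewrite cats0;
  apply: TS.
Qed.

(** The span of these 22 words is stable under left multiplication by the four letters. One sign of
    X suffices, as the mixed relation exchanges the two. *)
Lemma wlt2_nf w : wlt 2 w -> inspan 2 (fun t => t \in uuux 0 1 true) w.
Proof.
move=> w2; apply: (wlt2_ind w2) => [|i e t i2 tu]; first by apply: inspan_in.
apply: (residueP (ps := [:: (9, r_uuu ++ [:: r_mixed 0 1 false] ++ r_abs)])); first by rules;
  exact: valid_abs.
by case: i i2 => [|[|//]] _; case: e; move: t tu; apply/allP; vm_compute.
Qed.

(** The order of the pair is the choice of the outer generator: [uuux 1 0] is preferred in front of
    Y, which absorbs a final s_2. *)
Lemma nf2 n p q w : p < n -> q < n -> adj p q -> all (fun l => (l.1 == p) || (l.1 == q)) w ->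
  inspan n (fun t => t \in uuux p q true) w.
Proof.
move=> pn qn apq wpq; pose g i := if i == p then 0 else 1.
have -> : w = relabel (pq p q) (relabel g w).
  rewrite /relabel -map_comp map_id_in // => -[i e] /(allP wpq) /= /orP [] /eqP ->.
    by rewrite /g eqxx.
  by rewrite /g; case: eqP => // qp; move: apq; rewrite qp /adj orbb -[_ == _]negbK neq_ltn ltnSn
    orbT.
have /wlt2_nf gw : wlt 2 (relabel g w) by rewrite /wlt all_map; apply/allP => -[i e] _ /=;
  rewrite /g; case: ifP.
by apply: inspan_bind (inspan_pq pn qn apq gw) _ => _ [t tu ->]; apply: inspan_in;
  exact: (map_f (relabel (pq p q)) tu).
Qed.

Definition cnt k (w : word) := count (fun l : letter => l.1 == k) w.
Definition mid (P : pred word) (m w : word) :=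
  has (fun i => [&& P (take i w), take (size m) (drop i w) == m & P (drop (size m) (drop i w))])
    (iota 0 (size w).+1).

Lemma midP (P : pred word) m w :
  reflect (exists u v, [/\ P u, P v & w = u ++ m ++ v]) (mid P m w).
Proof.
apply: (iffP hasP) => [[i _ /and3P [Pu /eqP mE Pv]]|[u [v [Pu Pv ->]]]].
  by exists (take i w), (drop (size m) (drop i w)); rewrite -{2}mE !cat_take_drop.
exists (size u); first by rewrite mem_iota !size_cat /= add0n ltnS leq_addr.
by rewrite take_size_cat // drop_size_cat // take_size_cat // drop_size_cat // Pu Pv eqxx.
Qed.

Lemma cnt_cat k u v : cnt k (u ++ v) = cnt k u + cnt k v. Proof. exact: count_cat. Qed.

Lemma cnt_cons k x v : cnt k (x :: v) = (x.1 == k) + cnt k v. Proof. by []. Qed.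

Lemma cnt_rev k w : cnt k (rev w) = cnt k w. Proof. exact: count_rev. Qed.

Lemma wlt_cat k u v : wlt k (u ++ v) = wlt k u && wlt k v. Proof. exact: all_cat. Qed.

Lemma wlt_rev k w : wlt k (rev w) = wlt k w. Proof. exact: all_rev. Qed.

Lemma wlt_cnt k w : wlt k w -> cnt k w = 0.
Proof. by elim: w => //= -[i e] w IH /andP [/= ik /IH ->]; rewrite (ltn_eqF ik). Qed.

Lemma cnt_wlt k w : wlt k.+1 w -> cnt k w = 0 -> wlt k w.
Proof.
elim: w => //= -[i e] w IH /andP [/= ik wk]; case: eqP => //= i_k /(IH wk) ->.
by rewrite ltn_neqAle -ltnS ik andbT; case: eqP i_k.
Qed.

Lemma wlt_leq k m w : k <= m -> wlt k w -> wlt m w.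
Proof. by move=> km; apply: sub_all => l /leq_trans; apply. Qed.

Lemma cnt_split k n w : wlt k.+1 w -> cnt k w = n.+1 ->
  exists x e y, [/\ w = x ++ (k, e) :: y, wlt k x, wlt k.+1 y & cnt k y = n].
Proof.
elim: w => //= -[i e] w IH /andP [/= ik wk]; case: eqP => [-> [wn]|i_k /= /(IH wk)].
  by exists [::], e, w.
move=> [x [f [y [-> xk yk yn]]]]; exists ((i, e) :: x), f, y; split => //=.
by rewrite xk ltn_neqAle -ltnS ik !andbT; case: eqP i_k.
Qed.

Lemma valid_ctx n u l rs v : valid n (l, rs) -> valid n (u ++ l ++ v, [seq u ++ r ++ v | r <- rs]).
Proof. by move=> vl; apply: inspan_ctx vl _ => t tl; apply: inspan_in; apply: map_f. Qed.

Definition r_suf v (r : rule) : rule := (r.1 ++ v, [seq x ++ v | x <- r.2]).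
Definition r_pre u (r : rule) : rule := (u ++ r.1, [seq u ++ x | x <- r.2]).
Lemma valid_suf n v r : valid n r -> valid n (r_suf v r).
Proof. case: r => l rs; exact: (@valid_ctx n [::]). Qed.

Lemma valid_pre n u r : valid n r -> valid n (r_pre u r).
Proof.
case: r => l rs /(valid_ctx u [::]); rewrite cats0 /r_pre /=; congr valid; congr pair.
by apply: eq_map => r; rewrite cats0.
Qed.

Definition sufs k R := flatten [seq map (r_suf [:: (k, f)]) R | f <- signs].

Definition pres k R := flatten [seq map (r_pre [:: (k, f)]) R | f <- signs].

Lemma valid_sufs n k R : valids n R -> valids n (sufs k R).
Proof. by move=> vR r /flattenP [_ /mapP [f _ ->] /mapP [r' /vR vr ->]]; exact: valid_suf. Qed.

Lemma valid_pres n k R : valids n R -> valids n (pres k R).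
Proof. by move=> vR r /flattenP [_ /mapP [f _ ->] /mapP [r' /vR vr ->]]; exact: valid_pre. Qed.

Lemma inspan_mono n m T w : n <= m -> inspan n T w -> inspan m T w.
Proof.
move=> nm; elim=> [t /inspan_in //|u l v rs lrs _ IH]; apply: inspan_step IH.
by case: lrs => *; constructor=> //; exact: leq_trans nm.
Qed.

Lemma valids_mono n m R : n <= m -> valids n R -> valids m R.
Proof. by move=> nm vR r /vR; exact: inspan_mono. Qed.
#[export] Hint Resolve valid_suf valid_pre valid_sufs valid_pres valids_rev : rules.

(** * Three generators *)

(* With [Q_3 = <s_1, s_2>], in the usual numbering:
   [Q_4 = Q_3 u_3 Q_3 + Q_3 Y Q_3 + R Z+ + R Z-].  The word [om e] replaces
   [Z e] modulo the first two summands, and commutes with [s_1] and [s_2]. *)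
Definition Y : word := X 1 2 true.
Definition Z e : word := (2, e) :: X 0 1 true ++ [:: (2, e)].

Definition om e : word := [:: (2, e); (1, e); (0, e); (0, e); (1, e); (2, e)].

Definition nfM w := wlt 3 w && ((cnt 2 w <= 1) || mid (wlt 2) Y w).
Definition nf3 w := [|| nfM w, w == Z true | w == Z false].

Definition cnt2_le2 w := wlt 3 w && (cnt 2 w <= 2).

(** Aimed at lowering the number of letters s_3. Commutations of s_1 with s_3 carry a neighbour that
    the letter s_3 meets after the move; free commutations would not stop. *)
Definition r_q3 := r_cancel 3 ++ r_sq 3 ++ r_braid 2 1 ++
  sufs 1 (r_comm 2 0) ++ sufs 2 (r_comm 2 0) ++ pres 1 (r_comm 0 2) ++ [:: r_mixed 1 2 false].

Lemma valid_q3 n : 2 < n -> valids n r_q3.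
Proof. by move=> n2; rewrite /r_q3; rules; try exact: ltnW. Qed.
#[export] Hint Resolve valid_q3 : rules.

Definition pm i : seq word := [:: [:: (i, true)]; [:: (i, false)]].

Definition sandw (A B C : seq word) := [seq x ++ y | x <- A, y <- [seq b ++ c | b <- B, c <- C]].

Definition solves (T : pred word) ps ws := all (fun w => nilp (residue T ps w)) ws.
Lemma solvesP n (T : pred word) ps ws w : (forall p, p \in ps -> valids n p.2) ->
  solves T ps ws -> w \in ws -> inspan n T w.
Proof. by move=> vp /allP ok /ok; exact: residueP. Qed.

Lemma sandwP A B C x y z : x \in A -> y \in B -> z \in C -> x ++ y ++ z \in sandw A B C.
Proof. by move=> *; apply/allpairsP; exists (x, y ++ z); split=> //; apply/allpairsP;
  exists (y, z). Qed.

Lemma pmP i e : [:: (i, e)] \in pm i. Proof. by case: e; rewrite !inE eqxx ?orbT. Qed.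

Lemma u3_uuu_u3 e f t : t \in uuu 0 1 -> inspan 3 nfM ((2, e) :: t ++ [:: (2, f)]).
Proof.
move=> tu; apply: (@solvesP 3 nfM [:: (20, r_q3)] (sandw (pm 2) (uuu 0 1) (pm 2))).
- by rules.
- by vm_compute.
- by apply: (@sandwP _ _ _ [:: (2, e)]); rewrite ?pmP.
Qed.

Lemma valid_uncancel n i e : i < n -> valid n ([::], [:: [:: (i, e); (i, ~~ e)]]).
Proof. by move=> ni; apply: ax_valid; constructor. Qed.
#[export] Hint Resolve valid_uncancel : rules.

Definition r_X2s e f : rule := (X 0 1 e, [:: (1, f); (0, f); (0, f); (1, f)] :: uuu 0 1).
Lemma valid_X2s n e f : 1 < n -> valid n (r_X2s e f).
Proof.
move=> n2; apply: inspan_mono n2 _; case: (eqVneq e f) => [<-|ef].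
  by apply: (valid_X2 (r := r_X2s e e)); apply/mapP; exists e => //; case: e.
apply: (@residueP _ _ [:: (1, [:: r_mixed 0 1 e]); (1, r_X2)]); first by rules.
by case: e f ef => -[] // _; vm_compute.
Qed.

Definition conj21 := [seq ([:: (1, e); (2, ~~ e)], [:: [:: (2, ~~ e); (1, ~~ e); (2, e);
  (1, e)]]) | e <- signs].

Lemma valid_conj21 n : 2 < n -> valids n conj21.
Proof.
move=> n3; apply: valids_map => e; apply: inspan_mono n3 _.
apply: (@residueP _ _ [:: (1, [:: r_pre [:: (2, ~~ e)] ([::], [:: [:: (1, ~~ e);
  (1, ~~ ~~ e)]])]); (1, r_braid 1 2)]); first by rules.
by case: e; vm_compute.
Qed.
#[export] Hint Resolve valid_X2s valid_conj21 : rules.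

(** Exchange X for s_2^e s_1^(2e) s_2^e. From s_1 s_2 s_3 s_i = s_(i+1) s_1 s_2 s_3 for i = 1, 2 it
    follows that s_3 s_2 s_1^2 s_2 s_3^-1 is the conjugate of s_3 s_2^2 s_3 by s_1 s_2, and s_3
    s_2^2 s_3 is a multiple of Y modulo u_2 u_3 u_2. The same holds with all signs changed. *)
Lemma u3_X_u3 e : inspan 3 nfM ((2, e) :: X 0 1 true ++ [:: (2, ~~ e)]).
Proof.
apply: (@residueP _ _ [:: (1, [seq r_suf [:: (2, ~~ f)] (r_X2s true f) | f <- signs]);
  (1, pres 0 conj21);
  (9, r_comm 0 2); (20, r_q3 ++ r_braid 1 0); (1, sufs 1 (r_comm 2 0));
  (1, pres 2 (pres 1 (r_comm 0 2))); (9, r_braid 2 1 ++ [:: r_mixed 1 2 false])]).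
  by rules.
by case: e; vm_compute.
Qed.

Lemma u3_uuux_u3 e f t : t \in uuux 0 1 true -> inspan 3 nf3 ((2, e) :: t ++ [:: (2, f)]).
Proof.
rewrite in_cons => /orP [/eqP ->|/u3_uuu_u3 H]; last first.
  by apply: inspan_bind (H e f) _ => w nw; apply: inspan_in; rewrite /nf3 nw.
case: (eqVneq f (~~ e)) => [->|].
  by apply: inspan_bind (u3_X_u3 e) _ => w nw; apply: inspan_in; rewrite /nf3 nw.
by case: e; case: f => // _; apply: inspan_in.
Qed.

Definition r_om_comm i : seq rule := [seq ((i, e) :: om f, [:: rcons (om f) (i, e)]) |
  e <- signs, f <- signs].

(** [om] is the full twist of B_4 divided by that of B_3, or the inverse of this quotient. *)
Lemma valid_om_comm n i : i < 2 -> 2 < n -> valids n (r_om_comm i).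
Proof.
move=> i2 n3; apply: valids_mono n3 _ => _ /allpairsP [[e f] [_ _ ->]].
case: i i2 => [|[|//]] _.
  apply: (@residueP _ _ [:: (1, r_comm 0 2); (1, r_braid 0 1); (1, sufs 2 (r_braid 1 0));
    (9, r_comm 0 2)]); first by rules.
  by case: e; case: f; vm_compute.
apply: (@residueP _ _ [:: (2, r_comm 0 2 ++ r_braid 0 1); (1, r_braid 0 1 ++ r_braid 1 2);
  (9, r_comm 2 0); (1, r_braid 2 1); (1, r_braid 1 0); (9, r_comm 0 2)]); first by rules.
by case: e; case: f; vm_compute.
Qed.

(** A rule must list its right-hand side, so the words by which [Z e] and [om e] differ are
    computed. The target [pred0] discards nothing. *)
Definition u3_uuu_u3_nf e := undup (flatten [seq normalize pred0 r_q3 20 w |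
  w <- sandw [:: [:: (2, e)]] (uuu 0 1) [:: [:: (2, e)]]]).
Definition red e := Eval vm_compute in if e then u3_uuu_u3_nf true else u3_uuu_u3_nf false.
Definition r_Zom e : rule := (Z e, om e :: red e).
Definition r_omZ e : rule := (om e, Z e :: red e).
Definition r_0Z := [seq ((0,e) :: Z f, Z f :: red f) | e <- signs, f <- signs].

Lemma valid_Zom n e : 2 < n -> valid n (r_Zom e).
Proof.
move=> n3; apply: inspan_mono n3 _; apply: (@residueP _ _ [:: (1, [:: r_X2s true e]);
  (20, r_q3)]); first by rules.
by case: e; vm_compute.
Qed.

Lemma valid_omZ n e : 2 < n -> valid n (r_omZ e).
Proof.
move=> n3; apply: inspan_mono n3 _.
apply: (@residueP _ _ [:: (1, r_sq 1); (1, r_mixed 0 1 false :: r_braid 1 0); (20, r_q3)]);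
  first by rules.
by case: e; vm_compute.
Qed.

Lemma valid_0Z n : 2 < n -> valids n r_0Z.
Proof.
move=> n3; apply: valids_mono n3 _ => _ /allpairsP [[e f] [_ _ ->]].
apply: (@residueP _ _ [:: (1, r_comm 0 2); (1, r_absl); (20, r_q3)]).
  by rules; apply: valids_mono valid_absl.
by case: e; case: f; vm_compute.
Qed.
#[export] Hint Resolve valid_om_comm valid_Zom valid_omZ valid_0Z : rules.

Definition r_conj1 e : rule := ([:: (1, e)], [:: [:: (0, true); (1, true); (0, e); (1, false);
  (0, false)]]).
Lemma valid_conj1 n e : 1 < n -> valid n (r_conj1 e).
Proof.
move=> n2; apply: inspan_mono n2 _.
apply: (@residueP _ _ [:: (1, [:: r_suf [:: (1, e)] ([::], [:: [:: (0, true); (0, ~~ true)]])]);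
  (1, [:: r_pre [:: (0, false); (1, e)] ([::], [:: [:: (0, true); (0, ~~ true)]])]);
    (1, r_braid 0 1)]).
  by rules.
by case: e; vm_compute.
Qed.
#[export] Hint Resolve valid_conj1 : rules.

(** Z absorbs s_1 because X does. For s_2, write s_2 = g s_1 g^-1 with g = s_1 s_2. Exchanging Z for
    [om] lets g^-1 pass to the right; s_1 is then absorbed by Z, and a second exchange brings g^-1
    back to cancel g. *)
Lemma q3_Z i e f : i < 2 -> inspan 3 (fun w => nfM w || (w == Z f)) ((i, e) :: Z f).
Proof.
case: i => [|[|//]] _.
  apply: (@residueP _ _ [:: (1, r_0Z)]); first by rules.
  by case: e; case: f; vm_compute.
apply: (@residueP _ _ [:: (1, [seq r_suf [:: (2, f');
  (1, true)] (r_conj1 e') | e' <- signs, f' <- signs]); (1, [seq r_Zom e | e <- signs]);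
  (2, r_om_comm 0 ++ r_om_comm 1);
 (1, [seq r_omZ e | e <- signs]); (1, r_0Z); (20, r_q3); (1, [seq r_Zom e | e <- signs]);
   (2, map r_rev (r_om_comm 0 ++ r_om_comm 1));
 (3, r_cancel 3);  (1, [seq r_omZ e | e <- signs]); (20, r_q3)]).
  by rules.
by case: e; case: f; vm_compute.
Qed.

Lemma nfM_closed x w y : wlt 2 x -> wlt 2 y -> nfM w -> nfM (x ++ w ++ y).
Proof.
move=> x2 y2 /andP [w3 wM]; rewrite /nfM !wlt_cat w3 !(@wlt_leq 2 3) //= !cnt_cat (wlt_cnt x2)
  (wlt_cnt y2) add0n addn0.
case/orP: wM => [-> //|/midP [u [v [u2 v2 ->]]]].
apply/orP; right; apply/midP; exists (x ++ u), (v ++ y).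
by rewrite !wlt_cat u2 v2 x2 y2 !catA.
Qed.

Lemma nfM_cons i e w : i < 2 -> nfM w -> nfM ((i, e) :: w).
Proof. by move=> i2 wM; rewrite -[_ :: w]/([:: (i, e)] ++ w) -[w]cats0 nfM_closed //= /wlt /= i2.
  Qed.

Lemma nfM_rev w : nfM w -> nfM (rev w).
Proof.
rewrite /nfM wlt_rev cnt_rev => /andP [-> /orP [-> //|/midP [u [v [u2 v2 ->]]]]].
apply/orP; right; apply/midP; exists (rev v), (rev u).
by rewrite !wlt_rev u2 v2 !rev_cat !catA.
Qed.

Lemma q3_Zl x f : wlt 2 x -> inspan 3 (fun w => nfM w || (w == Z f)) (x ++ Z f).
Proof.
elim: x => [_|[i e] x IH /andP [/= i2 /IH xZ]]; first by apply: inspan_in; rewrite eqxx orbT.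
rewrite -[_ :: _]/([:: (i, e)] ++ (x ++ Z f)) -[x ++ _]cats0; apply: inspan_ctx xZ _ => t.
rewrite cats0 => /orP [tM|/eqP ->]; last exact: q3_Z.
by apply: inspan_in; rewrite nfM_cons.
Qed.

Lemma q3_Zr x f : wlt 2 x -> inspan 3 (fun w => nfM w || (w == Z f)) (Z f ++ x).
Proof.
move=> x2; have /(q3_Zl f)/inspan_rev : wlt 2 (rev x) by rewrite wlt_rev.
rewrite rev_cat revK => H; apply: inspan_bind H _ => t /orP [/nfM_rev|/eqP].
  by rewrite revK => tM; apply: inspan_in; rewrite tM.
by move=> /(congr1 rev); rewrite revK => ->; apply: inspan_in; rewrite eqxx orbT.
Qed.

Lemma q3_nf3_q3 x w y : wlt 2 x -> wlt 2 y -> nf3 w -> inspan 3 nf3 (x ++ w ++ y).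
Proof.
move=> x2 y2; rewrite /nf3 orbA -orbA => /orP [wM|wZ].
  by apply: inspan_in; rewrite nfM_closed.
have [f {wZ}->] : exists f, w = Z f by case/orP: wZ => /eqP ->; [exists true|exists false].
rewrite catA -[_ ++ y]cats0 -catA; apply: (@inspan_ctx _ _ _ [::] _ _ (q3_Zl f x2)) => t /=;
  rewrite cats0.
case/orP => [tM|/eqP ->].
  by apply: inspan_in; rewrite /nf3 -[t ++ y]/([::] ++ t ++ y) nfM_closed.
apply: inspan_bind (q3_Zr f y2) _ => s /orP [sM|/eqP ->]; apply: inspan_in.
  by rewrite /nf3 sM.
by case: (f).
Qed.

Lemma nf3_cnt2_le2 w : cnt2_le2 w -> inspan 3 nf3 w.
Proof.
case/andP=> w3; rewrite leq_eqVlt ltnS => /orP [/eqP w2|w1]; last first.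
  by apply: inspan_in; rewrite /nf3 /nfM w3 w1.
have [x [e [v [-> x2 v3 v1]]]] := cnt_split w3 w2.
have [y [f [z [-> y2 z3 z0]]]] := cnt_split v3 v1.
have z2 := cnt_wlt z3 z0.
have -> : x ++ (2, e) :: y ++ (2, f) :: z = (x ++ [:: (2, e)]) ++ y ++ [:: (2, f)] ++
  z by rewrite -!catA.
apply: inspan_ctx (inspan_mono (isT : 2 <= 3) (wlt2_nf y2)) _ => t tu.
have -> : (x ++ [:: (2, e)]) ++ t ++ [:: (2, f)] ++ z = x ++ ((2, e) :: t ++ [:: (2, f)]) ++
  z by rewrite /= -!catA.
by apply: inspan_ctx (u3_uuux_u3 e f tu) _ => s; exact: q3_nf3_q3.
Qed.

Definition r_y := at_ 1 2 r_abs.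
Definition r_y1 := map (r_suf [:: (0, true)]) (map r_rev (at_ 1 2 [:: (X 0 1 true, ((0, true) ::
  X 0 1 true) :: uuu 0 1)])) ++ [:: r_suf [:: (0, false)] (r_mixed 1 2 true)].

Lemma valid_y n : 2 < n -> valids n r_y.
Proof. by move=> n3; apply: valids_mono n3 _; rewrite /r_y; rules. Qed.

Lemma valid_y1 n : 2 < n -> valids n r_y1.
Proof. by move=> n3; apply: valids_mono n3 _; rewrite /r_y1; rules. Qed.
#[export] Hint Resolve valid_y valid_y1 : rules.

(** Since Y absorbs a final s_2 of x, the words to treat are essentially s_3^e s_2^g s_1^h Y. Moving
    s_3 across s_1^h produces s_3^e s_2^g s_3, which a braid move shortens unless it is Y itself;
    [r_y1] deals with the resulting Y s_1^h. *)
Lemma u3_q3_Y e x : wlt 2 x -> inspan 3 cnt2_le2 ((2, e) :: x ++ Y).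
Proof.
move=> x2; rewrite -[_ :: _]/([:: (2, e)] ++ x ++ Y);
  apply: inspan_ctx (@nf2 3 1 0 x _ _ _ _) _ => //.
  by apply: sub_all x2 => -[[|[|]] f].
move=> t tu; apply: (@solvesP 3 cnt2_le2 [:: (20, r_q3 ++ r_y); (9, pres 1 (r_comm 0 2));
  (1, r_y1); (20, r_q3 ++ r_braid 1 0)]
   (sandw (pm 2) (uuux 1 0 true) [:: Y])); [by rules|by vm_compute|].
by apply: (@sandwP _ _ _ [:: (2, e)]); rewrite ?pmP.
Qed.

Lemma u3_Z e f : inspan 3 cnt2_le2 ((2, e) :: Z f).
Proof. by apply: (@residueP _ _ [:: (20, r_q3 ++ r_y)]); [rules|case: e; case: f; vm_compute]. Qed.

Theorem nf3P w : wlt 3 w -> inspan 3 nf3 w.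
Proof.
elim: w => [_|[i e] w' IH /andP [/= i3 /IH wn]]; first exact: inspan_in.
rewrite -[_ :: _]/([:: (i, e)] ++ w') -[w']cats0; apply: inspan_ctx wn _ => w; rewrite cats0 => wn.
have [i2|] := ltnP i 2.
  by rewrite -[w]cats0; apply: q3_nf3_q3 => //=; rewrite /wlt /= i2.
rewrite leq_eqVlt ltnNge -ltnS i3 orbF => /eqP i2; subst i.
case/or3P: wn => [|/eqP ->|/eqP ->]; try by apply: inspan_bind (u3_Z e _) _ => t;
  exact: nf3_cnt2_le2.
case/andP=> w3 /orP [w1|/midP [u [v [u2 v2 ->]]]]; first by apply: nf3_cnt2_le2;
  rewrite /cnt2_le2 /= w3.
have -> : [:: (2, e)] ++ u ++ Y ++ v = [::] ++ ((2, e) :: u ++ Y) ++ v by rewrite /= -!catA.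
apply: inspan_ctx (u3_q3_Y e u2) _ => t /andP [t3 t2]; apply: nf3_cnt2_le2.
by rewrite cat0s /cnt2_le2 wlt_cat t3 (wlt_leq _ v2) //= cnt_cat (wlt_cnt v2) addn0.
Qed.

(** * Four generators *)

(* [F k] describes the spanning words of [Q_5^(k)]. *)
Definition F k w := cnt 3 w <= k.
Definition W : word := X 2 3 true.
Definition V e : word := (3, e) :: Y ++ [:: (3, e)].

Definition Ee e : word := W ++ [:: (1, true); (0, false)] ++ Y ++ [:: (3, e)].

Lemma wlt2_3 x : wlt 2 x -> wlt 3 x. Proof. exact: wlt_leq. Qed.

Lemma cnt3 x : wlt 3 x -> cnt 3 x = 0. Proof. exact: wlt_cnt. Qed.
Ltac count := rewrite /F ?(cnt_cat, cnt_cons, cnt_rev) /=;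
  repeat match goal with
  | H : is_true (wlt 2 ?x) |- context [cnt 3 ?x] => rewrite (cnt3 (wlt2_3 H))
  | H : is_true (wlt 3 ?x) |- context [cnt 3 ?x] => rewrite (cnt3 H)
  | H : is_true (F _ ?x) |- context [cnt 3 ?x] => move: H; rewrite /F => ?
  end; try lia.

Lemma inspan_F k j u m v : inspan 4 (F k) m -> cnt 3 u + cnt 3 v + k <= j ->
  inspan 4 (F j) (u ++ m ++ v).
Proof. by move=> Fm uv; apply: inspan_ctx Fm _ => t Ft; apply: inspan_in; count. Qed.

Lemma inspan_ax1 n (T : word -> Prop) u l r v : ax n l [:: r] -> inspan n T (u ++ r ++ v) ->
  inspan n T (u ++ l ++ v).
Proof. by move=> lr Tr; apply: inspan_step lr _ => x; rewrite inE => /eqP ->. Qed.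

Lemma comm4 (T : word -> Prop) u e x v : wlt 2 x -> inspan 4 T (u ++ x ++ (3, e) :: v) ->
  inspan 4 T (u ++ (3, e) :: x ++ v).
Proof.
elim: x u => //= -[i f] x IH u /andP [/= i2 x2] Tx.
apply: (@inspan_ax1 _ _ u [:: (3, e); (i, f)] [:: (i, f); (3, e)]).
  by constructor=> //; [lia|rewrite /far; lia].
by rewrite -cat_rcons /=; apply: IH => //; rewrite cat_rcons.
Qed.

Lemma comm4i (T : word -> Prop) u e x v : wlt 2 x -> inspan 4 T (u ++ (3, e) :: x ++ v) ->
  inspan 4 T (u ++ x ++ (3, e) :: v).
Proof.
elim/last_ind: x v => //= x [i f] IH v; rewrite /wlt all_rcons => /andP [/= i2 x2] Tx.
rewrite cat_rcons catA; apply: (@inspan_ax1 _ _ (u ++ x) [:: (i, f); (3, e)] [:: (3, e); (i, f)]).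
  by constructor=> //; [lia|rewrite /far; lia].
by rewrite -catA; apply: IH => //; rewrite -(cat_rcons (i, f) x).
Qed.

Lemma merge4 k u e x f v : wlt 2 x -> cnt 3 u + cnt 3 v < k ->
  inspan 4 (F k) (u ++ (3, e) :: x ++ (3, f) :: v).
Proof.
move=> x2 uv; apply: comm4 => //; rewrite catA.
have [<-|ef] := eqVneq e f.
  apply: (@inspan_step _ _ (u ++ x) [:: (3, e); (3, e)]); first by constructor.
  by move=> r; rewrite !inE => /or3P [] /eqP ->; apply: inspan_in; count.
have ->: f = ~~ e by case: e f ef => -[].
apply: (@inspan_step _ _ (u ++ x) [:: (3, e); (3, ~~ e)]); first by constructor.
by move=> r; rewrite !inE => /eqP ->; apply: inspan_in; count.
Qed.

Lemma nf234 w : all (fun l => 0 < l.1 < 4) w -> inspan 4 (fun t =>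
  exists2 s, nf3 s & t = relabel succn s) w.
Proof.
move=> w4; have -> : w = relabel succn (relabel predn w).
  rewrite /relabel -map_comp map_id_in // => -[i e] /(allP w4) /=; by case: i.
have /nf3P/inspan_relabel H : wlt 3 (relabel predn w).
  by rewrite /wlt all_map; apply: sub_all w4 => -[i e] /=; lia.
by apply: H.
Qed.

(** The normal form of Q_4, shifted to s_2, s_3, s_4, has at most two letters of highest index in
    each word. *)
Lemma F234 w : all (fun l => 0 < l.1 < 4) w -> inspan 4 (F 2) w.
Proof.
move=> /nf234 H; apply: inspan_bind H _ => _ [s sn ->]; apply: inspan_in.
have -> : F 2 (relabel succn s) = (cnt 2 s <= 2) by rewrite /F /cnt /relabel count_map.
case/or3P: sn => [/andP [_ /orP [|/midP [u [v [u2 v2 ->]]]]]|/eqP ->|/eqP ->] //; first by lia.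
by rewrite !cnt_cat (wlt_cnt u2) (wlt_cnt v2).
Qed.

(* The predicates [T1], ..., [Tc] below are decidable sufficient conditions for a
   word to lie in the span of interest, to be used as targets of [residue]. *)
Fixpoint dropw (p : pred letter) (w : word) :=
  if w is x :: w' then if p x then dropw p w' else w else [::].

Definition zero (l : letter) := l.1 == 0.
Definition core w := rev (dropw zero (rev (dropw zero w))).
Definition q3l (l : letter) := l.1 < 2.
Definition T1 w := wlt 4 w && (F 2 w || all (predC zero) (core w)).
Definition Tb w := let w' := dropw q3l w in
  [&& take 3 w' == W, wlt 4 w, cnt 2 (drop 3 w') <= 1 & cnt 3 (drop 3 w') <= 1].

Definition TE e w := let k := size w - size (Ee e) in wlt 2 (take k w) && (drop k w == Ee e).
Definition TY e w := let w' := dropw q3l w in let r := drop 3 w' in let k := size r - 4 in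
  [&& take 3 w' == W, wlt 2 (take k r) & drop k r == Y ++ [:: (3, e)]].

Definition Tc e w := [|| T1 w, Tb w | TE e w].

Lemma dropwP p w : exists2 u, all p u & w = u ++ dropw p w.
Proof.
elim: w => [|x w [u pu e]] /=; first by exists [::].
by case: ifP => px; [exists (x :: u); rewrite /= ?px // -e|exists [::]].
Qed.

Lemma T1P w : T1 w -> inspan 4 (F 2) w.
Proof.
case/andP=> w4 /orP [|c0]; first exact: inspan_in.
have [u u0 wE] := dropwP zero w; have [v v0 /(congr1 rev)] := dropwP zero (rev (dropw zero w)).
rewrite revK rev_cat -/(core w) => dE; rewrite wE dE.
have z3 x : all zero x -> cnt 3 x = 0.
  by move=> x0; apply: cnt3; apply: sub_all x0 => l /eqP ->.
apply: (@inspan_F 2); last by rewrite cnt_rev !z3.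
apply: F234; apply/allP => l lc; have /negP l0 := allP c0 l lc.
have l4 : l.1 < 4 by apply: (allP w4); rewrite wE dE !mem_cat lc orbT.
by rewrite l4 andbT lt0n; apply/negP.
Qed.

(** * The products W Q_4 s_4^e *)

Definition W3 f : rule := (W, (rcons W (2, f)) :: uuu 2 3).
Definition r_Wcomm : seq rule := [seq (rcons W (0, e), [:: (0, e) :: W]) | e <- signs].

Lemma valid_W3 f : valid 4 (W3 f).
Proof.
have /valids_rev v2 : valids 2 r_unabs by exact: valid_unabs.
have [r rP rE] : exists2 r, r \in map r_rev r_unabs & rmap (pq 2 3) r = (W, rcons W (2, f) ::
  map rev (uuu 2 3)).
  by exists (r_rev (X 0 1 true, ((0, f) :: X 0 1 true) :: uuu 0 1)); [apply/map_f/allpairsP;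
    exists (true, f); case: f|].
have := valid_pq (p := 2) (q := 3) (n := 4) isT isT isT (v2 _ rP); rewrite rE => H.
apply: inspan_bind H _ => t /=; rewrite inE => /orP [/eqP ->|tr]; apply: inspan_in;
  rewrite inE ?eqxx //.
by apply/orP; right; move: t tr; apply/allP; vm_compute.
Qed.

Lemma valid_Wcomm : valids 4 r_Wcomm.
Proof. apply: valids_map => e; apply: (@residueP _ _ [:: (3, r_comm 3 0 ++ r_comm 2 0)]);
  [by rules|by case: e; vm_compute]. Qed.
#[export] Hint Resolve valid_W3 valid_Wcomm : rules.

(** Let W have the sign opposite to e. Its last letter passes X and gives s_4^-e s_3^f s_4^e, where
    a braid move removes one s_4. *)
Lemma WX34 f e : inspan 4 T1 (W ++ X 0 1 true ++ [:: (2, f); (3, e)]).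
Proof.
apply: (@residueP _ _ [:: (1, if e then [:: r_mixed 2 3 true] else [::]);
  (9, r_comm 3 0 ++ r_comm 3 1); (9, r_braid 3 2)]).
  by case: e; rules.
by case: e; case: f; vm_compute.
Qed.

Lemma Wuuu34 t f e : t \in uuu 0 1 -> inspan 4 T1 (W ++ t ++ [:: (2, f); (3, e)]).
Proof.
move=> tu; apply: (@solvesP 4 T1 [:: (1, r_Wcomm); (9, pres 1 (r_comm 0 2) ++
  pres 2 (r_comm 0 3))] (sandw [:: W] (uuu 0 1) (sandw (pm 2) [:: [::]] (pm 3)))).
- by rules.
- by vm_compute.
by apply: (@sandwP _ _ _ W) => //; apply: (@sandwP _ _ _ [:: (2, f)] [::]); rewrite ?pmP.
Qed.

Lemma W_q3_4 x e : wlt 2 x -> inspan 4 (F 2) (W ++ x ++ [:: (3, e)]).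
Proof. by move=> x2; apply: (@merge4 2 [:: (3, true); (2, false)] true x e [::]). Qed.

Lemma W_q3u3q3_4 x f y e : wlt 2 x -> wlt 2 y -> inspan 4 (F 2) (W ++ x ++ (2, f) :: y ++
  [:: (3, e)]).
Proof.
move=> x2 y2; rewrite (_ : _ ++ _ = (W ++ x ++ [:: (2, f)]) ++ y ++ [:: (3, e)]);
  last by rewrite -!catA.
apply: comm4i => //; rewrite cats0 -2!catA; apply: (inspan_ctx (nf2 (p := 0) (q := 1) _ _ _ _))
  => //.
  by apply: sub_all x2 => -[[|[|]] g].
move=> t; rewrite in_cons => tu.
rewrite (_ : _ ++ _ = [::] ++ (W ++ t ++ [:: (2, f); (3, e)]) ++ y); last by rewrite /= -!catA.
apply: (@inspan_F 2); last by count.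
have {tu} : inspan 4 T1 (W ++ t ++ [:: (2, f); (3, e)]).
  by case/orP: tu => [/eqP ->|tu]; [exact: WX34|exact: Wuuu34].
by move=> H; apply: inspan_bind H _; exact: T1P.
Qed.

Lemma TbP w : Tb w -> inspan 4 (F 2) w.
Proof.
case/and4P=> /eqP wW w4; set r := drop 3 _ => r2 r3.
have [u u2 wE] := dropwP q3l w.
have {wW wE} wE : w = u ++ W ++ r by rewrite {1}wE -wW cat_take_drop.
have [_ /andP [_ r4]] : wlt 4 u /\ wlt 4 W && wlt 4 r by move: w4; rewrite wE !wlt_cat => /andP [].
have {}u2 : wlt 2 u by [].
move: r3; rewrite leq_eqVlt ltnS leqn0 => /orP [/eqP r3|/eqP r3]; last first.
  by rewrite wE; apply: inspan_in; count.
have [r1 [e [s [rE r13 s4 s3]]]] := cnt_split r4 r3.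
have {}s4 := cnt_wlt s4 s3.
have {wE} -> : w = u ++ (W ++ r1 ++ [:: (3, e)]) ++ s by rewrite wE rE -!catA.
apply: (@inspan_F 2); last by count.
have r12 : cnt 2 r1 <= 1 by move: r2; rewrite rE cnt_cat; lia.
move: r12; rewrite leq_eqVlt ltnS leqn0 => /orP [/eqP r12|/eqP r12].
  have [x [f [y [-> x2 y3 y2]]]] := cnt_split r13 r12.
  by rewrite -catA; apply: W_q3u3q3_4 => //; exact: cnt_wlt.
by apply: W_q3_4; exact: cnt_wlt.
Qed.

(* [W Q_4 s_4^e] is contained in [Q_5^(2) + Q_3 Ee], and so is [Ee Q_3]. *)
Definition Ec e t := F 2 t \/ exists2 x, wlt 2 x & t = x ++ Ee e.

Lemma Ec_left e x t : wlt 2 x -> Ec e t -> Ec e (x ++ t).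
Proof.
move=> x2 [tF|[y y2 ->]]; first by left; count.
by right; exists (x ++ y); rewrite ?wlt_cat ?x2 // catA.
Qed.

Lemma TcP e w : Tc e w -> inspan 4 (Ec e) w.
Proof.
case/or3P=> [/T1P|/TbP|/andP [k2 /eqP kE]]; try by move=> H; apply: inspan_bind H _ => t tF;
  apply: inspan_in; left.
by apply: inspan_in; right; exists (take (size w - size (Ee e)) w);
  rewrite // -[X in _ ++ X]kE cat_take_drop.
Qed.

Definition Yneg : rule := r_pre [:: (1, false); (0, false)] (r_mixed 1 2 true).
(** An empty pattern would match at the left end of every word; the context [u], [v] pins down the
    place of insertion. *)
Definition ins u i e v : rule := r_pre u (r_suf v ([::], [:: [:: (i, e); (i, ~~ e)]])).
Lemma valid_ins n u i e v : i < n -> valid n (ins u i e v).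
Proof. by move=> ni; apply: valid_pre; apply: valid_suf; exact: valid_uncancel. Qed.
#[export] Hint Resolve valid_ins : rules.

Lemma valid_Yneg : valid 4 Yneg.
Proof. by apply: valid_pre; rules. Qed.

Definition r_2inv1 : rule := ([:: (1, false); (0, true)], [:: [:: (0, true); (1, true);
  (0, false); (1, false)]]).
Lemma valid_2inv1 : valid 4 r_2inv1.
Proof. by apply: (@residueP _ _ [:: (1, [:: ins [::] 0 true [:: (1, false); (0, true)]]);
  (1, r_braid 0 1)]); [rules|vm_compute]. Qed.
#[export] Hint Resolve valid_Yneg valid_2inv1 : rules.

(** With s_1 moved to the left of W and s_2 absorbed by Y, there remain the words W s_2^g s_1^h Y
    s_4^e. For g = +, h = - this is [Ee e]; for g = -, h = + it becomes s_1 [Ee e] by s_2^-1 s_1 =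
    s_1 s_2 s_1^-1 s_2^-1. For g = h, W emits s_3^g by [W3], and s_3^g s_2^g s_1^g Y, with Y taken
    in the sign g, is a word with a single s_3. *)
Lemma W_q3_Y x e : wlt 2 x -> inspan 4 (Ec e) (W ++ x ++ Y ++ [:: (3, e)]).
Proof.
move=> x2; apply: (inspan_ctx (nf2 (p := 1) (q := 0) _ _ _ _)) => //.
  by apply: sub_all x2 => -[[|[|]] g].
move=> t tu; apply: (inspan_bind (T := Tc e)); last exact: TcP.
apply: (@solvesP 4 (Tc e) [:: (9, r_cancel 3 ++ r_sq 3 ++ r_y); (1, r_Wcomm);
   (1, [:: r_pre W r_2inv1; Yneg] ++
       [seq r_suf [:: (1, f); (0, f)] (W3 f) | f <- signs]);
   (1, [seq r_suf [:: (1, f); (0, f)] (W3 f) | f <- signs] ++ r_Wcomm); (9, r_y);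
     (20, r_q3 ++ r_braid 1 0);
   (1, sufs 1 (r_comm 2 0)); (1, pres 2 (pres 1 (r_comm 0 2))); (9, r_braid 2 1)]
   (sandw [:: W] (uuux 1 0 true) [:: Y ++ [:: (3, e)]])).
- by rules.
- by case: e; vm_compute.
by apply: (@sandwP _ _ _ W); rewrite ?mem_head.
Qed.

(** The middle of [Ee]. It intertwines s_1 and s_3, as [A1] and its reverse [A1i] express. *)
Definition m1 : word := [:: (1, true); (0, false)] ++ Y.
Definition A1 : rule := (m1 ++ [:: (0, true)], [:: (2, true) :: m1]).
Definition A1i : rule := ((2, true) :: m1, [:: m1 ++ [:: (0, true)]]).
Lemma valid_A1 : valid 4 A1.
Proof. by apply: (@residueP _ _ [:: (1, pres 1 (r_comm 2 0)); (1, pres 1 (r_comm 0 2));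
  (1, r_braid 0 1); (1, r_braid 1 2);  (1, sufs 1 (r_comm 2 0))]); [rules|vm_compute]. Qed.

Lemma valid_A1i : valid 4 A1i.
Proof. by apply: (@residueP _ _ [:: (1, pres 1 (r_comm 0 2)); (1, r_braid 2 1); (1, r_braid 1 0);
  (1, sufs 1 (r_comm 2 0)); (1, map (r_pre [:: (1, false)]) (r_comm 0 2))]); [rules|vm_compute].
  Qed.

(** Once more s_1 s_2 s_3 s_i = s_(i+1) s_1 s_2 s_3, solved for s_3 s_2^2 s_3 s_1 s_2. *)
Definition B1 : rule := ([:: (2, true); (1, true); (1, true); (2, true); (0, true);
  (1, true)], [:: [:: (0, true); (1, true)] ++ [:: (2, true); (1, true); (0, true); (0, true);
  (1, true); (2, false)]]).
Definition r_m121 : rule := ([:: (0, false); (1, true); (0, true)], [:: [:: (1, true); (0, true);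
  (1, false)]]).
Definition B1_phases := [:: (1, [:: ins [:: (1, true)] 0 true [:: (1, true)]]); (1, r_comm 2 0);
  (1, [:: ins [::] 0 true [:: (2, true); (1, true)]]); (1, map (r_pre [:: (0, true)]) (r_comm 0 2));
 (2, [:: r_m121]); (1, r_cancel 3); (1, [:: ins [:: (0, true)] 1 true [:: (2, true); (1, true)]]);
 (1, r_braid 1 2); (2, r_comm 2 0); (1, sufs 1 (r_braid 2 1)); (1, r_cancel 3)].

Lemma valid_m121 : valid 4 r_m121.
Proof. by apply: (@residueP _ _ [:: (1, r_braid 0 1)]); [rules|vm_compute]. Qed.
#[export] Hint Resolve valid_m121 valid_A1 valid_A1i : rules.

Lemma valid_B1 : valid 4 B1.
Proof. by apply: (@residueP _ _ B1_phases); [rules|vm_compute]. Qed.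

Definition r_Y2 := r_suf [:: (0, true)] (rmap (pq 1 2) (r_X2s true true)).
Lemma valid_Y2 : valid 4 r_Y2.
Proof. by apply: valid_suf; apply: valid_pq => //; apply: valid_X2s. Qed.

Definition r_sq1 i : rule := ([:: (i, true); (i, true)], [:: [:: (i, true)]; [::];
  [:: (i, false)]]).
Lemma valid_sq1 n i : i < n -> valid n (r_sq1 i).
Proof. by move=> ni; apply: ax_valid; apply: ax_sq. Qed.
#[export] Hint Resolve valid_B1 valid_Y2 valid_sq1 : rules.

Lemma TYP e w : TY e w -> inspan 4 (Ec e) w.
Proof.
case/and3P=> /eqP wW; set r := drop 3 _ => k2 /eqP rE.
have [u u2 wE] := dropwP q3l w.
rewrite wE -(cat_take_drop 3 (dropw q3l w)) wW -/r -(cat_take_drop (size r - 4) r) rE.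
rewrite -[u ++ _]cats0 -catA; apply: inspan_ctx (W_q3_Y e k2) _ => t tE; apply: inspan_in.
by rewrite cats0; apply: Ec_left.
Qed.

Definition Ee_letter_phases := [:: (1, pres 2 (r_comm 3 1)); (1, [:: W3 true]); (1, [:: A1i]);
  (1, [:: r_Y2]);
 (1, [:: B1]); (1, r_cancel 1); (1, [:: r_sq1 1]);
 (1, [:: r_pre [:: (1, false); (2, true); (1, true)] (r_sq1 0)]);
 (1, r_braid 1 2); (1, at_ 2 3 r_abs); (9, r_comm 2 0); (1, r_braid 2 1 ++ [:: r_mixed 1 2 false])].

(** A letter s_1 passes s_4^e, leaves [m1] on the left as s_3 and is absorbed by W. For s_2 the
    traffic is reversed: W emits s_3, which leaves [m1] on the right as s_1, and [B1] applies to the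
    resulting s_1 s_2. *)
Lemma Ee_letter e i : i < 2 -> inspan 4 (Ec e) (Ee e ++ [:: (i, true)]).
Proof.
move=> i2; apply: (inspan_bind (T := fun w => Tc e w || TY e w)); last by move=> t /orP [/TcP|/TYP].
case: i i2 => [|[|//]] _.
  apply: (@residueP _ _ [:: (1, r_comm 3 0); (1, [:: A1]); (1, at_ 2 3 r_abs)]); first by rules.
  by case: e; vm_compute.
by apply: (@residueP _ _ Ee_letter_phases); [rules|case: e; vm_compute].
Qed.

Lemma Ec_right e y t : wlt 2 y -> Ec e t -> inspan 4 (Ec e) (t ++ y).
Proof.
elim: y t => [|[i f] y IH] t; first by rewrite cats0 => _ tE; exact: inspan_in.
move=> /andP [/= i2 y2] tE.
have step s : Ec e s -> inspan 4 (Ec e) (s ++ [:: (i, true)]).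
  case=> [sF|[x x2 ->]]; first by apply: inspan_in; left; count.
  by rewrite -catA -[_ ++ _]cats0 -catA; apply: inspan_ctx (Ee_letter e i2) _ => s' sE;
    rewrite cats0; apply: inspan_in; exact: Ec_left.
suff H : inspan 4 (Ec e) (t ++ [:: (i, f)]).
  by rewrite -cat_rcons -cats1 -[_ ++ y]cat0s; apply: inspan_ctx H _ => s sE; exact: IH.
case: f; first exact: step.
(* An inverse letter is a combination of the square of the positive letter, that letter and 1. *)
apply: (@inspan_step _ _ t [:: (i, false)] [::]); first by constructor; lia.
move=> r; rewrite !inE => /or3P [] /eqP ->; rewrite ?cats0; last 1 first.
- exact: inspan_in.
- rewrite (_ : _ ++ _ = [::] ++ (t ++ [:: (i, true)]) ++ [:: (i, true)]); last by rewrite -!catA.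
  by apply: inspan_ctx (step t tE) _ => s; exact: step.
- exact: step.
Qed.

Lemma W_q4_4 q e : wlt 3 q -> inspan 4 (Ec e) (W ++ q ++ [:: (3, e)]).
Proof.
move=> q3; apply: inspan_ctx (inspan_mono (isT : 3 <= 4) (nf3P q3)) _ => {q q3} t.
have WZ f : inspan 4 (Ec e) (W ++ Z f ++ [:: (3, e)]).
  apply: (inspan_bind (T := Tc e)); last exact: TcP.
  (* W absorbs the first letter of Z, which leaves a single s_3. *)
  by apply: (@residueP _ _ [:: (1, at_ 2 3 r_abs)]); [rules|case: e; case: f; vm_compute].
case/or3P=> [/andP [t3 /orP [|/midP [u [v [u2 v2 ->]]]]]|/eqP ->|/eqP ->] //; last first.
  rewrite (_ : W ++ _ = (W ++ u ++ Y) ++ v ++ [:: (3, e)]); last by rewrite -!catA.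
  apply: comm4i => //.
  have -> : (W ++ u ++ Y) ++ (3, e) :: v ++ [::] = [::] ++ (W ++ u ++ Y ++ [:: (3, e)]) ++
    v by rewrite cats0 cat0s -!catA.
  by apply: inspan_ctx (W_q3_Y e u2) _ => s; exact: Ec_right.
rewrite leq_eqVlt ltnS leqn0 => /orP [/eqP t1|/eqP t0].
  have [x [f [y [-> x2 y3 y0]]]] := cnt_split t3 t1.
  rewrite -catA; apply: inspan_bind (W_q3u3q3_4 f e x2 (cnt_wlt y3 y0)) _ => s sF.
  by apply: inspan_in; left.
by apply: inspan_bind (W_q3_4 e (cnt_wlt t3 t0)) _ => s sF; apply: inspan_in; left.
Qed.

(** * Products of three factors u_4 that contain W *)

Ltac reshape r := match goal with |- inspan ?n ?T ?w =>
  rewrite (_ : w = r); last by rewrite /= ?cats0 -?catA /= -?catA /= -?catA end.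

Lemma F_rev k w : inspan 4 (F k) (rev w) -> inspan 4 (F k) w.
Proof. by move/inspan_rev; rewrite revK => H; apply: inspan_bind H _ => t tF; apply: inspan_in;
  move: tF; rewrite /F cnt_rev. Qed.

Lemma valid_succ r : valid 3 r -> valid 4 (rmap succn r).
Proof. by move=> vr; apply: inspan_bind (@inspan_relabel 3 4 succn _ _ _ _ _ vr) _ =>
  // _ [t tr ->]; apply: inspan_in; apply: map_f. Qed.

Lemma inspan_F_sub k (T : word -> Prop) w : inspan 4 (F k) w -> (forall t, F k t -> T t) ->
  inspan 4 T w.
Proof. by move=> H HT; apply: inspan_bind H _ => t /HT; exact: inspan_in. Qed.

Definition Td w := F 3 w || has (fun k => Tb (rev (take k w)) && (cnt 3 (drop k w) <= 1)) (iota 0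
  (size w).+1).
Lemma TdP w : Td w -> inspan 4 (F 3) w.
Proof.
case/orP=> [|/hasP [k _ /andP [/TbP/F_rev kF dF]]]; first exact: inspan_in.
by rewrite -(cat_take_drop k w) -[take k w]cat0s -catA; apply: inspan_F kF _; count.
Qed.

Definition r_dp_comm : seq rule := map (rmap succn) (map r_rev (r_om_comm 1)).
Lemma valid_dp_comm : valids 4 r_dp_comm.
Proof.
have v3 : valids 3 (map r_rev (r_om_comm 1)) by rules.
by move=> _ /mapP [r /v3 vr ->]; exact: valid_succ.
Qed.
#[export] Hint Resolve valid_dp_comm : rules.

Definition r_Yom e : rule := rmap (pq 1 2) (r_X2s true e).
Lemma valid_Yom e : valid 4 (r_Yom e). Proof. by apply: valid_pq => //; apply: valid_X2s. Qed.
#[export] Hint Resolve valid_Yom : rules.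

(* [Q_5^(1) + Q_4 W Q_4] *)
Definition L t := F 1 t \/ exists x y, [/\ wlt 3 x, wlt 3 y & t = x ++ W ++ y].

Lemma L_ctx u v t : wlt 3 u -> wlt 3 v -> L t -> L (u ++ t ++ v).
Proof.
move=> u3 v3 [tF|[x [y [x3 y3 ->]]]]; first by left; count.
by right; exists (u ++ x), (y ++ v); rewrite !wlt_cat u3 v3 x3 y3 !catA.
Qed.

Lemma wlt_relabel w : wlt 2 w -> wlt 3 (relabel succn w).
Proof. by rewrite /wlt all_map => w2; apply: sub_all w2 => -[i e]. Qed.

Lemma nfM_L t : nfM t -> L (relabel succn t).
Proof.
case/andP=> _ /orP [t1|/midP [u [v [u2 v2 ->]]]].
  by left; move: t1; rewrite /F /cnt /relabel count_map.
right; exists (relabel succn u), (relabel succn v).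
by rewrite !wlt_relabel // /relabel !map_cat.
Qed.

Lemma inspan_succ (T : word -> Prop) w : inspan 3 T w ->
  inspan 4 (fun x => exists2 t, T t & x = relabel succn t) (relabel succn w).
Proof. exact: inspan_relabel. Qed.

(** It suffices to treat [Ee true] s_3^-1 s_4. There Y stands between two letters s_4; exchanged for
    s_3 s_2^2 s_3, it forms with them an element commuting with s_3. So s_3^-1 passes to the left
    and two letters s_4 meet. *)
Lemma W_q4_W q : wlt 3 q -> inspan 4 (F 3) (W ++ q ++ W).
Proof.
move=> q3; reshape ([::] ++ (W ++ q ++ [:: (3, true)]) ++ [:: (2, false); (3, true)]).
apply: inspan_ctx (W_q4_4 true q3) _ => t [tF|[x x2 ->]]; first by apply: inspan_in; count.
reshape (x ++ (Ee true ++ [:: (2, false); (3, true)]) ++ [::]).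
apply: (@inspan_F 3); last by count.
apply: (inspan_bind (T := Td)); last exact: TdP.
apply: (@residueP _ _ [:: (1, [:: r_pre [:: (2, false)] ([:: (3, true);
  (1, true)], [:: [:: (1, true); (3, true)]])]);
 (1, sufs 2 (r_comm 3 0)); (1, [:: r_pre [:: (3, true)] (r_Yom true)]); (1, r_dp_comm); (9, r_sq 4);
 (9, r_braid 3 2 ++ sufs 3 (r_comm 3 1) ++ r_sq 4);
 (9, pres 2 (r_comm 1 3) ++ r_braid 3 2); (1, pres 0 (sufs 2 (r_comm 3 1))); (9, r_braid 3 2)]);
   last by vm_compute.
by rules; apply: valid_pre; apply: ax_valid; apply: ax_comm.
Qed.

Definition dp e := relabel succn (om e).
Lemma V_dp e : inspan 4 (fun t => L t \/ t = dp e) (V e).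
Proof.
rewrite -[V e]/([:: (3, e)] ++ Y ++ [:: (3, e)]).
apply: (inspan_ctx (T := fun t => t \in (r_Yom e).2)); first exact: valid_Yom.
move=> t; rewrite inE => /orP [/eqP ->|tu]; first by apply: inspan_in; right; case: (e).
have [s su ->] : exists2 s, s \in uuu 0 1 & t = relabel succn s by apply/mapP; move: t tu;
  apply/allP; vm_compute.
have := inspan_succ (u3_uuu_u3 e e su); rewrite /relabel /= map_cat => H.
by apply: inspan_bind H _ => _ [r /nfM_L rL ->]; apply: inspan_in; left.
Qed.

(** After the reduction of W q s_4^e, the final s_4^e Y s_4^e is exchanged for [dp e] modulo [L].
    This commutes with s_2 and s_3, passes the preceding Y, and its first s_4^e merges with the last
    letter of W. *)
Lemma W_q4_V q e : wlt 3 q -> inspan 4 (F 3) (W ++ q ++ V e).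
Proof.
move=> q3; reshape ([::] ++ (W ++ q ++ [:: (3, e)]) ++ Y ++ [:: (3, e)]).
apply: inspan_ctx (W_q4_4 e q3) _ => t [tF|[x x2 ->]]; first by apply: inspan_in; count.
reshape ((x ++ W ++ [:: (1, true); (0, false)] ++ Y) ++ V e ++ [::]).
apply: inspan_ctx (V_dp e) _ => s [[sF|[u [v [u3 v3 ->]]]]|->]; rewrite ?cats0;
  first by apply: inspan_in; count.
  reshape (x ++ (W ++ ([:: (1, true); (0, false)] ++ Y ++ u) ++ W) ++ v).
  by apply: inspan_F (W_q4_W _) _; rewrite ?wlt_cat ?u3 //; count.
reshape (x ++ (W ++ [:: (1, true); (0, false)] ++ Y ++ dp e) ++ [::]).
apply: (@inspan_F 3); last by count.
have v3 : valids 3 (map r_rev (r_om_comm 0 ++ r_om_comm 1)) by rules.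
have v4 : valids 4 (map (rmap succn) (map r_rev (r_om_comm 0 ++ r_om_comm 1))).
  by move=> _ /mapP [r /v3 vr ->]; exact: valid_succ.
have v3' : valids 3 (r_om_comm 0 ++ r_om_comm 1) by rules.
have v4' : valids 4 (map (rmap succn) (r_om_comm 0 ++ r_om_comm 1)).
  by move=> _ /mapP [r /v3' vr ->]; exact: valid_succ.
apply: (@residueP _ _ [:: (3, map (rmap succn) (r_om_comm 0 ++ r_om_comm 1));
  (2, sufs 0 (r_comm 3 1) ++ sufs 3 (r_comm 3 0)); (9, r_sq 4 ++ r_cancel 4)]).
  by rules.
by case: e; vm_compute.
Qed.

Lemma q3_L_q3 x y t : wlt 2 x -> wlt 2 y -> L t -> L (x ++ t ++ y).
Proof. by move=> x2 y2; apply: L_ctx; apply: wlt2_3. Qed.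

Lemma Y_cross e : inspan 4 L ((3, e) :: Y ++ [:: (3, ~~ e)]).
Proof. by apply: inspan_bind (inspan_succ (u3_X_u3 e)) _ => _ [s /nfM_L sL ->]; apply: inspan_in.
  Qed.

Lemma u434 e f g : inspan 4 L [:: (3, e); (2, f); (3, g)].
Proof.
have H : inspan 3 nfM ((2, e) :: [:: (1, f)] ++ [:: (2, g)]) by apply: u3_uuu_u3; case: f.
by apply: inspan_bind (inspan_succ H) _ => _ [s /nfM_L sL ->]; apply: inspan_in.
Qed.

Lemma q3u3q3_L e x f y g : wlt 2 x -> wlt 2 y -> inspan 4 L ((3, e) :: x ++ (2, f) :: y ++
  [:: (3, g)]).
Proof.
move=> x2 y2; apply: (@comm4 _ [::]) => //.
reshape ((x ++ [:: (3, e); (2, f)]) ++ y ++ (3, g) :: [::]); apply: comm4i => //.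
reshape (x ++ [:: (3, e); (2, f); (3, g)] ++ y).
by apply: inspan_ctx (u434 e f g) _ => t tL; apply: inspan_in; apply: q3_L_q3.
Qed.

Lemma q3Yq3_slide e x y f (T : word -> Prop) : wlt 2 x -> wlt 2 y ->
  inspan 4 T (x ++ (3, e) :: Y ++ (3, f) :: y) -> inspan 4 T ((3, e) :: x ++ Y ++ y ++ [:: (3, f)]).
Proof.
move=> x2 y2 H; apply: (@comm4 _ [::]) => //.
by reshape ((x ++ (3, e) :: Y) ++ y ++ (3, f) :: [::]); apply: comm4i => //;
  reshape (x ++ (3, e) :: Y ++ (3, f) :: y).
Qed.

(** Let W have the sign opposite to e. Its letters s_4^-e then enclose the two Y with the outer
    letters: s_4^e Y s_4^-e lies in the span of [L], and s_4^-e Y s_4^f is a V or lies there too.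
    New factors W lead to [W_q4_V] and [W_q4_W]. *)
Lemma WqW_YY e f y z : wlt 2 y -> wlt 2 z ->
  inspan 4 (F 3) ((3, e) :: Y ++ y ++ W ++ z ++ Y ++ [:: (3, f)]).
Proof.
move=> y2 z2; have H : inspan 4 (fun t => t \in X 2 3 (~~ e) :: uuu 2 3) W.
  case: e; last by apply: inspan_in.
  exact: (valid_mixed (n := 4) (i := 2) (j := 3) true isT isT isT).
reshape (((3, e) :: Y ++ y) ++ W ++ (z ++ Y ++ [:: (3, f)])).
apply: inspan_ctx H _ => t; rewrite in_cons => /orP [/eqP ->|tu]; last first.
  have t1 : cnt 3 t <= 1 by move: t tu; apply/allP; vm_compute.
  by apply: inspan_in; count.
reshape (((3, e) :: Y) ++ y ++ (3, ~~ e) :: [:: (2, ~~ ~~ e)] ++ (3, ~~ e) :: z ++ Y ++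
  [:: (3, f)]).
apply: comm4i => //.
reshape (((3, e) :: Y ++ (3, ~~ e) :: y ++ [:: (2, ~~ ~~ e)]) ++ (3, ~~ e) :: z ++ Y ++
  [:: (3, f)]).
apply: comm4 => //.
reshape ([::] ++ ((3, e) :: Y ++ [:: (3, ~~ e)]) ++ (y ++ (2, ~~ ~~ e) :: z ++ (3, ~~ e) :: Y ++
  [:: (3, f)])).
apply: inspan_ctx (Y_cross e) _ => s [sF|[u [v [u3 v3 ->]]]]; first by apply: inspan_in; count.
have q3 : wlt 3 (v ++ y ++ (2, ~~ ~~ e) :: z) by rewrite !wlt_cat v3 (wlt2_3 y2) /=; exact: wlt2_3.
have [->|ef] := eqVneq f (~~ e).
  reshape (u ++ (W ++ (v ++ y ++ (2, ~~ ~~ e) :: z) ++ V (~~ e)) ++ [::]).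
  by apply: inspan_F (W_q4_V _ q3) _; count.
have -> : f = ~~ ~~ e by case: (e) (f) ef => -[].
reshape ((u ++ W ++ (v ++ y ++ (2, ~~ ~~ e) :: z)) ++ ((3, ~~ e) :: Y ++ [:: (3, ~~ ~~ e)]) ++
  [::]).
apply: inspan_ctx (Y_cross (~~ e)) _ => r [rF|[u' [v' [u'3 v'3 ->]]]]; rewrite ?cats0;
  first by apply: inspan_in; count.
reshape (u ++ (W ++ ((v ++ y ++ (2, ~~ ~~ e) :: z) ++ u') ++ W) ++ v').
by apply: inspan_F (W_q4_W _) _; [rewrite wlt_cat q3|count].
Qed.

Lemma rev_W : rev W = W. Proof. by []. Qed.

Lemma rev_V e : rev (V e) = V e. Proof. by []. Qed.

Lemma q4_4_W e q : wlt 3 q -> inspan 4 (fun t => F 2 t \/ exists2 x, wlt 2 x & t = rev (Ee e) ++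
  x) ((3, e) :: q ++ W).
Proof.
move=> q3; have /(W_q4_4 e)/inspan_rev H : wlt 3 (rev q) by rewrite wlt_rev.
have -> : (3, e) :: q ++ W = rev (W ++ rev q ++ [:: (3, e)]) by rewrite !rev_cat revK -catA.
apply: inspan_bind H _ => t [tF|[x x2 tE]]; apply: inspan_in; first by left; move: tF;
  rewrite /F cnt_rev.
by right; exists (rev x); rewrite ?wlt_rev // -[t]revK tE rev_cat.
Qed.

(** Reducing on the right of W and then on its left leaves [Ee f] and the reverse of [Ee e] sharing
    one W, as in [WqW_YY]. *)
Lemma four_W_four e q q' f : wlt 3 q -> wlt 3 q' -> inspan 4 (F 3) ((3, e) :: q ++ W ++ q' ++
  [:: (3, f)]).
Proof.
move=> q3 q'3; reshape (((3, e) :: q) ++ (W ++ q' ++ [:: (3, f)]) ++ [::]).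
apply: inspan_ctx (W_q4_4 f q'3) _ => t [tF|[x x2 ->]]; first by apply: inspan_in; count.
reshape ([::] ++ ((3, e) :: (q ++ x) ++ W) ++ [:: (1, true); (0, false)] ++ Y ++ [:: (3, f)]).
have qx : wlt 3 (q ++ x) by rewrite wlt_cat q3 wlt2_3.
apply: inspan_ctx (q4_4_W e qx) _ => s [sF|[y y2 ->]]; first by apply: inspan_in; count.
reshape ((3, e) :: Y ++ [:: (0, false); (1, true)] ++ W ++ (y ++ [:: (1, true);
  (0, false)]) ++ Y ++ [:: (3, f)]).
by apply: WqW_YY; rewrite ?wlt_cat ?y2.
Qed.

(** In [Ee e], let W have the sign opposite to e. Its last letter forms s_4^-e Y s_4^e, whose
    reduction puts a W between two letters s_4. *)
Lemma W_four_four q e q' f : wlt 3 q -> wlt 3 q' -> inspan 4 (F 3) (W ++ q ++ (3, e) :: q' ++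
  [:: (3, f)]).
Proof.
move=> q3 q'3; reshape ([::] ++ (W ++ q ++ [:: (3, e)]) ++ q' ++ [:: (3, f)]).
apply: inspan_ctx (W_q4_4 e q3) _ => t [tF|[x x2 ->]]; first by apply: inspan_in; count.
have H : inspan 4 (fun t => t \in X 2 3 (~~ e) :: uuu 2 3) W.
  case: (e); last by apply: inspan_in.
  exact: (valid_mixed (n := 4) (i := 2) (j := 3) true isT isT isT).
reshape (x ++ W ++ [:: (1, true); (0, false)] ++ Y ++ (3, e) :: q' ++ [:: (3, f)]).
apply: inspan_ctx H _ => s; rewrite in_cons => /orP [/eqP ->|su]; last first.
  have s1 : cnt 3 s <= 1 by move: s su; apply/allP; vm_compute.
  by apply: inspan_in; count.
reshape ((x ++ [:: (3, ~~ e); (2, ~~ ~~ e)]) ++ (3, ~~ e) :: [:: (1, true);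
  (0, false)] ++ Y ++ (3, e) :: q' ++ [:: (3, f)]).
apply: comm4 => //.
reshape ((x ++ [:: (3, ~~ e); (2, ~~ ~~ e); (1, true);
  (0, false)]) ++ ((3, ~~ e) :: Y ++ [:: (3, e)]) ++ q' ++ [:: (3, f)]).
have Yc := Y_cross (~~ e); rewrite negbK in Yc; apply: inspan_ctx Yc _ =>
  r [rF|[u [v [u3 v3 ->]]]]; first by apply: inspan_in; count.
reshape (x ++ ((3, ~~ e) :: ([:: (2, ~~ ~~ e); (1, true);
  (0, false)] ++ u) ++ W ++ (v ++ q') ++ [:: (3, f)]) ++ [::]).
by apply: inspan_F (four_W_four _ _ _ _) _; rewrite ?wlt_cat ?v3 //; count.
Qed.

Lemma four_four_W e q f q' : wlt 3 q -> wlt 3 q' -> inspan 4 (F 3) ((3, e) :: q ++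
  (3, f) :: q' ++ W).
Proof.
move=> q3 q'3; apply: F_rev; rewrite rev_cons rev_cat rev_cons rev_cat rev_W -!cats1 -!catA.
by apply: W_four_four; rewrite wlt_rev.
Qed.

(* [V e] absorbs [<s_2, s_3>] on both sides modulo [L], being the analogue of
   [Z e] for the generators [s_2, s_3, s_4]. *)
Definition wlt13 (w : word) := all (fun l => 0 < l.1 < 3) w.
Lemma V_right e y : wlt13 y -> inspan 4 (fun t => L t \/ t = V e) (V e ++ y).
Proof.
move=> y13; have yE : y = relabel succn (relabel predn y).
  by rewrite /relabel -map_comp map_id_in // => -[i f] /(allP y13) /=; case: i.
have /(q3_Zr e)/inspan_succ : wlt 2 (relabel predn y).
  by rewrite /wlt all_map; apply: sub_all y13 => -[i f] /=; lia.
rewrite {2}yE /relabel map_cat => H; apply: inspan_bind H _ => _ [t tZ ->]; apply: inspan_in.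
by case/orP: tZ => [/nfM_L|/eqP ->]; [left|right; case: (e)].
Qed.

Lemma L_rev t : L t -> L (rev t).
Proof.
case=> [tF|[x [y [x3 y3 ->]]]]; first by left; count.
by right; exists (rev y), (rev x); rewrite !wlt_rev !rev_cat rev_W -catA.
Qed.

Lemma V_left e y : wlt13 y -> inspan 4 (fun t => L t \/ t = V e) (y ++ V e).
Proof.
move=> y13; have /(V_right e)/inspan_rev H : wlt13 (rev y) by rewrite /wlt13 all_rev.
rewrite rev_cat revK rev_V in H; apply: inspan_bind H _ => t tL; apply: inspan_in.
case: tL => [/L_rev|/(congr1 rev)]; rewrite revK; first by left.
by rewrite rev_V; right.
Qed.

(** The normal form of q is taken with s_1 and s_3 exchanged, because V absorbs s_2 and s_3. There
    remain V m V with m in the algebra of s_1 and s_2, where two letters s_4 merge, and with m =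
    s_1^h s_2 s_3^-1 s_2 s_1^h, where the single s_3 makes s_4^e m s_4^f a combination of words of
    [L]. *)
Lemma V_q4_V e q f : wlt 3 q -> inspan 4 (F 3) (V e ++ q ++ V f).
Proof.
move=> q3; pose g i := 2 - i.
have gK x : wlt 3 x -> relabel g (relabel g x) = x.
  by move=> x3; rewrite /relabel -map_comp map_id_in // => -[i h] /(allP x3) /= i3; congr pair;
    rewrite /g; lia.
have /nf3P nq : wlt 3 (relabel g q) by rewrite /wlt all_map; apply: sub_all q3 => -[i h] /=;
  rewrite /g; lia.
have H : inspan 4 (fun x => exists2 t, nf3 t & x = relabel g t) q.
  rewrite -[q]gK //; apply: (@inspan_relabel 3 4 g _ _ _ _ _ nq) => [i i3|i j i3 j3|i j i3 j3];
    rewrite /g /adj /far; lia.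
have LV t u : wlt 3 u -> L t -> inspan 4 (F 3) (t ++ u ++ V f).
  move=> u3 [tF|[x [y [x3 y3 ->]]]]; first by apply: inspan_in; count.
  reshape (x ++ (W ++ (y ++ u) ++ V f) ++ [::]).
  by apply: inspan_F (W_q4_V _ _) _; rewrite ?wlt_cat ?y3 //; count.
have VL t u : wlt 3 u -> L t -> inspan 4 (F 3) (V e ++ u ++ t).
  move=> u3 [tF|[x [y [x3 y3 ->]]]]; first by apply: inspan_in; count.
  apply: F_rev; rewrite !rev_cat rev_V rev_W.
  reshape (rev y ++ (W ++ (rev x ++ rev u) ++ V e) ++ [::]).
  by apply: inspan_F (W_q4_V _ _) _; rewrite ?wlt_cat ?wlt_rev ?x3 //; count.
have g13 u : wlt 2 u -> wlt13 (relabel g u).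
  by rewrite /wlt13 all_map => u2; apply: sub_all u2 => -[i h] /=; rewrite /g; lia.
have l13 u : wlt13 u -> wlt 3 u by apply: sub_all => -[i h] /=; lia.
have core u m v : wlt13 u -> wlt13 v -> wlt 3 m -> inspan 4 (F 3) (V e ++ m ++ V f) ->
  inspan 4 (F 3) (V e ++ (u ++ m ++ v) ++ V f).
  move=> u13 v13 m3 mF; reshape ([::] ++ (V e ++ u) ++ m ++ v ++ V f).
  apply: inspan_ctx (V_right e u13) _ => t [tL|->].
    by reshape (t ++ (m ++ v) ++ V f); apply: LV => //; rewrite wlt_cat m3 l13.
  reshape ((V e ++ m) ++ (v ++ V f) ++ [::]).
  by apply: inspan_ctx (V_left f v13) _ => s [sL|->]; rewrite cats0 -catA //; apply: VL.
have slide u : wlt 2 u -> inspan 4 (F 3) (V e ++ u ++ V f).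
  by move=> u2; apply: (@merge4 3 ((3, e) :: Y) e u f (Y ++ [:: (3, f)])).
have Zc h : inspan 4 (F 3) (V e ++ relabel g (Z h) ++ V f).
  reshape (((3, e) :: Y) ++ ((3, e) :: [:: (0, h); (1, true)] ++ (2, false) :: [:: (1, true);
    (0, h)] ++ [:: (3, f)]) ++ (Y ++ [:: (3, f)])).
  apply: inspan_ctx (q3u3q3_L _ _ _ _ _) _ => // t [tF|[x [y [x3 y3 ->]]]];
    first by apply: inspan_in; count.
  reshape ((3, e) :: (Y ++ x) ++ W ++ (y ++ Y) ++ [:: (3, f)]).
  by apply: four_W_four; rewrite wlt_cat ?x3 ?y3.
apply: inspan_ctx H _ => {q q3 nq} _ [t tn ->].
have gcat a b : relabel g (a ++ b) = relabel g a ++ relabel g b by exact: map_cat.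
case/or3P: tn => [/andP [t3 /orP [|/midP [u [v [u2 v2 ->]]]]]|/eqP ->|/eqP ->].
- rewrite leq_eqVlt ltnS leqn0 => /orP [/eqP t1|/eqP t0].
    have [x [h [y [-> x2 y3 y0]]]] := cnt_split t3 t1.
    rewrite gcat -cat1s gcat; apply: core; rewrite ?g13 //; first exact: cnt_wlt.
    exact: slide.
  have := core (relabel g t) [::] [::]; rewrite !cats0; apply=> //; first by apply: g13;
    exact: cnt_wlt.
  exact: (slide [::]).
- by rewrite !gcat; apply: core; rewrite ?g13 //; exact: (slide (X 1 0 true)).
- exact: (Zc true).
- exact: (Zc false).
Qed.

(** * Products of three factors u_4 that contain V *)

Definition Y' : word := X 1 0 true.
Definition Th e : word := V e ++ Y' ++ Y ++ [:: (3, e)].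
(* [V_i Q_4 s_4^j] reduces to these words; the only genuinely new one is [Th]. *)
Definition V0 i t := [\/ F 2 t,
  exists p q j s, [/\ wlt 3 p, wlt 3 q, wlt 3 s & t = p ++ W ++ q ++ (3, j) :: s],
  exists p q j s, [/\ wlt 3 p, wlt 3 q, wlt 3 s & t = p ++ (3, j) :: q ++ W ++ s] |
  exists p s, [/\ wlt 3 p, wlt 3 s & t = p ++ Th i ++ s]].

Lemma V0_right i t y : wlt 3 y -> V0 i t -> V0 i (t ++ y).
Proof.
move=> y3 [tF|[p [q [j [s [p3 q3 s3 ->]]]]]|[p [q [j [s [p3 q3 s3 ->]]]]]|[p [s [p3 s3 ->]]]].
- by apply: Or41; count.
- by apply: Or42; exists p, q, j, (s ++ y); split; rewrite ?wlt_cat ?s3 // -!catA.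
- by apply: Or43; exists p, q, j, (s ++ y); split; rewrite ?wlt_cat ?s3 // -!catA /= -!catA.
- by apply: Or44; exists p, (s ++ y); split; rewrite ?wlt_cat ?s3 // -!catA.
Qed.

Lemma L_q4_4 i t q j : wlt 3 q -> L t -> V0 i (t ++ q ++ [:: (3, j)]).
Proof.
move=> q3 [tF|[x [y [x3 y3 ->]]]]; first by apply: Or41; count.
by apply: Or42; exists x, (y ++ q), j, [::]; rewrite wlt_cat y3 q3 x3 -!catA.
Qed.

Lemma V_absorb i y q j : wlt13 y -> wlt 3 q ->
  inspan 4 (V0 i) (V i ++ q ++ [:: (3, j)]) -> inspan 4 (V0 i) (V i ++ (y ++ q) ++ [:: (3, j)]).
Proof.
move=> y13 q3 Vq; reshape ([::] ++ (V i ++ y) ++ q ++ [:: (3, j)]).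
apply: inspan_ctx (V_right i y13) _ => t [tL|-> //].
by apply: inspan_in; apply: L_q4_4.
Qed.

Lemma V_q3_4 i x j : wlt 2 x -> inspan 4 (V0 i) (V i ++ x ++ [:: (3, j)]).
Proof.
move=> x2; apply: inspan_F_sub (@merge4 2 ((3, i) :: Y) i x j [::] x2 _) _; first by [].
by move=> t; apply: Or41.
Qed.

Lemma V_q3u3q3_4 i x f y j : wlt 2 x -> wlt 2 y -> inspan 4 (V0 i) (V i ++ (x ++ (2, f) :: y) ++
  [:: (3, j)]).
Proof.
move=> x2 y2; reshape (((3, i) :: Y) ++ ((3, i) :: x ++ (2, f) :: y ++ [:: (3, j)]) ++ [::]).
apply: inspan_ctx (q3u3q3_L _ _ _ _ _) _ => // t [tF|[p [s [p3 s3 ->]]]]; rewrite cats0;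
  apply: inspan_in; first by apply: Or41; count.
by apply: Or43; exists [::], (Y ++ p), i, s; rewrite wlt_cat p3 s3 -!catA.
Qed.

Lemma V_nf1_4 i q j : wlt 3 q -> cnt 2 q <= 1 -> inspan 4 (V0 i) (V i ++ q ++ [:: (3, j)]).
Proof.
move=> q3; rewrite leq_eqVlt ltnS leqn0 => /orP [/eqP q1|/eqP q0]; last by apply: V_q3_4;
  exact: cnt_wlt.
have [x [f [y [-> x2 y3 y0]]]] := cnt_split q3 q1.
by apply: V_q3u3q3_4; rewrite ?(cnt_wlt y3).
Qed.

(** V absorbs a first s_2 and Y a last one. In s_1^h Y = s_3 s_1^h s_2^-1 s_3 the first s_3 is
    absorbed by V as well. *)
Lemma V_uuu_Y_4 i t j : t \in uuu 1 0 -> inspan 4 (V0 i) (V i ++ (t ++ Y) ++ [:: (3, j)]).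
Proof.
move=> tu; pose b13 (l : letter) := 0 < l.1 < 3.
have H : inspan 3 (fun w => wlt 3 w && (cnt 2 (dropw b13 w) <= 1)) (t ++ Y).
  apply: (@solvesP 3 _ [:: (9, r_y); (9, r_comm 0 2)] (sandw (uuu 1 0) [:: Y] [:: [::]]));
    [by rules|by vm_compute|].
  by apply: (@sandwP _ _ _ t Y [::]).
apply: inspan_ctx (inspan_mono (isT : 3 <= 4) H) _ => w /andP [w3 w1].
have [y yb wE] := dropwP b13 w; rewrite wE.
have d3 : wlt 3 (dropw b13 w) by move: w3; rewrite {1}wE wlt_cat => /andP [].
by apply: V_absorb => //; exact: V_nf1_4.
Qed.

Lemma Y_pair e f : e != f -> inspan 4 L ((3, e) :: Y ++ [:: (3, f)]).
Proof. by move=> ef; have -> : f = ~~ e by [case: e f ef => -[]]; exact: Y_cross. Qed.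

Lemma V_q4_4 i q j : wlt 3 q -> inspan 4 (V0 i) (V i ++ q ++ [:: (3, j)]).
Proof.
move=> q3; apply: inspan_ctx (inspan_mono (isT : 3 <= 4) (nf3P q3)) _ => {q q3} t.
have VZ f : inspan 4 (V0 i) (V i ++ Z f ++ [:: (3, j)]).
  by apply: (@V_absorb i [:: (2, f)] (X 0 1 true ++ [:: (2, f)])) => //; exact: V_nf1_4.
case/or3P=> [/andP [t3 /orP [|/midP [u [v [u2 v2 ->]]]]]|/eqP ->|/eqP ->] //; first exact: V_nf1_4.
reshape ((V i ++ u ++ Y) ++ v ++ (3, j) :: [::]); apply: comm4i => //.
reshape ([::] ++ (V i ++ u ++ Y ++ [:: (3, j)]) ++ v).
apply: (inspan_ctx (T := V0 i)); last first.
  by move=> s sV; rewrite cat0s; apply: inspan_in; apply: (V0_right (wlt2_3 v2) sV).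
have [ij|ij] := eqVneq i j; last first.
  reshape (((3, i) :: Y) ++ (3, i) :: u ++ Y ++ [:: (3, j)]); apply: comm4 => //.
  reshape (((3, i) :: Y ++ u) ++ ((3, i) :: Y ++ [:: (3, j)]) ++ [::]).
  apply: inspan_ctx (Y_pair ij) _ => s [sF|[p [r [p3 r3 ->]]]]; rewrite cats0; apply: inspan_in;
    first by apply: Or41; count.
  by apply: Or43; exists [::], (Y ++ u ++ p), i, r; rewrite !wlt_cat (wlt2_3 u2) p3 r3 -!catA.
rewrite -ij; apply: inspan_ctx (nf2 (p := 1) (q := 0) _ _ _ _) _ => //.
  by apply: sub_all u2 => -[[|[|]] g].
move=> s; rewrite in_cons => /orP [/eqP ->|su].
  by apply: inspan_in; apply: Or44; exists [::], [::]; rewrite cats0.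
by reshape (V i ++ (s ++ Y) ++ [:: (3, i)]); exact: V_uuu_Y_4.
Qed.

Lemma Th_nf1_4 i q j : wlt 3 q -> cnt 2 q <= 1 -> inspan 4 (F 3) (Th i ++ q ++ [:: (3, j)]).
Proof.
move=> q3; rewrite leq_eqVlt ltnS leqn0 => /orP [/eqP q1|/eqP q0]; last first.
  by apply: (@merge4 3 (V i ++ Y' ++ Y) i q j [::]) => //; exact: cnt_wlt.
have [x [f [y [-> x2 y3 y0]]]] := cnt_split q3 q1.
reshape ((V i ++ Y' ++ Y) ++ ((3, i) :: x ++ (2, f) :: y ++ [:: (3, j)]) ++ [::]).
apply: inspan_ctx (q3u3q3_L _ _ _ _ _) _ => //; first exact: (cnt_wlt y3).
move=> t [tF|[p [s [p3 s3 ->]]]]; first by apply: inspan_in; count.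
reshape ([::] ++ ((3, i) :: Y ++ (3, i) :: (Y' ++ Y ++ p) ++ W) ++ s).
by apply: inspan_F (four_four_W _ _ _ _) _; rewrite ?wlt_cat ?p3 //; count.
Qed.

(** As [Y'] commutes with s_4, [Th i] is also s_4^i Y [Y'] V i, and this V absorbs the first letter
    of Z. If q contains Y, the last s_4^i of [Th i] moves up to that Y instead, and s_4^i Y s_4^j is
    a V or lies in the span of [L]. *)
Lemma Th_q4_4 i q j : wlt 3 q -> inspan 4 (F 3) (Th i ++ q ++ [:: (3, j)]).
Proof.
move=> q3; apply: inspan_ctx (inspan_mono (isT : 3 <= 4) (nf3P q3)) _ => {q q3} t.
have TZ f : inspan 4 (F 3) (Th i ++ Z f ++ [:: (3, j)]).
  reshape (((3, i) :: Y) ++ (3, i) :: Y' ++ (Y ++ [:: (3, i)] ++ Z f ++ [:: (3, j)])).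
  apply: comm4 => //.
  reshape (((3, i) :: Y ++ Y') ++ (V i ++ [:: (2, f)]) ++ X 0 1 true ++ [:: (2, f); (3, j)]).
  apply: inspan_ctx (V_right i (isT : wlt13 [:: (2, f)])) _ => s [[sF|[p [r [p3 r3 ->]]]]|->];
    first by apply: inspan_in; count.
    reshape ((3, i) :: (Y ++ Y' ++ p) ++ W ++ (r ++ X 0 1 true ++ [:: (2, f)]) ++ [:: (3, j)]).
    by apply: four_W_four; rewrite !wlt_cat ?p3 ?r3.
  reshape (((3, i) :: Y) ++ Y' ++ (3, i) :: (Y ++ (3, i) :: X 0 1 true ++ [:: (2, f); (3, j)])).
  apply: comm4i => //.
  by reshape (Th i ++ (X 0 1 true ++ [:: (2, f)]) ++ [:: (3, j)]); exact: Th_nf1_4.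
case/or3P=> [/andP [t3 /orP [|/midP [u [v [u2 v2 ->]]]]]|/eqP ->|/eqP ->] //; first exact: Th_nf1_4.
reshape ((Th i ++ u ++ Y) ++ v ++ (3, j) :: [::]); apply: comm4i => //.
reshape ((V i ++ Y' ++ Y) ++ (3, i) :: u ++ (Y ++ (3, j) :: v)); apply: comm4 => //.
have [<-|ij] := eqVneq i j.
  reshape ([::] ++ (V i ++ (Y' ++ Y ++ u) ++ V i) ++ v).
  by apply: inspan_F (V_q4_V _ _ _) _; rewrite ?wlt_cat ?(wlt2_3 u2) //; count.
reshape ((V i ++ Y' ++ Y ++ u) ++ ((3, i) :: Y ++ [:: (3, j)]) ++ v).
apply: inspan_ctx (Y_pair ij) _ => s [sF|[p [r [p3 r3 ->]]]]; first by apply: inspan_in; count.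
reshape ([::] ++ ((3, i) :: Y ++ (3, i) :: (Y' ++ Y ++ u ++ p) ++ W) ++ r ++ v).
by apply: inspan_F (four_four_W _ _ _ _) _; rewrite ?wlt_cat ?p3 ?(wlt2_3 u2) //; count.
Qed.

Lemma four_q4_Th j q i : wlt 3 q -> inspan 4 (F 3) ((3, j) :: q ++ Th i).
Proof.
move=> q3; apply: F_rev.
have -> : rev ((3, j) :: q ++ Th i) = ((3, i) :: Y) ++ Y' ++ (3, i) :: (Y ++ (3, i) :: rev q ++
  [:: (3, j)]).
  by rewrite rev_cons rev_cat -cats1 -catA.
by apply: comm4i => //; reshape (Th i ++ rev q ++ [:: (3, j)]); apply: Th_q4_4; rewrite wlt_rev.
Qed.

Lemma V_four_four i q j q' k : wlt 3 q -> wlt 3 q' ->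
  inspan 4 (F 3) (V i ++ q ++ (3, j) :: q' ++ [:: (3, k)]).
Proof.
move=> q3 q'3; reshape ([::] ++ (V i ++ q ++ [:: (3, j)]) ++ q' ++ [:: (3, k)]).
apply: inspan_ctx (V_q4_4 i j q3) _ => t; case=> [tF|[p [r [l [s [p3 r3 s3 ->]]]]]|[p [r [l [s
  [p3 r3 s3 ->]]]]]|[p [s [p3 s3 ->]]]].
- by apply: inspan_in; count.
- reshape (p ++ (W ++ r ++ (3, l) :: (s ++ q') ++ [:: (3, k)]) ++ [::]).
  by apply: inspan_F (W_four_four _ _ _ _) _; rewrite ?wlt_cat ?s3 //; count.
- reshape (p ++ ((3, l) :: r ++ W ++ (s ++ q') ++ [:: (3, k)]) ++ [::]).
  by apply: inspan_F (four_W_four _ _ _ _) _; rewrite ?wlt_cat ?s3 //; count.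
- reshape (p ++ (Th i ++ (s ++ q') ++ [:: (3, k)]) ++ [::]).
  by apply: inspan_F (Th_q4_4 _ _ _) _; rewrite ?wlt_cat ?s3 //; count.
Qed.

Lemma four_V_four k q' i q j : wlt 3 q -> wlt 3 q' ->
  inspan 4 (F 3) ((3, k) :: q' ++ V i ++ q ++ [:: (3, j)]).
Proof.
move=> q3 q'3; reshape (((3, k) :: q') ++ (V i ++ q ++ [:: (3, j)]) ++ [::]).
apply: inspan_ctx (V_q4_4 i j q3) _ => t; case=> [tF|[p [r [l [s [p3 r3 s3 ->]]]]]|[p [r [l [s
  [p3 r3 s3 ->]]]]]|[p [s [p3 s3 ->]]]].
- by apply: inspan_in; count.
- reshape ([::] ++ ((3, k) :: (q' ++ p) ++ W ++ r ++ [:: (3, l)]) ++ s).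
  by apply: inspan_F (four_W_four _ _ _ _) _; rewrite ?wlt_cat ?p3 ?q'3 //; count.
- reshape ([::] ++ ((3, k) :: (q' ++ p) ++ (3, l) :: r ++ W) ++ s).
  by apply: inspan_F (four_four_W _ _ _ _) _; rewrite ?wlt_cat ?p3 ?q'3 //; count.
- reshape ([::] ++ ((3, k) :: (q' ++ p) ++ Th i) ++ s).
  by apply: inspan_F (four_q4_Th _ _ _) _; rewrite ?wlt_cat ?p3 ?q'3 //; count.
Qed.

Lemma four_four_V j q k q' i : wlt 3 q -> wlt 3 q' ->
  inspan 4 (F 3) ((3, j) :: q ++ (3, k) :: q' ++ V i).
Proof.
move=> q3 q'3; apply: F_rev; rewrite rev_cons rev_cat rev_cons rev_cat rev_V -!cats1 -!catA.
by apply: V_four_four; rewrite wlt_rev.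
Qed.

(* [L + Q_4 V+ Q_4 + Q_4 V- Q_4], which contains [s_4^e Q_4 s_4^-e]. *)
Definition L' t := L t \/ exists x y i, [/\ wlt 3 x, wlt 3 y & t = x ++ V i ++ y].

Lemma L'_four_four t q j q' k : L' t -> wlt 3 q -> wlt 3 q' ->
  inspan 4 (F 3) (t ++ q ++ (3, j) :: q' ++ [:: (3, k)]).
Proof.
move=> tL q3 q'3; case: tL => [[tF|[x [y [x3 y3 ->]]]]|[x [y [i [x3 y3 ->]]]]];
  first by apply: inspan_in; count.
  reshape (x ++ (W ++ (y ++ q) ++ (3, j) :: q' ++ [:: (3, k)]) ++ [::]).
  by apply: inspan_F (W_four_four _ _ _ _) _; rewrite ?wlt_cat ?y3 //; count.
reshape (x ++ (V i ++ (y ++ q) ++ (3, j) :: q' ++ [:: (3, k)]) ++ [::]).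
by apply: inspan_F (V_four_four _ _ _ _ _) _; rewrite ?wlt_cat ?y3 //; count.
Qed.

Lemma four_four_L' j q k q' t : L' t -> wlt 3 q -> wlt 3 q' ->
  inspan 4 (F 3) ((3, j) :: q ++ (3, k) :: q' ++ t).
Proof.
move=> tL q3 q'3; case: tL => [[tF|[x [y [x3 y3 ->]]]]|[x [y [i [x3 y3 ->]]]]];
  first by apply: inspan_in; count.
  reshape ([::] ++ ((3, j) :: q ++ (3, k) :: (q' ++ x) ++ W) ++ y).
  by apply: inspan_F (four_four_W _ _ _ _) _; rewrite ?wlt_cat ?q'3 //; count.
reshape ([::] ++ ((3, j) :: q ++ (3, k) :: (q' ++ x) ++ V i) ++ y).
by apply: inspan_F (four_four_V _ _ _ _ _) _; rewrite ?wlt_cat ?q'3 //; count.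
Qed.

Lemma four_L'_four j q t q' k : L' t -> wlt 3 q -> wlt 3 q' ->
  inspan 4 (F 3) ((3, j) :: q ++ t ++ q' ++ [:: (3, k)]).
Proof.
move=> tL q3 q'3; case: tL => [[tF|[x [y [x3 y3 ->]]]]|[x [y [i [x3 y3 ->]]]]];
  first by apply: inspan_in; count.
  reshape ((3, j) :: (q ++ x) ++ W ++ (y ++ q') ++ [:: (3, k)]).
  by apply: four_W_four; rewrite wlt_cat ?q3 ?y3.
reshape ((3, j) :: (q ++ x) ++ V i ++ (y ++ q') ++ [:: (3, k)]).
by apply: four_V_four; rewrite wlt_cat ?q3 ?y3.
Qed.

(** * The factors s_4^e Q_4 s_4^f *)

Definition TL' w := wlt 4 w && [|| F 1 w, mid (wlt 3) W w, mid (wlt 3) (V true) w |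
  mid (wlt 3) (V false) w].

Definition r_conj32 : seq rule := map (rmap succn) conj21.
(** [drop 2] leaves out the two rules for three equal signs. *)
Definition r_bm i j := drop 2 (r_braid i j).
Lemma valid_bm n i j : i < n -> j < n -> adj i j -> valids n (r_bm i j).
Proof. by move=> im jn ij r /mem_drop; apply: valid_braid. Qed.

Lemma valid_conj32 : valids 4 r_conj32.
Proof. have v3 : valids 3 conj21 by rules. by move=> _ /mapP [r /v3 vr ->]; exact: valid_succ. Qed.
#[export] Hint Resolve valid_bm valid_conj32 : rules.

Definition om_cross_phases g := [:: (1, r_conj32); (9, r_comm 0 3 ++ r_comm 1 3);
  (1, r_braid 3 2); (1, conj21); (9, r_comm 0 2);
 (1, sufs 0 (r_braid 2 1)); (1, [:: ins [:: (0, g)] 1 (~~ g) [:: (0, g)]]); (2, r_bm 1 0);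
   (1, r_cancel 1); (9, r_comm 2 0);
 (1, sufs 0 (r_comm 3 1)); (1, sufs 2 (r_comm 3 0)); (1, sufs 1 (r_comm 0 2));
   (1, pres 0 (r_comm 1 3)); (1, pres 2 (r_comm 0 3));
 (1, r_sq 2); (1, r_braid 2 1 ++ r_mixed 1 2 false :: r_sq 3);
   (9, sufs 2 (r_comm 3 1) ++ pres 2 (r_comm 1 3) ++ r_braid 3 2 ++ r_mixed 2 3 false :: r_sq 4);
 (1, sufs 3 (r_comm 3 1)); (1, r_sq 4)].

Lemma TL'P w : TL' w -> L' w.
Proof.
case/andP=> w4 /or4P [w1|/midP [u [v [u3 v3 ->]]]|/midP [u [v [u3 v3 ->]]]|/midP [u [v [u3 v3
  ->]]]].
- by left; left.
- by left; right; exists u, v.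
- by right; exists u, v, true.
- by right; exists u, v, false.
Qed.

Lemma L'_rev t : L' t -> L' (rev t).
Proof.
case=> [/L_rev|[x [y [i [x3 y3 ->]]]]]; first by left.
by right; exists (rev y), (rev x), i; rewrite !wlt_rev !rev_cat rev_V -catA.
Qed.

(** The analogue of [u3_X_u3] one strand higher: s_1 s_2 s_3 s_4 s_i = s_(i+1) s_1 s_2 s_3 s_4 for i
    = 1, 2, 3 exhibits the word as a conjugate of [dp e] by s_1^e s_2^e s_3^e, and [dp e] is
    exchanged for V. *)
Lemma om_cross e : inspan 4 L' ((3, e) :: om e ++ [:: (3, ~~ e)]).
Proof.
apply: (inspan_bind (T := TL')); last by move=> t /TL'P; exact: inspan_in.
by apply: (@residueP _ _ (om_cross_phases e)); [rules|case: e; vm_compute].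
Qed.

Lemma nfM_pair e q f : nfM q -> inspan 4 L' ((3, e) :: q ++ [:: (3, f)]).
Proof.
case/andP=> q3 /orP [|/midP [x [y [x2 y2 ->]]]].
  rewrite leq_eqVlt ltnS leqn0 => /orP [/eqP q1|/eqP q0].
    have [x [g [y [-> x2 y3 y0]]]] := cnt_split q3 q1.
    rewrite -catA; apply: inspan_bind (q3u3q3_L e g f x2 (cnt_wlt y3 y0)) _ => t tL.
    by apply: inspan_in; left.
  apply: inspan_bind (@merge4 1 [::] e q f [::] (cnt_wlt q3 q0) isT) _ => t tF.
  by apply: inspan_in; left; left.
rewrite -!catA; apply: q3Yq3_slide => //.
reshape (x ++ ((3, e) :: Y ++ [:: (3, f)]) ++ y).
have [<-|ef] := eqVneq e f.
  by apply: inspan_in; right; exists x, y, e; rewrite !wlt2_3.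
by apply: inspan_ctx (Y_pair ef) _ => t tL; apply: inspan_in; left; apply: q3_L_q3.
Qed.

Lemma Z_om_pair e f g (T : word -> Prop) u v :
  (forall t, L' t -> inspan 4 T (u ++ t ++ v)) ->
  inspan 4 T (u ++ ((3, e) :: om g ++ [:: (3, f)]) ++ v) ->
    inspan 4 T (u ++ ((3, e) :: Z g ++ [:: (3, f)]) ++ v).
Proof.
move=> LT omT; reshape ((u ++ [:: (3, e)]) ++ Z g ++ (3, f) :: v).
apply: (inspan_ctx (T := fun t => t \in (r_Zom g).2)); first exact: valid_Zom.
move=> t; rewrite in_cons => /orP [/eqP ->|tr].
  by reshape (u ++ ((3, e) :: om g ++ [:: (3, f)]) ++ v).
have tM : nfM t by move: t tr; apply/allP; case: (g); vm_compute.
by reshape (u ++ ((3, e) :: t ++ [:: (3, f)]) ++ v); apply: inspan_ctx (nfM_pair e f tM) _ => s /LT.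
Qed.

(** [om_cross] requires Z to have the sign of the letter s_4 on its left. Z is a palindrome, so
    reversal settles the other sign. *)
Lemma q4_cross e q : wlt 3 q -> inspan 4 L' ((3, e) :: q ++ [:: (3, ~~ e)]).
Proof.
move=> q3; reshape ([:: (3, e)] ++ q ++ [:: (3, ~~ e)]);
  apply: inspan_ctx (inspan_mono (isT : 3 <= 4) (nf3P q3)) _ => {q q3} t.
have Zsame b : inspan 4 L' ((3, b) :: Z b ++ [:: (3, ~~ b)]).
  reshape ([::] ++ ((3, b) :: Z b ++ [:: (3, ~~ b)]) ++ [::]).
  apply: Z_om_pair; first by move=> s; rewrite cats0; exact: inspan_in.
  by rewrite cats0; exact: om_cross.
have Zc g : inspan 4 L' ((3, e) :: Z g ++ [:: (3, ~~ e)]).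
  have [->|ge] := eqVneq g e; first exact: Zsame.
  have -> : g = ~~ e by case: g e ge => -[].
  have -> : (3, e) :: Z (~~ e) ++ [:: (3, ~~ e)] = rev ((3, ~~ e) :: Z (~~ e) ++ [:: (3, ~~ ~~ e)]).
    by rewrite negbK.
  by apply: inspan_bind (inspan_rev (Zsame (~~ e))) _ => s /L'_rev; rewrite revK; exact: inspan_in.
by case/or3P=> [tM|/eqP ->|/eqP ->]; rewrite cat1s //; exact: nfM_pair.
Qed.

Lemma q4_pair e q f : wlt 3 q ->
  inspan 4 (fun t => L' t \/ (e = f /\ exists g, t = (3, e) :: Z g ++
    [:: (3, e)])) ((3, e) :: q ++ [:: (3, f)]).
Proof.
move=> q3; have [<-|ef] := eqVneq e f; last first.
  have -> : f = ~~ e by case: e f ef => -[].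
  by apply: inspan_bind (q4_cross e q3) _ => t tL; apply: inspan_in; left.
reshape ([:: (3, e)] ++ q ++ [:: (3, e)]); apply: inspan_ctx (inspan_mono (isT : 3 <= 4) (nf3P
  q3)) _ => {q q3} t.
case/or3P=> [tM|/eqP ->|/eqP ->]; rewrite cat1s; try (by apply: inspan_in; right; split=> //;
  eexists).
by apply: inspan_bind (nfM_pair e e tM) _ => s sL; apply: inspan_in; left.
Qed.

(* Commutes with [s_1, s_2, s_3], hence brings two letters [s_4] together. *)
Definition dd e : word := (3, e) :: om e ++ [:: (3, e)].

Lemma valid_dd_comm i g e : i < 3 -> valid 4 ((i, g) :: dd e, [:: rcons (dd e) (i, g)]).
Proof.
case: i => [|[|[|//]]] _.
- apply: (@residueP _ _ [:: (1, r_comm 0 3); (1, r_om_comm 0); (1, r_comm 0 3)]); first by rules.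
  by case: e; case: g; vm_compute.
- apply: (@residueP _ _ [:: (1, r_comm 1 3); (1, r_om_comm 1); (1, r_comm 1 3)]); first by rules.
  by case: e; case: g; vm_compute.
- apply: (@residueP _ _ [:: (1, r_braid 2 3); (9, sufs 0 (r_comm 3 1) ++ sufs 1 (r_comm 3 0) ++
  r_comm 3 0); (1, sufs 2 (r_comm 3 1)); (1, r_braid 3 2)]); first by rules.
  by case: e; case: g; vm_compute.
Qed.

Lemma inspan_rule1 (T : word -> Prop) u l r v : valid 4 (l, [:: r]) ->
  inspan 4 T (u ++ r ++ v) -> inspan 4 T (u ++ l ++ v).
Proof. by move=> lr Tr; apply: inspan_ctx lr _ => x; rewrite inE => /eqP ->. Qed.

Lemma dd_comm (T : word -> Prop) u e q v : wlt 3 q -> inspan 4 T (u ++ q ++ dd e ++ v) ->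
  inspan 4 T (u ++ dd e ++ q ++ v).
Proof.
elim: q u => // -[i g] q IH u /andP [/= i3 q3] Tq.
reshape (u ++ (dd e ++ [:: (i, g)]) ++ q ++ v); apply: (@inspan_rule1 _ _ _ ((i, g) :: dd e)).
  exact: (valid_rev (valid_dd_comm g e i3)).
by reshape ((u ++ [:: (i, g)]) ++ dd e ++ q ++ v); apply: IH => //;
  reshape (u ++ (i, g) :: q ++ dd e ++ v).
Qed.

(** * Words with four letters s_4^b *)

Lemma ZZZ_om b g2 g3 :
  inspan 4 (F 3) ((3, b) :: Z b ++ (3, b) :: Z g2 ++ (3, b) :: Z g3 ++ [:: (3, b)]).
Proof.
have Z3 g : wlt 3 (Z g) by case: g.
reshape ([::] ++ ((3, b) :: Z b ++ [:: (3, b)]) ++ (Z g2 ++ (3, b) :: Z g3 ++ [:: (3, b)])).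
apply: Z_om_pair => [t tL|]; first exact: L'_four_four.
apply: dd_comm => //.
by apply: (@merge4 3 (Z g2 ++ (3, b) :: om b) b [::] b (Z g3 ++ [:: (3, b)])) => //; case: b;
  case: g2; case: g3.
Qed.

Lemma ZomZ b g1 g3 :
  inspan 4 (F 3) ((3, b) :: Z g1 ++ (3, b) :: Z b ++ (3, b) :: Z g3 ++ [:: (3, b)]).
Proof.
have Z3 g : wlt 3 (Z g) by case: g.
reshape (((3, b) :: Z g1) ++ ((3, b) :: Z b ++ [:: (3, b)]) ++ (Z g3 ++ [:: (3, b)])).
apply: Z_om_pair => [t tL|]; first exact: (four_L'_four b b tL (Z3 g1) (Z3 g3)).
apply: dd_comm => //.
by apply: (@merge4 3 ((3, b) :: Z g1 ++ Z g3 ++ (3, b) :: om b) b [::] b [::]) => //; case: b;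
  case: g1; case: g3.
Qed.

(** By s_4^e s_3^-e = s_3^-e s_4^-e s_3^e s_4^e a letter s_4^-e of the opposite sign appears. *)
Definition r_D e : rule := ((3, e) :: Z (~~ e) ++ [:: (3, e)], [:: [:: (2, ~~ e); (3, ~~ e);
  (2, e)] ++ X 0 1 true ++ X 2 3 e]).
Lemma valid_D e : valid 4 (r_D e).
Proof.
apply: (@residueP _ _ [:: (1, [:: ins [::] 2 (~~ e) [:: (3, e)]]); (1, r_bm 2 3);
  (9, r_comm 3 0 ++ r_comm 3 1)]); first by rules.
by case: e; vm_compute.
Qed.

Lemma WZ4 e :
  inspan 4 (fun t => t \in ([:: (3, ~~ e); (2, e)] ++ X 0 1 true ++ [:: (2, e); (3, ~~ e);
  (2, ~~ e)])
    :: [seq s ++ X 0 1 true ++ [:: (2, ~~ e); (3, e)] | s <- uuu 2 3]) (X 2 3 e ++ Z (~~ e) ++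
      [:: (3, e)]).
Proof.
apply: (@residueP _ _ [:: (1, at_ 2 3 r_abs); (1, [:: r_mixed 2 3 e]);
  (9, r_comm 3 0 ++ r_comm 3 1); (1, r_bm 3 2)]); first by rules.
by case: e; vm_compute.
Qed.

(* The one word with four letters [s_4^e] for which [dd] is of no use: rewriting
   the middle factor [s_4 Z s_4] by braid moves creates a sign change, so that
   [q4_cross] applies. *)
Lemma ZZZ_omega e : let z := Z (~~ e) in inspan 4 (F 3) ((3, e) :: z ++ (3, e) :: z ++
  (3, e) :: z ++ [:: (3, e)]).
Proof.
move=> z; have z3 : wlt 3 z by rewrite /z; case: (e).
reshape (((3, e) :: z) ++ ((3, e) :: z ++ [:: (3, e)]) ++ (z ++ [:: (3, e)])).
apply: inspan_rule1 (valid_D e) _.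
reshape (((3, e) :: z ++ [:: (2, ~~ e); (3, ~~ e); (2, e)] ++ X 0 1 true) ++ (X 2 3 e ++ z ++
  [:: (3, e)]) ++ [::]).
apply: inspan_ctx (WZ4 e) _ => t; rewrite in_cons cats0 => /orP [/eqP ->|/mapP [s su ->]].
  reshape (((3, e) :: z ++ [:: (2, ~~ e); (3, ~~ e);
    (2, e)]) ++ X 0 1 true ++ (3, ~~ e) :: (2, e) :: X 0 1 true ++ [:: (2, e); (3, ~~ e);
    (2, ~~ e)]).
  apply: comm4i => //.
  have H : inspan 4 (fun t => t = W \/ cnt 3 t <= 1) [:: (3, ~~ e); (2, e); (3, ~~ e)].
    case: (e); last by apply: inspan_in; left.
    apply: inspan_bind (valid_mixed (n := 4) (i := 2) (j := 3) false isT isT isT) _ => r.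
    rewrite in_cons => /orP [/eqP ->|ru]; apply: inspan_in; [by left|right].
    by move: r ru; apply/allP; vm_compute.
  reshape (((3, e) :: z ++ [:: (2, ~~ e)]) ++ [:: (3, ~~ e); (2, e);
    (3, ~~ e)] ++ (X 0 1 true ++ (2, e) :: X 0 1 true ++ [:: (2, e); (3, ~~ e); (2, ~~ e)])).
  apply: inspan_ctx H _ => r [->|r1]; last by apply: inspan_in; count.
  reshape ([::] ++ ((3, e) :: (z ++ [:: (2, ~~ e)]) ++ W ++ (X 0 1 true ++
    (2, e) :: X 0 1 true ++ [:: (2, e)]) ++ [:: (3, ~~ e)]) ++ [:: (2, ~~ e)]).
  by apply: inspan_F (four_W_four _ _ _ _) _; rewrite ?wlt_cat ?z3.
have [s4 s1] : wlt 4 s /\ cnt 3 s <= 1 by apply/andP; move: s su; apply/allP; vm_compute.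
move: s1; rewrite leq_eqVlt ltnS leqn0 => /orP [/eqP s1|/eqP s0]; last by apply: inspan_in; count.
have [x [k [y [-> x3 y4 y0]]]] := cnt_split s4 s1.
have y3 := cnt_wlt y4 y0.
have zq : wlt 3 (z ++ [:: (2, ~~ e)]) by rewrite wlt_cat z3.
have xq : wlt 3 ((2, e) :: X 0 1 true ++ x) by rewrite /= x3.
have yq : wlt 3 (y ++ X 0 1 true ++ [:: (2, ~~ e)]) by rewrite wlt_cat y3.
have [ke|ke] := eqVneq k e.
  rewrite ke; have := q4_cross (~~ e) xq; rewrite negbK => H.
  reshape (((3, e) :: z ++ [:: (2, ~~ e)]) ++ ((3, ~~ e) :: ((2, e) :: X 0 1 true ++ x) ++
    [:: (3, e)]) ++ (y ++ X 0 1 true ++ [:: (2, ~~ e)]) ++ [:: (3, e)]).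
  by apply: inspan_ctx H _ => r rL; exact: (four_L'_four e e rL zq yq).
have -> : k = ~~ e by case: (k) (e) ke => -[].
have := q4_cross (~~ e) yq; rewrite negbK => H.
reshape (((3, e) :: (z ++ [:: (2, ~~ e)]) ++ (3, ~~ e) :: ((2, e) :: X 0 1 true ++ x)) ++
  ((3, ~~ e) :: (y ++ X 0 1 true ++ [:: (2, ~~ e)]) ++ [:: (3, e)]) ++ [::]).
apply: inspan_ctx H _ => r rL.
by reshape ((3, e) :: (z ++ [:: (2, ~~ e)]) ++ (3, ~~ e) :: ((2, e) :: X 0 1 true ++ x) ++ r);
  exact: (four_four_L' e (~~ e) rL zq xq).
Qed.

Lemma ZZZ b g1 g2 g3 :
  inspan 4 (F 3) ((3, b) :: Z g1 ++ (3, b) :: Z g2 ++ (3, b) :: Z g3 ++ [:: (3, b)]).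
Proof.
have [->|g1b] := eqVneq g1 b; first exact: ZZZ_om.
have [->|g2b] := eqVneq g2 b; first exact: ZomZ.
have [->|g3b] := eqVneq g3 b; first by apply: F_rev; exact: (ZZZ_om b g2 g1).
have gE g : g != b -> g = ~~ b by case: (g) (b) => -[].
by rewrite (gE _ g1b) (gE _ g2b) (gE _ g3b); exact: ZZZ_omega.
Qed.

Lemma four_four_four_four a q1 b q2 c q3 d : wlt 3 q1 -> wlt 3 q2 -> wlt 3 q3 ->
  inspan 4 (F 3) ((3, a) :: q1 ++ (3, b) :: q2 ++ (3, c) :: q3 ++ [:: (3, d)]).
Proof.
move=> q1_3 q2_3 q3_3; have Z3 g : wlt 3 (Z g) by case: g.
reshape (((3, a) :: q1) ++ ((3, b) :: q2 ++ [:: (3, c)]) ++ (q3 ++ [:: (3, d)])).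
apply: inspan_ctx (q4_pair b c q2_3) _ => t [tL|[bc [g ->]]].
  exact: (four_L'_four a d tL q1_3 q3_3).
reshape ([::] ++ ((3, a) :: q1 ++ [:: (3, b)]) ++ (Z g ++ (3, b) :: q3 ++ [:: (3, d)])).
apply: inspan_ctx (q4_pair a b q1_3) _ => {}t [tL|[-> [g1 ->]]]; first exact: (L'_four_four b d tL).
reshape (((3, b) :: Z g1 ++ (3, b) :: Z g) ++ ((3, b) :: q3 ++ [:: (3, d)]) ++ [::]).
apply: inspan_ctx (q4_pair b d q3_3) _ => {}t [tL|[_ [g3 ->]]].
  by reshape ((3, b) :: Z g1 ++ (3, b) :: Z g ++ t); exact: (four_four_L' b b tL).
by reshape ((3, b) :: Z g1 ++ (3, b) :: Z g ++ (3, b) :: Z g3 ++ [:: (3, b)]); exact: ZZZ.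
Qed.

Lemma ax_wlt n l rs r : ax n l rs -> r \in rs -> wlt n r.
Proof.
case=> [i e i_n|i e i_n|i e i_n|i e i_n|i j e f i_n j_n _|i j e i_n j_n _|i j e f i_n j_n _|i j e
  i_n j_n _].
- by rewrite inE => /eqP ->.
- by rewrite inE => /eqP ->; rewrite /wlt /= i_n.
- by rewrite !inE => /or3P [] /eqP ->; rewrite /wlt /= ?i_n.
- by rewrite !inE => /or3P [] /eqP ->; rewrite /wlt /= ?i_n.
- by rewrite inE => /eqP ->; rewrite /wlt /= i_n j_n.
- by rewrite inE => /eqP ->; rewrite /wlt /= i_n j_n.
- by rewrite inE => /eqP ->; rewrite /wlt /= i_n j_n.
rewrite in_cons => /orP [/eqP ->|/uuuP [p _ ->]]; first by rewrite /wlt /= i_n j_n.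
by rewrite /wlt /pattern all_map; apply/allP => -[[] e'] _ /=.
Qed.

(** Rewriting introduces no new generator. This has to be recorded because [F k] only counts letters
    s_4. *)
Lemma inspan_wlt n (T : word -> Prop) w : wlt n w -> inspan n T w ->
  inspan n (fun t => T t /\ wlt n t) w.
Proof.
move=> wn Tw; elim: Tw wn => [t Tt tn|u l v rs lrs _ IH]; first exact: inspan_in.
rewrite !wlt_cat => /and3P [un ln vn]; apply: (inspan_step lrs) => r rs_r.
by apply: IH => //; rewrite !wlt_cat un vn (ax_wlt lrs rs_r).
Qed.

Theorem F3P w : wlt 4 w -> inspan 4 (F 3) w.
Proof.
elim: w => [_|[i e] w IH /andP [/= i4 w4]]; first exact: inspan_in.
reshape ([:: (i, e)] ++ w ++ [::]); apply: inspan_ctx (inspan_wlt w4 (IH w4)) _ => t [tF t4].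
have [i3|] := ltnP i 3; first by apply: inspan_in; rewrite cats0 /F cnt_cat /cnt /= (ltn_eqF i3).
rewrite leq_eqVlt ltnNge -ltnS i4 orbF => /eqP i3; subst i; rewrite cats0.
move: tF; rewrite /F leq_eqVlt ltnS => /orP [/eqP t3|t2]; last by apply: inspan_in; count.
have [q1 [b [y [-> q1_3 y4 y2]]]] := cnt_split t4 t3.
have [q2 [c [z [-> q2_3 z4 z1]]]] := cnt_split y4 y2.
have [q3 [d [s [-> q3_3 s4 s0]]]] := cnt_split z4 z1.
have s3 := cnt_wlt s4 s0.
reshape ([::] ++ ((3, e) :: q1 ++ (3, b) :: q2 ++ (3, c) :: q3 ++ [:: (3, d)]) ++ s).
by apply: inspan_F (four_four_four_four _ _ _ _ _ _ _) _ => //; count.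
Qed.

(** * Finiteness *)

Definition fin_span n (P : word -> Prop) : Prop :=
  exists L : seq word, forall w, P w -> inspan n (fun t => t \in L) w.

Section FinSpan.
Variable n : nat.
Implicit Types (P : word -> Prop) (L : seq word).

Lemma fin_span_seq L : fin_span n (fun w => w \in L).
Proof. by exists L => w; exact: inspan_in. Qed.

Lemma fin_span_bind P P' : (forall w, P w -> inspan n P' w) -> fin_span n P' -> fin_span n P.
Proof. by move=> PP' [L LP]; exists L => w /PP' P'w; exact: inspan_bind P'w LP. Qed.

Lemma fin_span_or P P' : fin_span n P -> fin_span n P' -> fin_span n (fun w => P w \/ P' w).
Proof.
move=> [L LP] [L' LP']; exists (L ++ L') => w [/LP Pw|/LP' Pw];
  by apply: inspan_bind Pw _ => t tL; apply: inspan_in; rewrite mem_cat tL ?orbT.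
Qed.

Lemma fin_span_cat P P' : fin_span n P -> fin_span n P' ->
  fin_span n (fun w => exists x y, [/\ P x, P' y & w = x ++ y]).
Proof.
move=> [L LP] [L' LP']; exists [seq x ++ y | x <- L, y <- L'] => _ [x [y [/LP Lx /LP' Ly ->]]].
rewrite -[x ++ y]/([::] ++ x ++ y); apply: inspan_ctx Lx _ => t tL; rewrite cat0s -[y]cats0.
by apply: inspan_ctx Ly _ => t' t'L; rewrite cats0; apply: inspan_in; exact: allpairs_f.
Qed.

Lemma fin_span_sandwich P P' L : fin_span n P -> fin_span n P' ->
  fin_span n (fun w => exists x m y, [/\ P x, m \in L, P' y & w = x ++ m ++ y]).
Proof.
move=> fP fP'; apply: fin_span_bind (fin_span_cat fP (fin_span_cat (fin_span_seq L) fP')).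
by move=> w [x [m [y [Px mL P'y ->]]]]; apply: inspan_in; exists x, (m ++ y); split=> //;
  exists m, y.
Qed.

Hypothesis n4 : 3 < n.

Lemma fin_span_wlt2 : fin_span n (wlt 2).
Proof. by exists (uuux 0 1 true) => w /wlt2_nf; apply: inspan_mono; exact: ltn_trans n4. Qed.

Lemma fin_span_wlt3 : fin_span n (wlt 3).
Proof.
pose P := fun w => (exists x m y, [/\ wlt 2 x, m \in Y :: pm 2, wlt 2 y & w = x ++ m ++ y]) \/
  (wlt 2 w \/ w \in [:: Z true; Z false]).
apply: (@fin_span_bind _ P) => [w /nf3P wn|].
  apply: inspan_bind (inspan_mono (ltnW n4) wn) _ => {wn}w wn; apply: inspan_in.
  case/or3P: wn => [|/eqP ->|/eqP ->]; [|by right; right; rewrite !inE eqxx ?orbT..].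
  case/andP=> w3 /orP [|/midP [u [v [u2 v2 ->]]]]; last first.
    by left; exists u, Y, v; split=> //; exact: mem_head.
  case E : (cnt 2 w) => [|k] k1; first by right; left; exact: cnt_wlt.
  have [x [e [y [-> x2 y3 yk]]]] := cnt_split w3 E; left; exists x, [:: (2, e)], y.
  by split=> //; [rewrite inE pmP orbT|apply: cnt_wlt => //; case: (k) k1 yk].
apply: fin_span_or; first exact: fin_span_sandwich fin_span_wlt2 fin_span_wlt2.
by apply: fin_span_or fin_span_wlt2 _; exact: fin_span_seq.
Qed.

(** A word is cut at its first s_4: the part in front belongs to Q_4 and the rest has one s_4
    less. *)
Lemma fin_span_F k : fin_span n (fun w => F k w /\ wlt 4 w).
Proof.
elim: k => [|k IH].
  by apply: fin_span_bind fin_span_wlt3 => w []; rewrite /F leqn0 => /eqP w0 w4;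
    apply: inspan_in; exact: cnt_wlt.
apply: fin_span_bind (fin_span_or fin_span_wlt3 (fin_span_sandwich (pm 3) fin_span_wlt3 IH)).
move=> w [wk w4]; apply: inspan_in; case E : (cnt 3 w) => [|j]; first by left; exact: cnt_wlt.
have [x [e [y [-> x3 y4 yj]]]] := cnt_split w4 E; right; exists x, [:: (3, e)], y.
by split; rewrite ?pmP //; split=> //; rewrite /F yj; move: wk; rewrite /F E ltnS.
Qed.

End FinSpan.

Lemma fin_span_wlt4 : fin_span 4 (wlt 4).
Proof.
by apply: fin_span_bind (fin_span_F _ 3) => // w w4; exact: inspan_wlt (F3P w4).
Qed.

Import GRing.Theory.
Local Open Scope ring_scope.

(** * Soundness of the relations in an algebra *)

Section Submodule.
Variables (R : unitRingType) (V : lmodType R).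
Implicit Types x y : V.

(** Soundness concerns arbitrary submodules: the inverse image of one under multiplication by u on
    the left and v on the right is again one, which is what rewriting inside a word requires. *)
Definition is_submod (N : V -> Prop) : Prop :=
  [/\ N 0, forall x y, N x -> N y -> N (x + y) & forall k x, N x -> N (k *: x)].

Variables (N : V -> Prop) (cN : is_submod N).

Lemma submodD x y : N x -> N y -> N (x + y). Proof. by case: cN => _ + _; apply. Qed.

Lemma submodZ k x : N x -> N (k *: x). Proof. by case: cN => _ _; apply. Qed.

Lemma submodN x : N x -> N (- x). Proof. by rewrite -scaleN1r; exact: submodZ. Qed.

Lemma submodB x y : N x -> N y -> N (x - y). Proof. by move=> Nx /submodN; exact: submodD. Qed.

Lemma submodZV k x : k \is a GRing.unit -> N (k *: x) -> N x.
Proof. by move=> Uk /(submodZ k^-1); rewrite scalerA mulVr // scale1r. Qed.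

Lemma submodDl x y : N x -> N (x + y) -> N y.
Proof. by move=> Nx Nxy; rewrite -[y](addKr x); apply: submodD => //; exact: submodN. Qed.

Lemma submod_eq0 x y : x + y = 0 -> N x -> N y.
Proof. by move=> xy Nx; apply: (submodDl Nx); rewrite xy; case: cN. Qed.

End Submodule.

Section Cubic.
Variables (R : comUnitRingType) (A : algType R) (a b c : R).
Implicit Types x y p q : A.

Definition cubic p := (p - a%:A) * (p - b%:A) * (p - c%:A).
Definition e1 := a + b + c.
Definition e2 := a * b + b * c + a * c.
Definition e3 := a * b * c.

Lemma cubicE p : cubic p = p * p * p - e1 *: (p * p) + e2 *: p - e3%:A.
Proof.
have cA k x : x * k%:A = k *: x by rewrite -scalerAr mulr1.
have Ac k x : k%:A * x = k *: x by rewrite -scalerAl mul1r.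
have abE : (p - a%:A) * (p - b%:A) = p * p - (a + b) *: p + (a * b)%:A.
  rewrite mulrBl !mulrBr cA !Ac scalerA opprB scalerDl opprD !addrA.
  by rewrite [LHS](ACl (1*4*2*3)).
rewrite /cubic abE mulrBr cA mulrDl mulrBl -!scalerAl mul1r !(scalerDr, scalerN) !scalerA.
have -> : e1 = a + b + c by [].
have -> : e2 = a * b + c * (a + b) by rewrite /e2 mulrDr -addrA [b * c + _]addrC (mulrC a c)
  (mulrC b c).
have -> : e3 = c * (a * b) by rewrite mulrC.
by rewrite [in RHS]scalerDl [in RHS]scalerDl !opprD opprK !addrA [LHS](ACl (1*2*4*3*5*6)).
Qed.

(** The inverses are separate arguments, so that conjugation acts on all four alike. *)
Definition mixed x x' y y' := x' * y * x
  - (x * y * x' - a^-1 *: (x * y) + a *: (x * y')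
     + a *: (x' * y) - a ^+ 3 *: (x' * y') + a^-1 *: (y * x)
     - a *: (y * x') - a *: (y' * x) + a ^+ 3 *: (y' * x')
     + a ^+ 2 *: (x' * y' * x) - a ^+ 2 *: (x * y' * x')).

Lemma cubic_conj g g' p : g' * g = 1 -> g * g' = 1 -> cubic (g * p * g') = g * cubic p * g'.
Proof.
move=> g'g gg'; have B k : g * p * g' - k%:A = g * (p - k%:A) * g'.
  by rewrite mulrBr mulrBl -scalerAr mulr1 -scalerAl gg'.
by rewrite /cubic !B !mulrA -(mulrA _ g' g) g'g mulr1 -(mulrA _ g' g) g'g mulr1.
Qed.

Lemma mixed_conj g g' x x' y y' : g' * g = 1 ->
  mixed (g * x * g') (g * x' * g') (g * y * g') (g * y' * g') = g * mixed x x' y y' * g'.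
Proof.
move=> g'g; pose f x := g * x * g'.
have fM : {morph f : x y / x * y} by move=> u v; rewrite /f !mulrA -(mulrA _ g' g) g'g mulr1.
have fD : {morph f : x y / x + y} by move=> u v; rewrite /f mulrDr mulrDl.
have fN : {morph f : x / - x} by move=> u; rewrite /f mulrN mulNr.
have fZ k : {morph f : x / k *: x} by move=> u; rewrite /f -scalerAr -scalerAl.
by rewrite -!/(f _) /mixed !(fM, fD, fN, fZ).
Qed.

Lemma submod_ctx N u v : is_submod N -> is_submod (fun x => N (u * x * v)).
Proof.
case=> N0 ND NZ; split=> [|x y Nx Ny|k x Nx]; first by rewrite mulr0 mul0r.
  by rewrite mulrDr mulrDl; exact: ND.
by rewrite -scalerAr -scalerAl; exact: NZ.
Qed.

Definition inverse_pair p P := p * P = 1 /\ P * p = 1.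

Lemma inverse_pair_sym p P : inverse_pair p P -> inverse_pair P p.
Proof. by case. Qed.

Lemma inverseK p P x : inverse_pair p P -> (p * (P * x) = x) * (P * (p * x) = x).
Proof. by case=> pP Pp; rewrite !mulrA pP Pp !mul1r. Qed.

Lemma comm_inverse p P q : inverse_pair p P -> p * q = q * p -> P * q = q * P.
Proof.
move=> pP pq; rewrite -[q in LHS]mulr1 -(pP.1) [q * _]mulrA -pq -[p * q * P]mulrA.
by rewrite (inverseK _ pP).
Qed.

Section Pair.
Variables (p P q Q : A).
Hypotheses (pP : inverse_pair p P) (qQ : inverse_pair q Q).

Hypothesis pqp : p * q * p = q * p * q.

Let K x : (p * (P * x) = x) * (P * (p * x) = x) * (q * (Q * x) = x) * (Q * (q * x) = x).
Proof. by rewrite !(inverseK _ pP) !(inverseK _ qQ). Qed.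

Lemma braid_inverse : P * Q * P = Q * P * Q.
Proof.
have E : P * (Q * (P * (q * p * q * (Q * (P * Q))))) = Q * (P * Q).
  by rewrite -pqp -!mulrA !K.
by rewrite -!mulrA -E -!mulrA !K qQ.1 mulr1.
Qed.

Lemma braid_mixed : p * q * P = Q * p * q.
Proof.
have E : Q * (q * p * q * P) = p * q * P by rewrite -!mulrA !K.
by rewrite -E -pqp -!mulrA pP.1 mulr1.
Qed.

End Pair.

Lemma cubic_sq p P : inverse_pair p P -> cubic p = 0 ->
  p * p - e1 *: p + e2%:A - e3 *: P = 0.
Proof.
case=> pP _ /(congr1 ( *%R^~ P)); rewrite mul0r cubicE !(mulrDl, mulNr) -!scalerAl mul1r pP.
by rewrite -!(mulrA _ p P) pP !mulr1.
Qed.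

Lemma cubic_linear p P : inverse_pair p P -> cubic p = 0 ->
  p - e1%:A + e2 *: P - e3 *: (P * P) = 0.
Proof.
move=> iP /(cubic_sq iP)/(congr1 ( *%R^~ P)); case: iP => pP _.
by rewrite mul0r !(mulrDl, mulNr) -!scalerAl mul1r -!(mulrA _ p P) pP !mulr1.
Qed.

Hypotheses (Ua : a \is a GRing.unit) (Ub : b \is a GRing.unit) (Uc : c \is a GRing.unit).

Lemma e3_unit : e3 \is a GRing.unit.
Proof. by rewrite /e3 !unitrM Ua Ub Uc. Qed.

Section CubicSubmodule.
Variables (p P : A) (N : A -> Prop).
Hypotheses (pP : inverse_pair p P) (p0 : cubic p = 0) (cN : is_submod N).

Lemma submod_sq : N p -> N 1 -> N P -> N (p * p).
Proof.
move=> Np N1 NP; apply: (submod_eq0 cN (x := - e1 *: p + e2%:A - e3 *: P)).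
  by rewrite -[RHS](cubic_sq pP p0) scaleNr addrC !addrA.
by apply: submodB => //; [apply: submodD => //|]; apply: submodZ.
Qed.

Lemma submod_invsq : N p -> N 1 -> N P -> N (P * P).
Proof.
move=> Np N1 NP; apply: (submodZV cN e3_unit); rewrite -[_ *: _]opprK; apply: submodN => //.
apply: (submod_eq0 cN (cubic_linear pP p0)).
by apply: submodD => //; [apply: submodB => //|]; apply: submodZ.
Qed.

Lemma submod_unsq : N (P * P) -> N P -> N 1 -> N p.
Proof.
move=> NPP NP N1; apply: (submod_eq0 cN (x := - e1 *: 1 + e2 *: P - e3 *: (P * P))).
  by rewrite -[RHS](cubic_linear pP p0) scaleNr addrC !addrA.
by apply: submodB => //; [apply: submodD => //|]; apply: submodZ.
Qed.

Lemma submod_invunsq : N (p * p) -> N p -> N 1 -> N P.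
Proof.
move=> Npp Np N1; apply: (submodZV cN e3_unit); rewrite -[_ *: _]opprK; apply: submodN => //.
apply: (submod_eq0 cN (cubic_sq pP p0)).
by apply: submodD => //; [apply: submodB => //|]; apply: submodZ.
Qed.

End CubicSubmodule.

(** The last two terms are set apart because, after multiplication by y on the right, they are the
    ones that do not reduce to u_x u_y u_x. *)
Lemma mixedE x x' y y' : mixed x x' y y' =
  x' * y * x + a^-1 *: (x * y) - a *: (x * y') - a *: (x' * y) + a ^+ 3 *: (x' * y') - a^-1 *: (y
    * x)
  + a *: (y' * x) - a ^+ 3 *: (y' * x') - a ^+ 2 *: (x' * y' * x) + a ^+ 2 *: (x * y' * x')
  + (a *: (y * x') - x * y * x').
Proof. by rewrite /mixed !opprD !opprK !addrA [LHS](ACl (1*3*4*5*6*7*9*10*11*12*8*2)). Qed.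

(* In [mixed p P q Q * q] all terms but [q P q] and [p q P q = Q p q^2] are, after
   braid moves, in the span of [u_p u_q u_p], and [Q p q^2] is [e3 Q p Q] modulo
   that span. *)
Section MixedSubmodule.
Variables (p P q Q : A) (N : A -> Prop).
Hypotheses (pP : inverse_pair p P) (qQ : inverse_pair q Q) (pqp : p * q * p = q * p * q).
Hypotheses (p0 : cubic p = 0) (q0 : cubic q = 0) (pq0 : mixed p P q Q = 0) (cN : is_submod N).
Let T x := x = 1 \/ x = p \/ x = P.
Hypothesis NT : forall x z, T x -> T z -> [/\ N x, N (x * q * z) & N (x * Q * z)].

Let T1 : T 1. Proof. by left. Qed.
Let Tp : T p. Proof. by right; left. Qed.
Let TP : T P. Proof. by right; right. Qed.
Let K x : (p * (P * x) = x) * (P * (p * x) = x) * (q * (Q * x) = x) * (Q * (q * x) = x).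
Proof. by rewrite !(inverseK _ pP) !(inverseK _ qQ). Qed.
Let N_ x : T x -> N x. Proof. by move=> Tx; case: (NT Tx T1). Qed.
Let Nq x : T x -> N (x * q). Proof. by move=> Tx; case: (NT Tx T1); rewrite mulr1. Qed.
Let NQ x : T x -> N (x * Q). Proof. by move=> Tx; case: (NT Tx T1); rewrite !mulr1. Qed.
Let qN z : T z -> N (q * z). Proof. by move=> Tz; case: (NT T1 Tz); rewrite !mul1r. Qed.
Let QN z : T z -> N (Q * z). Proof. by move=> Tz; case: (NT T1 Tz); rewrite !mul1r. Qed.
Let NqN x z : T x -> T z -> N (x * q * z). Proof. by move=> Tx Tz; case: (NT Tx Tz). Qed.
Let NQN x z : T x -> T z -> N (x * Q * z). Proof. by move=> Tx Tz; case: (NT Tx Tz). Qed.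

Let Nqq x : T x -> N (x * q * q).
Proof.
move=> Tx; rewrite -[N _]/((fun y => N y) (x * q * q)).
have := submod_sq qQ q0 (submod_ctx x 1 cN); rewrite !mulr1 !mulrA.
by apply; [exact: Nq|exact: N_|exact: NQ].
Qed.

Let qpqN : N (q * p * q).
Proof. by rewrite -pqp; apply: NqN. Qed.

Let NppQP : N (p * p * Q * P).
Proof.
have := submod_sq pP p0 (submod_ctx 1 (Q * P) cN); rewrite !mul1r !mulrA.
by apply; [exact: NQN|exact: QN|exact: NQN].
Qed.

Let iqP := inverse_pair_sym qQ.
Let ipP := inverse_pair_sym pP.
Let pqP : p * q * P = Q * p * q. Proof. exact: braid_mixed. Qed.
Let QPq : Q * P * q = p * Q * P.
Proof. by apply: braid_mixed => //; rewrite (braid_inverse pP qQ pqp). Qed.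

Let N_difference : N (a *: (q * P * q) - p * q * P * q).
Proof.
rewrite scalerAl -mulrBl.
pose N' x := N (1 * x * q); have cN' : is_submod N' := submod_ctx 1 q cN.
suff: N' (a *: (q * P) - p * q * P) by rewrite /N' mul1r.
have : N' (mixed p P q Q) by rewrite pq0; case: cN'.
rewrite mixedE; apply: (submodDl cN').
repeat (first [apply: (submodB cN') | apply: (submodD cN') | apply: (submodZ cN')]);
  rewrite /N' mul1r.
- by rewrite -!mulrA [q * (p * q)]mulrA -pqp -!mulrA K; exact: qN.
- exact: Nqq.
- by rewrite -mulrA iqP.1 mulr1; exact: N_.
- exact: Nqq.
- by rewrite -mulrA iqP.1 mulr1; exact: N_.
- exact: qpqN.
- by rewrite -pqP; exact: NqN.
- by rewrite QPq; exact: NQN.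
- by rewrite -!mulrA [Q * (p * q)]mulrA -pqP -!mulrA K; exact: qN.
- by rewrite -!mulrA [Q * (P * q)]mulrA QPq !mulrA; exact: NppQP.
Qed.

Let N_pqPq : N (p * q * P * q - e3 *: (Q * p * Q)).
Proof.
apply: (submod_eq0 cN (x := e2 *: (Q * p) - e1 *: (Q * p * q))).
  have /(congr1 ( *%R (Q * p))) := cubic_sq qQ q0.
  rewrite mulr0 !(mulrDr, mulrN) -!scalerAr mulr1 mulrA pqP => <-.
  by rewrite addrA [LHS](ACl (3*2*1*4)).
by apply: submodB => //; apply: submodZ => //; [exact: QN|rewrite -pqP; exact: NqN].
Qed.

Let N_e3QpQ : N (a *: (q * P * q) - e3 *: (Q * p * Q)).
Proof. by rewrite -[X in N (X - _)](subrK (p * q * P * q)) -addrA; exact: submodD. Qed.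

Lemma submod_mixed : N (Q * p * Q) -> N (q * P * q).
Proof.
move=> /(submodZ cN e3) NQpQ; apply: (submodZV cN Ua).
by rewrite -[_ *: _](subrK (e3 *: (Q * p * Q))); exact: submodD.
Qed.

Lemma submod_invmixed : N (q * P * q) -> N (Q * p * Q).
Proof.
move=> /(submodZ cN a) NqPq; apply: (submodZV cN e3_unit).
by rewrite -[_ *: _](subKr (a *: (q * P * q))); exact: submodB.
Qed.

End MixedSubmodule.

Section Soundness.
Variables (n : nat) (phi : letter -> A).
Hypotheses (phi_inverse : forall i, (i < n)%N -> inverse_pair (phi (i, true)) (phi (i, false))).
Hypotheses (phi_cubic : forall i, (i < n)%N -> cubic (phi (i, true)) = 0).
Hypotheses (phi_comm : forall i j, (i < n)%N -> (j < n)%N -> far i j ->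
  phi (i, true) * phi (j, true) = phi (j, true) * phi (i, true)).
Hypotheses (phi_braid : forall i j, (i < n)%N -> (j < n)%N -> adj i j ->
  phi (i, true) * phi (j, true) * phi (i, true) = phi (j, true) * phi (i, true) * phi (j, true)).
Hypotheses (phi_mixed : forall i j, (i < n)%N -> (j < n)%N -> adj i j ->
  mixed (phi (i, true)) (phi (i, false)) (phi (j, true)) (phi (j, false)) = 0).

Definition word_val w := \prod_(l <- w) phi l.

Lemma word_val_cat u v : word_val (u ++ v) = word_val u * word_val v.
Proof. exact: big_cat. Qed.

Let inv i e : (i < n)%N -> inverse_pair (phi (i, e)) (phi (i, ~~ e)).
Proof. by move=> /phi_inverse; case: e => // /inverse_pair_sym. Qed.

Let word_valE := (big_cons, big_nil, mulr1).

Let braid_ i j e : (i < n)%N -> (j < n)%N -> adj i j ->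
  phi (i, e) * phi (j, e) * phi (i, e) = phi (j, e) * phi (i, e) * phi (j, e).
Proof.
move=> i_n j_n ij; case: e; first exact: phi_braid.
by apply: braid_inverse (phi_braid i_n j_n ij); exact: phi_inverse.
Qed.

Lemma ax_submod l rs (N : A -> Prop) : is_submod N -> ax n l rs ->
  (forall r, r \in rs -> N (word_val r)) -> N (word_val l).
Proof.
move=> cN; case=> {l rs}.
- move=> i e i_n /(_ [::] (mem_head _ _)); rewrite /word_val !word_valE.
  by rewrite (inv e i_n).1.
- move=> i e i_n /(_ _ (mem_head _ _)); rewrite /word_val !word_valE.
  by rewrite (inv e i_n).1.
- move=> i e i_n H.
  have := H [:: (i, e)]; have := H [::]; have := H [:: (i, ~~ e)].
  rewrite /word_val !word_valE !inE !eqxx !orbT => /(_ isT) NP /(_ isT) N1 /(_ isT) Np.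
  case: e NP Np {H} => /= NP Np; first exact: submod_sq (phi_inverse i_n) (phi_cubic i_n) cN Np
    N1 NP.
  exact: submod_invsq (phi_inverse i_n) (phi_cubic i_n) cN NP N1 Np.
- move=> i e i_n H.
  have := H [:: (i, ~~ e); (i, ~~ e)]; have := H [::]; have := H [:: (i, ~~ e)].
  rewrite /word_val !word_valE !inE !eqxx !orbT => /(_ isT) NP /(_ isT) N1 /(_ isT) Np.
  case: e NP Np {H} => /= NP Np; first exact: submod_unsq (phi_inverse i_n) (phi_cubic i_n) cN Np
    NP N1.
  exact: submod_invunsq (phi_inverse i_n) (phi_cubic i_n) cN Np NP N1.
- move=> i j e f i_n j_n ij /(_ _ (mem_head _ _)); rewrite /word_val !word_valE.
  have C x : phi (i, true) * x = x * phi (i, true) -> phi (i, e) * x = x * phi (i, e).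
    by case: (e) => //; apply: comm_inverse; exact: phi_inverse.
  suff -> : phi (i, e) * phi (j, f) = phi (j, f) * phi (i, e) by [].
  apply: C; apply: esym; case: f; first exact/esym/phi_comm.
  by apply: comm_inverse; [exact: phi_inverse|exact/esym/phi_comm].
- by move=> i j e i_n j_n ij /(_ _ (mem_head _ _));
  rewrite /word_val !word_valE !mulrA (braid_ e i_n j_n ij).
- move=> i j e f i_n j_n ij /(_ _ (mem_head _ _)); rewrite /word_val !word_valE !mulrA.
  have [[iP jQ] ji] := (inv e i_n, inv e j_n, braid_ e i_n j_n ij).
  have [->|] := eqVneq f e; first by rewrite (braid_mixed iP jQ ji).
  rewrite eq_sym -negb_add negbK => /addbP <-.
  (* The remaining sign is the same identity for the inverse letters, with i and j exchanged. *)
  have iP' := inverse_pair_sym iP; have jQ' := inverse_pair_sym jQ.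
  by rewrite (braid_mixed jQ' iP' (esym (braid_inverse iP jQ ji))).
move=> i j e i_n j_n ij H.
have NE (r : word) : r \in uuu i j -> N (word_val r) by move=> ru; apply: H; rewrite inE ru orbT.
have NT x z : (x = 1 \/ x = phi (i, true) \/ x = phi (i, false)) ->
    (z = 1 \/ z = phi (i, true) \/ z = phi (i, false)) ->
    [/\ N x, N (x * phi (j, true) * z) & N (x * phi (j, false) * z)].
  have W x' : (x' = 1 \/ x' = phi (i, true) \/ x' = phi (i, false)) ->
      exists2 w, w \in [:: [::]; [:: (false, true)];
        [:: (false, false)]] & x' = word_val (pattern i j w).
    case=> [|[]] ->; [exists [::]|exists [:: (false, true)]|exists [:: (false, false)]] => //;
      by rewrite /word_val !word_valE.
  move=> /W [wx xP ->] /W [wz zP ->].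
  have NM (w : seq (bool * bool)) : w \in uuu_pattern -> N (word_val (pattern i j w)).
    by move=> wP; apply: NE; exact: map_f.
  have E f : word_val (pattern i j wx) * phi (j, f) * word_val (pattern i j wz) = word_val
    (pattern i j (wx ++ (true, f) :: wz)).
    by rewrite /pattern map_cat /= word_val_cat /word_val big_cons mulrA.
  rewrite !E; split; apply: NM.
  - by move: wx xP {E}; apply/allP.
  - by move: wx wz xP zP {E} => wx wz; rewrite !inE => /or3P [] /eqP -> /or3P [] /eqP ->.
  - by move: wx wz xP zP {E} => wx wz; rewrite !inE => /or3P [] /eqP -> /or3P [] /eqP ->.
have := H _ (mem_head _ _); rewrite /word_val !word_valE !mulrA.
have iP := phi_inverse i_n; have jQ := phi_inverse j_n; have ji := phi_braid i_n j_n ij.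
have M := phi_mixed i_n j_n ij; have [ci cj] := (phi_cubic i_n, phi_cubic j_n).
case: e {H} => /=; first exact: submod_mixed iP jQ ji ci cj M cN NT.
exact: submod_invmixed iP jQ ji ci cj M cN NT.
Qed.

Lemma inspan_submod (T : word -> Prop) (N : A -> Prop) w : is_submod N ->
  (forall t, T t -> N (word_val t)) -> inspan n T w -> N (word_val w).
Proof.
move=> cN TN Tw; elim: Tw => [t /TN //|u l v rs lrs _ IH].
rewrite !word_val_cat mulrA; apply: (ax_submod (submod_ctx (word_val u) (word_val v) cN) lrs) =>
  r /IH.
by rewrite !word_val_cat mulrA.
Qed.

End Soundness.
End Cubic.

(** * The algebra Q_5 *)

Section BraidConjugation.
Variable m : nat.

(** An index out of range gives s_1; the lemmas carry the bounds. *)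
Definition sigma (i : nat) : braid m.+2 := @artin m.+2 (inord i).

Local Open Scope group_scope.

Lemma braid_mulE u v : @bword m.+2 u * bword v = bword (u ++ v).
Proof. exact: bmulE. Qed.

Lemma sigma_comm i j : (i < m.+1)%N -> (j < m.+1)%N -> far i j -> commute (sigma i) (sigma j).
Proof.
move=> i_m j_m; wlog ij : i j i_m j_m / (i.+1 < j)%N => [th|_].
  by rewrite /far => /orP [] ij; [|apply: commute_sym]; apply: th => //; rewrite /far ij ?orbT.
by rewrite /commute /sigma /artin !braid_mulE; apply/bwordP; apply: braid_eq_comm; rewrite !inordK.
Qed.

Lemma sigma_braid i j : (i < m.+1)%N -> (j < m.+1)%N -> adj i j ->
  sigma i * sigma j * sigma i = sigma j * sigma i * sigma j.
Proof.
move=> i_m j_m; wlog ij : i j i_m j_m / (i.+1 == j)%N => [th|_].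
  by rewrite /adj => /orP [] ij; [|apply: esym]; apply: th => //; rewrite /adj ij ?orbT.
rewrite /sigma /artin !braid_mulE; apply/bwordP; apply: braid_eq_braid.
by rewrite !inordK //; exact/eqP.
Qed.

Lemma conjg_intertwine (x y h : braid m.+2) : x * h = h * y -> x ^ h = y.
Proof. by move=> xh; rewrite conjgE xh mulKg. Qed.

(* The defining relations involve [s_1, s_2] only; conjugation carries them to
   every ordered pair of adjacent generators. *)
Lemma sigma_conj_succ i : (i.+1 < m.+1)%N ->
  exists g, sigma 0 ^ g = sigma i /\ sigma 1 ^ g = sigma i.+1.
Proof.
elim: i => [|i IH] i_m; first by exists 1; rewrite !conjg1.
have [g [g0 g1]] := IH (ltnW i_m); exists (g * (sigma i.+2 * sigma i.+1 * sigma i)).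
rewrite !(conjgM _ g) g0 g1; set x := sigma i; set y := sigma i.+1; set z := sigma i.+2.
have xyx : x * y * x = y * x * y by apply: sigma_braid; rewrite ?/adj ?eqxx // ltnW // ltnW.
have yzy : y * z * y = z * y * z by apply: sigma_braid; rewrite ?/adj ?eqxx // ltnW.
have xz : x * z = z * x by apply: sigma_comm; rewrite /far ?ltnSn // ltnW // ltnW.
split; apply: conjg_intertwine.
  by rewrite !mulgA xz -!mulgA [x * (y * x)]mulgA xyx !mulgA.
by rewrite !mulgA yzy -(mulgA _ z x) -xz !mulgA.
Qed.

Lemma sigma_conj i j : (i < m.+1)%N -> (j < m.+1)%N -> adj i j ->
  exists g, sigma 0 ^ g = sigma i /\ sigma 1 ^ g = sigma j.
Proof.
move=> i_m j_m /orP [] /eqP ij; first by rewrite -ij in j_m *; exact: sigma_conj_succ.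
rewrite -ij in i_m *; have [g [g0 g1]] := sigma_conj_succ i_m.
(* Conjugation by x y x exchanges x and y, which reverses the pair. *)
exists (g * (sigma j * sigma j.+1 * sigma j)); rewrite !(conjgM _ g) g0 g1.
set x := sigma j; set y := sigma j.+1.
have xyx : x * y * x = y * x * y by apply: sigma_braid; rewrite ?/adj ?eqxx // ltnW.
split; apply: conjg_intertwine; first by rewrite {1}xyx !mulgA.
by rewrite !mulgA -xyx.
Qed.

End BraidConjugation.

Section QuotientLetters.
Variable m : nat.
Local Notation n := m.+2.
Local Notation QE := (@Qelt n).

Lemma QeltM g h : QE (g * h)%g = QE g * QE h.
Proof. by rewrite /Qelt geltM qprojM. Qed.

Lemma Qelt1 : QE 1%g = 1.
Proof. by rewrite /Qelt gelt1. Qed.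

Lemma Qelt_inverse g : inverse_pair (QE g) (QE g^-1%g).
Proof. by split; rewrite -QeltM ?mulgV ?mulVg Qelt1. Qed.

Lemma Qelt_conj g h : QE (g ^ h)%g = QE h^-1%g * QE g * QE h.
Proof. by rewrite conjgE !QeltM mulrA. Qed.

Lemma qprojN x : qproj (@Qrel _ La Lb Lc n) (- x) = - qproj _ x.
Proof. by rewrite -scaleN1r qprojZ scaleN1r. Qed.

Definition Qletter (l : letter) : Q n := QE (if l.2 then sigma m l.1 else (sigma m l.1)^-1%g).

Lemma Qelt_cubic0 : cubic La Lb Lc (QE (sigma m 0)) = 0.
Proof.
rewrite -[RHS](qproj_rel (x := @cubic_rel _ La Lb Lc n (inord 0))).
  by rewrite /cubic_rel !qprojM !qprojD !qprojN !qprojZ.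
by left; exists (inord 0); rewrite ?inordK.
Qed.

Lemma Qelt_mixed0 : (0 < m)%N ->
  mixed La (QE (sigma m 0)) (QE (sigma m 0)^-1%g) (QE (sigma m 1)) (QE (sigma m 1)^-1%g) = 0.
Proof.
move=> m0; rewrite -[RHS](qproj_rel (x := @mixed_rel _ La n (inord 0) (inord 1))).
  by rewrite /mixed_rel !(qprojM, qprojD, qprojN, qprojZ).
by right; exists (inord 0), (inord 1); rewrite !inordK.
Qed.

Lemma Qletter_cubic i : (i < m.+1)%N -> cubic La Lb Lc (Qletter (i, true)) = 0.
Proof.
move=> i_m; have [g gi] : exists g, (sigma m 0 ^ g = sigma m i)%g.
  case: i i_m => [|i] i_m; first by exists 1%g; rewrite conjg1.
  have ij : adj i.+1 i by rewrite /adj eqxx orbT.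
  by have [g [g0 _]] := sigma_conj i_m (ltnW i_m) ij; exists g.
have [gg' g'g] := Qelt_inverse g.
by rewrite /Qletter -gi Qelt_conj cubic_conj // Qelt_cubic0 mulr0 mul0r.
Qed.

Lemma Qletter_mixed i j : (i < m.+1)%N -> (j < m.+1)%N -> adj i j ->
  mixed La (Qletter (i, true)) (Qletter (i, false)) (Qletter (j, true)) (Qletter (j, false)) = 0.
Proof.
move=> i_m j_m ij; have [g [gi gj]] := sigma_conj i_m j_m ij; have [gg' g'g] := Qelt_inverse g.
rewrite /Qletter /= -gi -gj -!conjVg !Qelt_conj mixed_conj // Qelt_mixed0 ?mulr0 ?mul0r //.
by rewrite lt0n; apply: contraTneq ij => m0; move: i_m j_m;
  rewrite m0 !ltnS !leqn0 => /eqP -> /eqP ->.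
Qed.

Lemma Qletter_inspan_submod (T : word -> Prop) (N : Q n -> Prop) w : is_submod N ->
  (forall t, T t -> N (word_val Qletter t)) -> inspan m.+1 T w -> N (word_val Qletter w).
Proof.
move=> cN TN Tw.
apply: (inspan_submod (a := La) (b := Lb) (c := Lc)) cN TN Tw.
- exact: La_unit.
- exact: Lb_unit.
- exact: Lc_unit.
- by move=> i _; exact: Qelt_inverse.
- exact: Qletter_cubic.
- by move=> i j i_m j_m ij; rewrite -!QeltM sigma_comm.
- by move=> i j i_m j_m ij; rewrite -!QeltM sigma_braid.
- exact: Qletter_mixed.
Qed.

Lemma Qelt_word g : exists2 w, wlt m.+1 w & QE g = word_val Qletter w.
Proof.
elim/braid_ind: g => w; exists [seq (val l.1, l.2) | l <- w].
  by rewrite /wlt all_map; apply/allP => l _ /=.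
elim: w => [|[i e] w IH]; first by rewrite /word_val big_nil; exact: Qelt1.
rewrite /word_val /= big_cons -/(word_val _ _) -IH -[_ :: w]cat1s -bmulE QeltM; congr (QE _ * _).
rewrite /= /sigma inord_val; case: e => //=.
rewrite -[RHS]mulg1 -(_ : artin i * bword [:: (i, false)] = 1)%g ?mulKg //.
by rewrite [LHS]bmulE; apply/bwordP; exact: braid_eq_cancel.
Qed.

Lemma submod_span (V : lmodType laurent3) (S : set V) : is_submod (Defs.span S).
Proof.
split.
- by exists 0, (fun=> 0), (fun=> 0); split=> [[]//|]; rewrite big_ord0.
- move=> _ _ [m1 [k [v [Sv ->]]]] [m2 [l [u [Su ->]]]].
  exists (m1 + m2), (fun i => match split i with inl j => k j | inr j => l j end),
    (fun i => match split i with inl j => v j | inr j => u j end).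
  split=> [i|]; first by case: split.
  rewrite big_split_ord /=; congr (_ + _); apply: eq_bigr => i _.
    by rewrite -[lshift _ i]/(unsplit (inl i)) unsplitK.
  by rewrite -[rshift _ i]/(unsplit (inr i)) unsplitK.
- move=> k _ [m1 [l [v [Sv ->]]]]; exists m1, (fun i => k * l i), v; split=> //.
  by rewrite scaler_sumr; apply: eq_bigr => i _; rewrite scalerA.
Qed.

Lemma mem_span (V : lmodType laurent3) (S : set V) x : S x -> Defs.span S x.
Proof. by move=> Sx; exists 1, (fun=> 1), (fun=> x); rewrite big_ord1 scale1r. Qed.

Lemma Q_span_words (x : Q n) (S : set (Q n)) :
  (forall w, wlt m.+1 w -> Defs.span S (word_val Qletter w)) -> Defs.span S x.
Proof.
move=> Sw; have [S0 SD SZ] := submod_span S.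
elim/qalg_ind: x => x; elim/galg_ind: x => [|x y Sx Sy|p g].
- by rewrite (_ : qproj _ 0 = 0).
- by rewrite qprojD; exact: SD.
- rewrite qprojZ; apply: SZ; have [w /Sw] := Qelt_word g.
  by rewrite /Qelt => ? ->.
Qed.
End QuotientLetters.

(** * Finite generation and the equality with Q_5^(3) *)

Lemma fin_gen_Q5 : fin_gen (Q 5).
Proof.
have [L LP] := fin_span_wlt4; exists (size L), (fun i =>
  word_val (@Qletter 3) (tnth (in_tuple L) i)).
apply/seteqP; split=> // x _; apply: Q_span_words => w /LP Lw.
apply: (Qletter_inspan_submod _ _ Lw); first exact: submod_span.
move=> t tL; apply: mem_span => /=.
have /tnthP [i ->] : t \in in_tuple L by [].
by exists i.
Qed.

Lemma submod_Q4in5 : is_submod Q4in5.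
Proof.
split; [|exact: subalg_genD|exact: subalg_genZ].
by rewrite -[0](scale0r (1 : Q 5)); apply: subalg_genZ; exact: subalg_gen1.
Qed.

Lemma Q4in5_word w : wlt 3 w -> Q4in5 (word_val (@Qletter 3) w).
Proof.
elim: w => [_|[i e] w IH /andP [/= i3 /IH Qw]]; rewrite /word_val ?big_nil ?big_cons;
  first exact: subalg_gen1.
apply: subalg_genM => //.
have Qi : Q4in5 (Qletter 3 (i, true)).
  by apply: subalg_gen_in; exists (inord i) => //=; rewrite inordK // ltnW.
case: e => //; apply: (submod_invunsq La_unit Lb_unit Lc_unit _ _ submod_Q4in5 _ Qi).
- exact: Qelt_inverse.
- exact/Qletter_cubic/ltnW.
- exact: subalg_genM.
- exact: subalg_gen1.
Qed.

Lemma u4_1 : u4 1.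
Proof. by exists 1, 0, 0; rewrite !scale0r !addr0 scale1r. Qed.

Lemma u4_letter e : u4 (Qletter 3 (3, e)).
Proof.
have s3 : sigma 3 3 = @artin 5 (ord_max : 'I_4) by congr artin; apply: val_inj; rewrite /= inordK.
by rewrite /Qletter /= s3; case: e; [exists 0, 1, 0|exists 0, 0, 1];
  rewrite !scale0r scale1r ?addr0 ?add0r.
Qed.

Lemma word_val_factorization k w : wlt 4 w -> (cnt 3 w <= k)%N ->
  exists (x0 : Q 5) (u x : 'I_k -> Q 5),
    [/\ Q4in5 x0, forall i, u4 (u i), forall i, Q4in5 (x i) &
      word_val (@Qletter 3) w = x0 * \prod_(i < k) (u i * x i)].
Proof.
elim: k w => [|k IH] w w4.
  rewrite leqn0 => /eqP w0; exists (word_val (@Qletter 3) w), (fun=> 0), (fun=> 0).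
  by split=> [|[]|[]|] //; [exact/Q4in5_word/cnt_wlt|rewrite big_ord0 mulr1].
case E : (cnt 3 w) => [|j] jk.
  (* The word has no s_4 here, so all [k.+1] factors are filled up with 1. *)
  exists (word_val (@Qletter 3) w), (fun=> 1), (fun=> 1); split=> [|_|_|].
  - exact/Q4in5_word/cnt_wlt.
  - exact: u4_1.
  - exact: subalg_gen1.
  - by rewrite big1 ?mulr1 // => i _; rewrite mulr1.
have [x [e [y [-> x3 y4 yj]]]] := cnt_split w4 E.
have [|y0 [u [v [Qy0 uu Qv yE]]]] := IH y y4; first by rewrite yj.
exists (word_val (@Qletter 3) x), (fun i => oapp u (Qletter 3 (3%N, e)) (unlift ord0 i)),
  (fun i => oapp v y0 (unlift ord0 i)); split=> [|i|i|].
- exact: Q4in5_word.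
- by case: unliftP => [i'|] _ //=; exact: u4_letter.
- by case: unliftP => [i'|] _ /=.
rewrite word_val_cat /word_val big_cons -!/(word_val _ _) yE big_ord_recl unlift_none /= !mulrA.
by congr (_ * _); apply: eq_bigr => i _; rewrite liftK.
Qed.

Theorem theorem5p7 : fin_gen (Q 5) /\ Q5pow 3 = [set: Q 5]%classic.
Proof.
split; first exact: fin_gen_Q5.
apply/seteqP; split=> // x _; apply: Q_span_words => w w4.
apply: (Qletter_inspan_submod _ _ (inspan_wlt w4 (F3P w4))); first exact: submod_span.
by move=> t [tF t4]; apply: mem_span; exact: word_val_factorization.
Qed.
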